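(* Let $R$ be a commutative ring with unity ($1\neq 0$), let $G$ be an amenable group, and let $G\to\Gamma$ be a group homomorphism whose kernel lies in Strebel's class $D(R)$. Let $n$ be an integer and let $C_*$ be a bounded below chain complex over $\mathbb{Z}G$ such that $C_i$ is a finitely generated free $\mathbb{Z}G$-module for each $i\le n$. If $H_i(C_*\otimes_{\mathbb{Z}G}R\Gamma)=0$ for all $i\le n$, then $\dim^{(2)}H_i(C_*\otimes_{\mathbb{Z}G}\mathcal{N}G)=0$ for all $i\le n$.
   Context: Groups $G$ for which the von Neumann algebra is considered are countable and discrete. $\mathcal{N}G$ is the group von Neumann algebra of $G$. The $L^2$-dimension $\dim^{(2)}M\in[0,\infty]$ of an $\mathcal{N}G$-module $M$ is L\''uck's extended von Neumann dimension: for a finitely generated projective module $P$, $\dim^{(2)}P$ is the von Neumann trace of a (projection) matrix over $\mathcal{N}G$ whose row space is isomorphic to $P$; for arbitrary $M$, $\dim^{(2)}M=\sup\{\dim^{(2)}P\}$ over finitely generated projective submodules $P\subset M$. $R\Gamma$ is a $\mathbb{Z}G$-module via the ring homomorphism $\mathbb{Z}G\to R\Gamma$ induced by $G\to\Gamma$. For a commutative ring $R$ with unity, a group $N$ lies in Strebel's class $D(R)$ if for every homomorphism $f\colon P\to Q$ between projective $RN$-modules such that $f\otimes 1_R\colon P\otimes_{RN}R\to Q\otimes_{RN}R$ is injective (where $R$ has trivial $N$-action), $f$ itself is injective. *)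

(* Defs.v *)
(* A right module over a ring A is a left module over the converse ring A^c:
   m . a is (a : A^c) *: m. Rings are pzRingType (1 = 0 is not excluded by the
   structure), so that no nontriviality proof is needed for the rings built
   here. *)

From HB Require Import structures.
From mathcomp Require Import all_boot all_order all_algebra finmap complex.
From mathcomp.multinomials Require Import monalg.
From mathcomp Require Import ring lra.
From mathcomp Require Import fsbigop boolp classical_sets functions cardinality.
From mathcomp Require Import reals constructive_ereal ereal esum.

Set Implicit Arguments.
Unset Strict Implicit.
Unset Printing Implicit Defensive.

Import Order.TTheory GRing.Theory Num.Theory.
Local Open Scope quotient_scope.
Local Open Scope ring_scope.

Section MalgLift.
Variables (A : zmodType) (K : choiceType) (V : zmodType).
Implicit Types (x y : {malg A[K]}).

Definition malg_lift (F : K -> A -> V) (x : {malg A[K]}) : V :=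
  \sum_(k <- msupp x) F k x@_k.

Section Additive.
Variable F : K -> A -> V.
Hypothesis F_add : forall k, zmod_morphism (F k).

Let F0 k : F k 0 = 0.
Proof. by rewrite -[in LHS](subrr 0) F_add subrr. Qed.

Lemma malg_liftEw (d : {fset K}) x : (msupp x `<=` d)%fset ->
  malg_lift F x = \sum_(k <- d) F k x@_k.
Proof.
move=> led; rewrite /malg_lift (big_fset_incl _ led) // => k _ /mcoeff_outdom ->.
exact: F0.
Qed.

Lemma malg_lift_is_zmod_morphism : zmod_morphism (malg_lift F).
Proof.
move=> x y; pose d := (msupp x `|` msupp y)%fset.
rewrite !(@malg_liftEw d) ?fsubsetUl ?fsubsetUr ?msuppB_le //.
by rewrite -sumrB; apply: eq_bigr => k _; rewrite mcoeffB F_add.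
Qed.

Lemma malg_liftU a k : malg_lift F << a *g k >> = F k a.
Proof.
rewrite (@malg_liftEw [fset k]%fset) ?msuppU_le // big_seq_fset1.
by rewrite mcoeffUU.
Qed.

End Additive.

Lemma malg_liftB (F F1 F2 : K -> A -> V) x :
  (forall k a, F k a = F1 k a - F2 k a) ->
  malg_lift F x = malg_lift F1 x - malg_lift F2 x.
Proof. by move=> FE; rewrite -sumrB; apply: eq_bigr. Qed.

Lemma malg_additive_ext (f g : {malg A[K]} -> V) :
  zmod_morphism f -> zmod_morphism g ->
  (forall a k, f << a *g k >> = g << a *g k >>) -> f =1 g.
Proof.
move=> fD gD fg x.
pose F := GRing.isZmodMorphism.Build _ _ f fD.
pose G := GRing.isZmodMorphism.Build _ _ g gD.
pose f' : {additive _ -> _} := HB.pack f F.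
pose g' : {additive _ -> _} := HB.pack g G.
rewrite -[f]/(f' : _ -> _) -[g]/(g' : _ -> _) [x]monalgE !raddf_sum.
by apply: eq_bigr => k _; apply: fg.
Qed.

End MalgLift.

Section Composition.
Variables (U V W : zmodType).
Lemma zmod_morphismD (f : U -> V) : zmod_morphism f -> {morph f : x y / x + y}.
Proof.
move=> fD; pose F := GRing.isZmodMorphism.Build _ _ f fD.
pose f' : {additive _ -> _} := HB.pack f F; exact: (raddfD f').
Qed.

Lemma zmod_morphism_comp (f : V -> W) (g : U -> V) :
  zmod_morphism f -> zmod_morphism g -> zmod_morphism (f \o g).
Proof. by move=> fD gD x y /=; rewrite gD fD. Qed.
End Composition.

(* The underlying group of A[G] is that of finitely supported functions; the
   ring structure of {malg A[G]} in the library requires a monoid without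
   nontrivial units, hence the convolution product below. *)
Definition grpring (A : pzRingType) (G : groupType) := {malg A[G]}.

Section GroupRing.
Variables (A : pzRingType) (G : groupType).
Local Notation AG := (grpring A G).
Implicit Types (x y z : AG).

HB.instance Definition _ := GRing.Zmodule.on AG.

Definition gr (a : A) (g : G) : AG := << a *g g >>.

Definition gr_one : AG := gr 1 1%g.
Definition gr_mul x y : AG :=
  malg_lift (fun g a => malg_lift (fun h b => gr (a * b) (g * h)%g) y) x.

Lemma gr_is_zmod_morphism g : zmod_morphism (gr^~ g).
Proof. by move=> a b; rewrite /gr monalgUB. Qed.

Lemma gr_mul_inner (a : A) g :
  zmod_morphism (malg_lift (fun h b => gr (a * b) (g * h)%g)).
Proof.
apply: malg_lift_is_zmod_morphism => h b c.
by rewrite mulrBr gr_is_zmod_morphism.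
Qed.

Lemma gr_mulBr x : zmod_morphism (gr_mul x).
Proof. by move=> y z; apply: malg_liftB => g a; apply: gr_mul_inner. Qed.

Lemma gr_mulBl y : zmod_morphism (gr_mul^~ y).
Proof.
apply: (malg_lift_is_zmod_morphism
  (F := fun g a => malg_lift (fun h b => gr (a * b) (g * h)%g) y)) => g a b.
by apply: malg_liftB => h c; rewrite mulrBl gr_is_zmod_morphism.
Qed.

Lemma gr_mulUU a b g h : gr_mul (gr a g) (gr b h) = gr (a * b) (g * h)%g.
Proof.
rewrite /gr_mul malg_liftU => [|k c d]; last first.
  by apply: malg_liftB => l e; rewrite mulrBl gr_is_zmod_morphism.
by rewrite malg_liftU // => k c d; rewrite mulrBr gr_is_zmod_morphism.
Qed.

Lemma gr_mulA : associative gr_mul.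
Proof.
move=> x y z; have idA : zmod_morphism (@id AG) by [].
move: z; apply: malg_additive_ext; [|exact: gr_mulBr|].
  exact: zmod_morphism_comp (gr_mulBr _) (gr_mulBr _).
move=> c l; move: y; apply: malg_additive_ext.
- exact: zmod_morphism_comp (gr_mulBr _) (gr_mulBl _).
- exact: zmod_morphism_comp (gr_mulBl _) (gr_mulBr _).
move=> b h; move: x; apply: malg_additive_ext.
- exact: gr_mulBl.
- exact: zmod_morphism_comp (gr_mulBl _) (gr_mulBl _).
by move=> a g; rewrite !gr_mulUU mulrA mulgA.
Qed.

Lemma gr_mul1r : left_id gr_one gr_mul.
Proof.
apply: malg_additive_ext; [exact: gr_mulBr|by []|move=> b h].
by rewrite gr_mulUU mul1r mul1g.
Qed.

Lemma gr_mulr1 : right_id gr_one gr_mul.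
Proof.
apply: malg_additive_ext; [exact: gr_mulBl|by []|move=> b h].
by rewrite gr_mulUU mulr1 mulg1.
Qed.

Lemma gr_mulDl : left_distributive gr_mul +%R.
Proof. by move=> x y z; apply: (zmod_morphismD (gr_mulBl z)). Qed.

Lemma gr_mulDr : right_distributive gr_mul +%R.
Proof. by move=> x y z; apply: (zmod_morphismD (gr_mulBr x)). Qed.

HB.instance Definition _ := GRing.Zmodule_isPzRing.Build AG
  gr_mulA gr_mul1r gr_mulr1 gr_mulDl gr_mulDr.

Lemma gr_mulE a b g h : gr a g * gr b h = gr (a * b) (g * h)%g.
Proof. exact: gr_mulUU. Qed.

Lemma gr1E : 1 = gr 1 1%g.
Proof. by []. Qed.

End GroupRing.

Section GroupRingLift.
Variables (A B : pzRingType) (G : groupType).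

(* The ring morphism sum_g a_g g |-> sum_g f(a_g) u(g). *)
Definition gr_lift_spec (f : {rmorphism A -> B}) (u : G -> B) :=
  [/\ u 1%g = 1, {morph u : g h / (g * h)%g >-> g * h}
    & forall a g, GRing.comm (f a) (u g)].

Definition gr_lift (f : {rmorphism A -> B}) (u : G -> B)
  of gr_lift_spec f u := malg_lift (fun g a => f a * u g) : grpring A G -> B.

Variables (f : {rmorphism A -> B}) (u : G -> B) (fu : gr_lift_spec f u).

Lemma gr_lift_coef_additive g : zmod_morphism (fun a => f a * u g).
Proof. by move=> a b; rewrite rmorphB mulrBl. Qed.

Lemma gr_lift_is_zmod_morphism : zmod_morphism (gr_lift fu).
Proof. exact/malg_lift_is_zmod_morphism/gr_lift_coef_additive. Qed.

HB.instance Definition _ :=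
  GRing.isZmodMorphism.Build _ _ (gr_lift fu) gr_lift_is_zmod_morphism.

Lemma gr_liftE a g : gr_lift fu (gr a g) = f a * u g.
Proof. exact/malg_liftU/gr_lift_coef_additive. Qed.

Lemma gr_lift_is_monoid_morphism : monoid_morphism (gr_lift fu).
Proof.
have [u1 uM fuC] := fu; split; first by rewrite gr1E gr_liftE rmorph1 u1 mulr1.
move=> x y; move: y; apply: malg_additive_ext.
- by move=> y z /=; rewrite mulrBr raddfB.
- by move=> y z /=; rewrite raddfB mulrBr.
move=> b h; move: x; apply: malg_additive_ext.
- by move=> y z /=; rewrite mulrBl raddfB.
- by move=> y z /=; rewrite raddfB mulrBl.
move=> a g; rewrite gr_mulE !gr_liftE rmorphM uM -!mulrA; congr (_ * _).
by rewrite !mulrA fuC.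
Qed.

HB.instance Definition _ :=
  GRing.isMonoidMorphism.Build _ _ (gr_lift fu) gr_lift_is_monoid_morphism.

End GroupRingLift.

Section IntLift.
Variables (B : pzRingType) (G : groupType) (u : G -> B).
Hypothesis u1 : u 1%g = 1.
Hypothesis uM : {morph u : g h / (g * h)%g >-> g * h}.
Lemma int_lift_spec : gr_lift_spec (intmul (1 : B)) u.
Proof. by split=> // a g; apply/commr_sym/commr_int. Qed.
End IntLift.

Lemma augmentation_spec (A : pzRingType) (G : groupType) :
  gr_lift_spec (idfun : {rmorphism A -> A}) (fun _ : G => 1).
Proof. by split=> [//|g h|a g]; [rewrite mulr1|apply: commr1]. Qed.

Definition augmentation (A : pzRingType) (G : groupType) :
  {rmorphism grpring A G -> A} := gr_lift (@augmentation_spec A G).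

Section GroupRingMap.
Variables (A : pzRingType) (G H : groupType) (phi : {multiplicative G -> H}).

Lemma gmul_one : phi 1%g = 1%g.
Proof. by apply: (@mulIg _ (phi 1%g)); rewrite -gmulfM !mul1g. Qed.

Lemma gr_map_spec :
  gr_lift_spec (intmul (1 : grpring A H)) (fun g => gr 1 (phi g)).
Proof.
apply: int_lift_spec; first by rewrite gmul_one.
by move=> g h; rewrite gr_mulE mulr1 gmulfM.
Qed.

Definition gr_map : {rmorphism grpring int G -> grpring A H} :=
  gr_lift gr_map_spec.

Definition gker_pred : {pred G} := fun g => phi g == 1%g.

Lemma gker_group_closed : group_closed gker_pred.
Proof.
split=> [|g h]; first by rewrite unfold_in gmul_one.
rewrite !unfold_in => /eqP g1 /eqP h1.
apply/eqP/(@mulIg _ (phi h)); rewrite -gmulfM mulgVK h1 g1 mul1g.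
by [].
Qed.
Definition gker := {g : G | g \in gker_pred}.
HB.instance Definition _ := SubChoice.copy gker {g : G | g \in gker_pred}.
HB.instance Definition _ :=
  SubChoice_isSubGroup.Build G gker_pred gker gker_group_closed.

End GroupRingMap.

Section Submodules.
Variables (A : pzRingType) (M : lmodType A).

Definition submod (S : submodClosed M) := {x : M | x \in S}.
HB.instance Definition _ (S : submodClosed M) :=
  SubChoice.copy (submod S) {x : M | x \in S}.
HB.instance Definition _ (S : submodClosed M) :=
  [SubChoice_isSubLmodule of submod S by <:].

Variable S : submodClosed M.
Definition submod_pred : {pred M} := fun x => x \in S.
HB.instance Definition _ := GRing.isZmodClosed.Build M submod_pred
  (GRing.subsemimod_closedB (GRing.subsemimodClosedP S)).

Definition quotmod := {ideal_quot submod_pred}.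
HB.instance Definition _ := GRing.Zmodule.on quotmod.

Definition quotmod_pi (x : M) : quotmod := \pi_{ideal_quot submod_pred} x.
Definition quotmod_scale (a : A) (q : quotmod) : quotmod :=
  quotmod_pi (a *: repr (q : {ideal_quot submod_pred})).

Lemma quotmod_piP x y : reflect (quotmod_pi x = quotmod_pi y) (x - y \in S).
Proof. by rewrite -[_ \in S]/(_ \in submod_pred) Quotient.idealrBE; apply: eqP. Qed.

Lemma quotmod_pi_is_zmod_morphism : zmod_morphism quotmod_pi.
Proof. by move=> x y; rewrite /quotmod_pi raddfB. Qed.

Lemma quotmod_piK (q : quotmod) : quotmod_pi (repr (q : {ideal_quot submod_pred})) = q.
Proof. exact: reprK. Qed.

Lemma quotmod_scale_pi a x : quotmod_scale a (quotmod_pi x) = quotmod_pi (a *: x).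
Proof.
by apply/quotmod_piP; rewrite -scalerBr rpredZ //; apply/quotmod_piP/quotmod_piK.
Qed.

Let quotmod_ind (P : quotmod -> Prop) : (forall x, P (quotmod_pi x)) -> forall q, P q.
Proof. by move=> Ppi q; rewrite -[q]quotmod_piK. Qed.

Let quotmod_piD := zmod_morphismD quotmod_pi_is_zmod_morphism.

Lemma quotmod_scalerA a b q :
  quotmod_scale a (quotmod_scale b q) = quotmod_scale (a * b) q.
Proof. by elim/quotmod_ind: q => x; rewrite !quotmod_scale_pi scalerA. Qed.
Lemma quotmod_scale1r : left_id 1 quotmod_scale.
Proof. by elim/quotmod_ind=> x; rewrite quotmod_scale_pi scale1r. Qed.
Lemma quotmod_scalerDr : right_distributive quotmod_scale +%R.
Proof.
move=> a; elim/quotmod_ind=> x; elim/quotmod_ind=> y.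
by rewrite -quotmod_piD !quotmod_scale_pi scalerDr quotmod_piD.
Qed.
Lemma quotmod_scalerDl q : {morph quotmod_scale^~ q : a b / a + b}.
Proof.
elim/quotmod_ind: q => x a b.
by rewrite !quotmod_scale_pi scalerDl quotmod_piD.
Qed.

HB.instance Definition _ := GRing.Zmodule_isLmodule.Build A quotmod
  quotmod_scalerA quotmod_scale1r quotmod_scalerDr quotmod_scalerDl.

End Submodules.

Section ModulePredicates.
Variables (A : pzRingType).

Definition projective (P : lmodType A) : Prop :=
  forall (M N : lmodType A) (p : {linear M -> N}) (h : {linear P -> N}),
    (forall y, exists x, p x = y) -> exists k : {linear P -> M}, p \o k =1 h.

Definition finitely_generated (M : lmodType A) : Prop :=
  exists (k : nat) (v : 'I_k -> M),
    forall x, exists c : 'I_k -> A, x = \sum_i c i *: v i.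

Definition isomorphic (M N : lmodType A) : Prop :=
  exists f : {linear M -> N}, bijective f.

Definition fg_free (M : lmodType A) : Prop :=
  exists k : nat, isomorphic 'rV[A]_k M.

Definition trivial_module (M : lmodType A) : Prop := forall x : M, x = 0.
End ModulePredicates.

Section Tensor.
Variables (A : pzRingType) (M : lmodType A^c) (N : lmodType A).

Local Notation F := {malg int[(M * N)%type]}.
Local Notation "[[ m , n ]]" := (<< 1%Z *g (m, n) >> : F).

Inductive tensor_rel : F -> Prop :=
| TensorDl (m m' : M) (n : N) : tensor_rel ([[m + m', n]] - [[m, n]] - [[m', n]])
| TensorDr (m : M) (n n' : N) : tensor_rel ([[m, n + n']] - [[m, n]] - [[m, n']])
| TensorZ (m : M) (a : A) (n : N) : tensor_rel ([[(a : A^c) *: m, n]] - [[m, a *: n]]).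

(* The subgroup generated by the relations, as the intersection of all
   subgroups containing them. *)
Definition tensor_null : {pred F} := fun z =>
  `[< forall S : zmodClosed F, (forall r, tensor_rel r -> r \in S) -> z \in S >].

Lemma tensor_null_zmod_closed : zmod_closed tensor_null.
Proof.
split=> [|x y]; first by apply/asboolP => S _; exact: rpred0.
move=> /asboolP Sx /asboolP Sy; apply/asboolP => S relS.
by rewrite rpredB ?Sx ?Sy.
Qed.
HB.instance Definition _ :=
  GRing.isZmodClosed.Build F tensor_null tensor_null_zmod_closed.

Definition tensor := {ideal_quot (tensor_null : zmodClosed F)}.
HB.instance Definition _ := GRing.Zmodule.on tensor.

Definition tens (m : M) (n : N) : tensor :=
  \pi_{ideal_quot (tensor_null : zmodClosed F)} [[m, n]].

Definition balanced (V : zmodType) (b : M -> N -> V) :=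
  [/\ forall n, {morph b^~ n : m m' / m + m'},
      forall m, {morph b m : n n' / n + n'}
    & forall m (a : A) n, b ((a : A^c) *: m) n = b m (a *: n)].

Let pi_tens (z : F) : tensor := \pi_{ideal_quot (tensor_null : zmodClosed F)} z.
Let pi_tensB : zmod_morphism pi_tens.
Proof. by move=> x y; rewrite /pi_tens raddfB. Qed.
Let pi_tensP x y : reflect (pi_tens x = pi_tens y) (x - y \in tensor_null).
Proof.
rewrite -[_ \in _]/(_ \in (tensor_null : zmodClosed F)) Quotient.idealrBE.
exact: eqP.
Qed.
Let pi_tens0 r : tensor_rel r -> pi_tens r = 0.
Proof.
move=> relr; have -> : 0 = pi_tens 0 by rewrite -(subrr r) pi_tensB subrr.
by apply/pi_tensP; rewrite subr0; apply/asboolP => S; apply.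
Qed.

Lemma tens_balanced : balanced tens.
Proof.
split=> [n m m'|m n n'|m a n].
- have /pi_tens0 := TensorDl m m' n; rewrite !pi_tensB -addrA -opprD.
  by move/subr0_eq.
- have /pi_tens0 := TensorDr m n n'; rewrite !pi_tensB -addrA -opprD.
  by move/subr0_eq.
by have /pi_tens0 := TensorZ m a n; rewrite !pi_tensB => /subr0_eq.
Qed.

(* Meaningful for balanced b only, see tens_liftE. *)
Definition tens_lift (V : zmodType) (b : M -> N -> V) (t : tensor) : V :=
  malg_lift (fun k z => b k.1 k.2 *~ z)
    (repr (t : {ideal_quot (tensor_null : zmodClosed F)})).

Section Lift.
Variables (V : zmodType) (b : M -> N -> V) (bal : balanced b).
Let bZ k : zmod_morphism (fun z => b k.1 k.2 *~ z).
Proof. by move=> z z'; rewrite mulrzBr. Qed.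
Let flift := malg_lift (fun k z => b k.1 k.2 *~ z).
Let fliftB : zmod_morphism flift := malg_lift_is_zmod_morphism bZ.
Let fliftU m n : flift [[m, n]] = b m n.
Proof. exact: malg_liftU bZ _ _. Qed.

Definition flift_ker : {pred F} := fun z => flift z == 0.
Lemma flift_ker_closed : zmod_closed flift_ker.
Proof.
split=> [|x y]; first by rewrite unfold_in /flift_ker -(subrr (0 : F)) fliftB subrr.
by rewrite !unfold_in /flift_ker fliftB => /eqP -> /eqP ->; rewrite subr0.
Qed.
HB.instance Definition _ :=
  GRing.isZmodClosed.Build F flift_ker flift_ker_closed.

Let flift_null z : z \in tensor_null -> flift z = 0.
Proof.
have [bDl bDr bA] := bal.
move/asboolP/(_ (flift_ker : zmodClosed F)) => zker; apply/eqP/zker => _ [].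
- by move=> m m' n; rewrite unfold_in /flift_ker !fliftB !fliftU bDl -addrA -opprD subrr.
- by move=> m n n'; rewrite unfold_in /flift_ker !fliftB !fliftU bDr -addrA -opprD subrr.
- by move=> m a n; rewrite unfold_in /flift_ker !fliftB !fliftU bA subrr.
Qed.

Let tens_lift_pi z : tens_lift b (pi_tens z) = flift z.
Proof.
apply/eqP; rewrite -subr_eq0 -fliftB; apply/eqP/flift_null/pi_tensP.
exact: reprK.
Qed.

Lemma tens_liftE m n : tens_lift b (tens m n) = b m n.
Proof. by rewrite tens_lift_pi fliftU. Qed.

Lemma tens_lift_is_zmod_morphism : zmod_morphism (tens_lift b).
Proof.
move=> t u; have [x ->] : exists x, t = pi_tens x.
  by exists (repr (t : {ideal_quot (tensor_null : zmodClosed F)})); rewrite /pi_tens reprK.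
have [y ->] : exists y, u = pi_tens y.
  by exists (repr (u : {ideal_quot (tensor_null : zmodClosed F)})); rewrite /pi_tens reprK.
by rewrite -pi_tensB !tens_lift_pi fliftB.
Qed.
End Lift.

Lemma tens_additive_ext (V : zmodType) (f g : tensor -> V) :
  zmod_morphism f -> zmod_morphism g ->
  (forall m n, f (tens m n) = g (tens m n)) -> f =1 g.
Proof.
move=> fB gB fg t.
rewrite -[t](@reprK _ {ideal_quot (tensor_null : zmodClosed F)}).
move: (repr _); apply: malg_additive_ext.
- exact: zmod_morphism_comp fB pi_tensB.
- exact: zmod_morphism_comp gB pi_tensB.
move=> z [m n].
suff -> : << z *g (m, n) >> = [[m, n]] *~ z :> F.
  pose f' : {additive _ -> _} := HB.pack f (GRing.isZmodMorphism.Build _ _ f fB).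
  pose g' : {additive _ -> _} := HB.pack g (GRing.isZmodMorphism.Build _ _ g gB).
  rewrite -[f]/(f' : _ -> _) -[g]/(g' : _ -> _) !raddfMz; congr (_ *~ z).
  exact: fg.
by rewrite -raddfMz /= intz.
Qed.

End Tensor.

Section TensorMap.
Variables (A : pzRingType) (M M' : lmodType A^c) (N N' : lmodType A).
Variables (f : {linear M -> M'}) (g : {linear N -> N'}).

Definition tens_map : tensor M N -> tensor M' N' :=
  tens_lift (fun m n => tens (f m) (g n)).

Lemma tens_map_balanced : balanced (fun m n => tens (f m) (g n)).
Proof.
have [tDl tDr tA] := tens_balanced M' N'.
split=> [n m m'|m n n'|m a n]; first by rewrite linearD tDl.
  by rewrite linearD tDr.
by rewrite !linearZ tA.
Qed.

Lemma tens_mapE m n : tens_map (tens m n) = tens (f m) (g n).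
Proof. exact: tens_liftE tens_map_balanced _ _. Qed.

Lemma tens_map_is_zmod_morphism : zmod_morphism tens_map.
Proof. exact: tens_lift_is_zmod_morphism tens_map_balanced. Qed.
End TensorMap.

Section BaseChange.
Variables (A B : pzRingType) (f : {rmorphism A -> B}).

(* B as a left A-module through f. *)
Definition restr of {rmorphism A -> B} : Type := B.
HB.instance Definition _ := GRing.Zmodule.copy (restr f) B.
Definition restr_scale (a : A) (b : restr f) : restr f := f a * (b : B).

Lemma restr_scalerA a b x :
  restr_scale a (restr_scale b x) = restr_scale (a * b) x.
Proof. by rewrite /restr_scale rmorphM mulrA. Qed.
Lemma restr_scale1r : left_id 1 restr_scale.
Proof. by move=> x; rewrite /restr_scale rmorph1 mul1r. Qed.
Lemma restr_scalerDr : right_distributive restr_scale +%R.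
Proof. by move=> a x y; rewrite /restr_scale mulrDr. Qed.
Lemma restr_scalerDl x : {morph restr_scale^~ x : a b / a + b}.
Proof. by move=> a b; rewrite /restr_scale rmorphD mulrDl. Qed.
HB.instance Definition _ := GRing.Zmodule_isLmodule.Build A (restr f)
  restr_scalerA restr_scale1r restr_scalerDr restr_scalerDl.

Definition restr_mulr (c : B) (b : restr f) : restr f := (b : B) * c.
Lemma restr_mulr_is_linear c : linear (restr_mulr c).
Proof. by move=> a x y; rewrite /restr_mulr mulrDl -mulrA. Qed.
HB.instance Definition _ c :=
  GRing.isLinear.Build A (restr f) (restr f) *:%R (restr_mulr c)
    (restr_mulr_is_linear c).

Variable M : lmodType A^c.
Definition basechange := tensor M (restr f).
HB.instance Definition _ := GRing.Zmodule.on basechange.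

(* M (x)_A B as a right B-module: (m (x) b) . c = m (x) (b * c). *)
Definition bc_scale (c : B^c) (t : basechange) : basechange :=
  tens_map idfun (restr_mulr c) t.

Lemma bc_scaleE c m b : bc_scale c (tens m b) = tens m (restr_mulr c b).
Proof. exact: tens_mapE. Qed.

Let bc_scaleB c : zmod_morphism (bc_scale c).
Proof. exact: tens_map_is_zmod_morphism. Qed.

Lemma bc_scalerA c d t : bc_scale c (bc_scale d t) = bc_scale (c * d) t.
Proof.
move: t; apply: tens_additive_ext => //.
  exact: zmod_morphism_comp (bc_scaleB c) (bc_scaleB d).
by move=> m b; rewrite !bc_scaleE /restr_mulr -mulrA.
Qed.
Lemma bc_scale1r : left_id 1 bc_scale.
Proof.
apply: tens_additive_ext => // m b.
by rewrite bc_scaleE /restr_mulr mulr1.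
Qed.
Lemma bc_scalerDr : right_distributive bc_scale +%R.
Proof. by move=> c; apply: zmod_morphismD. Qed.
Lemma bc_scalerDl t : {morph bc_scale^~ t : c d / c + d}.
Proof.
move=> c d; move: t; apply: tens_additive_ext => // [t u|m b].
  by rewrite !bc_scaleB opprD addrACA.
rewrite !bc_scaleE /restr_mulr mulrDr.
by have [_ -> _] := tens_balanced M (restr f).
Qed.
HB.instance Definition _ := GRing.Zmodule_isLmodule.Build B^c basechange
  bc_scalerA bc_scale1r bc_scalerDr bc_scalerDl.

End BaseChange.

Section BaseChangeMap.
Variables (A B : pzRingType) (f : {rmorphism A -> B}).
Variables (M M' : lmodType A^c) (u : {linear M -> M'}).

Definition bc_map : basechange f M -> basechange f M' := tens_map u idfun.

Lemma bc_map_is_linear : linear bc_map.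
Proof.
have uB : zmod_morphism bc_map by exact: tens_map_is_zmod_morphism.
move=> c t t'; rewrite (zmod_morphismD uB); congr (_ + _); move: t.
have cB (W : lmodType A^c) : zmod_morphism (@bc_scale _ _ f W c).
  exact: tens_map_is_zmod_morphism.
apply: tens_additive_ext.
- exact: zmod_morphism_comp uB (cB M).
- exact: zmod_morphism_comp (cB M') uB.
move=> m b; change (bc_map (bc_scale c (tens m b)) =
  bc_scale c (bc_map (tens m b))).
by rewrite bc_scaleE /bc_map !tens_mapE bc_scaleE.
Qed.
HB.instance Definition _ := GRing.isLinear.Build B^c (basechange f M)
  (basechange f M') *:%R bc_map bc_map_is_linear.
End BaseChangeMap.
Arguments bc_map {A B} f {M M'} u _.

(* The differential is indexed by its source and its target and vanishes unless
   the degree drops by one: d_i : C_i -> C_(i-1) is bdry i (i - 1). With a single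
   index, C_(i + 1 - 1) and C_i would be different types. *)
Record chain_complex (A : pzRingType) := ChainComplex {
  chain : int -> lmodType A;
  bdry : forall i j, {linear chain i -> chain j};
  bdry_shape : forall i j, i != j + 1 -> bdry i j =1 \0;
  bdry_bdry : forall i j k x, bdry j k (bdry i j x) = 0
}.

Definition bounded_below (A : pzRingType) (C : chain_complex A) : Prop :=
  exists b : int, forall i, i < b -> trivial_module (chain C i).

Section Homology.
Variables (A : pzRingType) (U V W : lmodType A).
Variables (f : {linear U -> V}) (g : {linear V -> W}).

Definition ker_pred : {pred V} := fun x => g x == 0.
Lemma ker_submod_closed : GRing.subsemimod_closed ker_pred.
Proof.
split; first split; rewrite ?unfold_in /ker_pred ?linear0 //.
  by move=> x y; rewrite !unfold_in linearD => /eqP -> /eqP ->; rewrite addr0.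
by move=> a x; rewrite !unfold_in linearZ => /eqP -> /=; rewrite scaler0.
Qed.
HB.instance Definition _ := GRing.isSubmodClosed.Build A V ker_pred
  ker_submod_closed.

Definition cycles := submod (ker_pred : submodClosed V).

Definition bnd_pred : {pred cycles} := fun z => `[< exists x, f x = val z >].
Lemma bnd_submod_closed : GRing.subsemimod_closed bnd_pred.
Proof.
split; first split.
- by apply/asboolP; exists 0; rewrite linear0.
- move=> x y /asboolP [u fu] /asboolP [v fv]; apply/asboolP.
  by exists (u + v); rewrite linearD fu fv.
- move=> a x /asboolP [u fu]; apply/asboolP.
  by exists (a *: u); rewrite linearZ fu.
Qed.
HB.instance Definition _ := GRing.isSubmodClosed.Build A cycles bnd_pred
  bnd_submod_closed.

(* ker g / im f, meant for g \o f = 0. *)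
Definition subquotient : lmodType A := quotmod (bnd_pred : submodClosed cycles).
End Homology.

Definition homology (A : pzRingType) (C : chain_complex A) (i : int) :
  lmodType A := subquotient (bdry C (i + 1) i) (bdry C i (i - 1)).

Section BaseChangeComplex.
Variables (A B : pzRingType) (f : {rmorphism A -> B}).
Variable C : chain_complex A^c.

Definition bc_chain (i : int) : lmodType B^c := basechange f (chain C i).
Definition bc_bdry (i j : int) : {linear bc_chain i -> bc_chain j} :=
  bc_map f (bdry C i j).

Lemma bc_bdry_shape i j : i != j + 1 -> bc_bdry i j =1 \0.
Proof.
move=> ij; apply: tens_additive_ext.
- exact: tens_map_is_zmod_morphism.
- by move=> x y; rewrite /= subr0.
move=> m b; change (bc_map f (bdry C i j) (tens m b) = 0).
rewrite /bc_map tens_mapE bdry_shape //=.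
have [tD _ _] := tens_balanced (chain C j) (restr f).
by apply: (@addIr _ (tens 0 b)); rewrite -tD addr0 add0r.
Qed.

Lemma bc_bdry_bdry i j k x : bc_bdry j k (bc_bdry i j x) = 0.
Proof.
move: x; apply: (@tens_additive_ext _ _ _ _ (bc_bdry j k \o bc_bdry i j) (fun=> 0)).
- by apply: zmod_morphism_comp; apply: tens_map_is_zmod_morphism.
- by move=> x y; rewrite subr0.
move=> m b; change (bc_map f (bdry C j k) (bc_map f (bdry C i j) (tens m b)) = 0).
rewrite /bc_map !tens_mapE bdry_bdry.
have [tD _ _] := tens_balanced (chain C k) (restr f).
by apply: (@addIr _ (tens 0 b)); rewrite -tD addr0 add0r.
Qed.

Definition bc_complex : chain_complex B^c := ChainComplex bc_bdry_shape bc_bdry_bdry.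
End BaseChangeComplex.

Definition strebel (R : comNzRingType) (N : groupType) : Prop :=
  forall (P Q : lmodType (grpring R N)^c) (f : {linear P -> Q}),
    projective P -> projective Q ->
    injective (bc_map (augmentation R N) f) -> injective f.

(* A left-invariant finitely additive probability measure on all subsets. *)
Definition amenable (K : realType) (G : groupType) : Prop :=
  exists m : set G -> K,
    [/\ forall S, 0 <= m S,
        m setT = 1,
        forall S T, (S `&` T = set0 -> m (S `|` T) = m S + m T)%classic
      & forall g S, m [set (g * h)%g | h in S]%classic = m S].

Section EllTwo.
Variables (K : realType) (G : groupType).
Local Notation C := (K[i]).
Implicit Types (x y : G -> C).

Definition sqnormc (z : C) : K := complex.Re z ^+ 2 + complex.Im z ^+ 2.
Definition sqnorm x : \bar K := (\esum_(g in [set: G]) (sqnormc (x g))%:E)%E.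

Definition ell2_pred : {pred G -> C} := fun x => (sqnorm x < +oo)%E.

Lemma sqnormc_ge0 z : 0 <= sqnormc z.
Proof. by rewrite addr_ge0 // sqr_ge0. Qed.

Lemma sqnorm_ge0 x : (0 <= sqnorm x)%E.
Proof. by apply: esum_ge0 => g _; rewrite lee_fin sqnormc_ge0. Qed.

Lemma sqnormcM z w : sqnormc (z * w) = sqnormc z * sqnormc w.
Proof. by case: z => a b; case: w => c d; rewrite /sqnormc /=; ring. Qed.

Lemma sqnormcD z w : sqnormc (z + w) <= (sqnormc z + sqnormc w) + (sqnormc z + sqnormc w).
Proof.
case: z => a b; case: w => c d; rewrite /sqnormc /=.
have := sqr_ge0 (a - c); have := sqr_ge0 (b - d); lra.
Qed.

Lemma sqnormD x y :
  (sqnorm (x + y)%R <= (sqnorm x + sqnorm y) + (sqnorm x + sqnorm y))%E.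
Proof.
have E0 u g : (0 <= (sqnormc (u g))%:E)%E by rewrite lee_fin sqnormc_ge0.
rewrite /sqnorm -!esumD; last first.
all: try by move=> g _; rewrite ?adde_ge0.
by apply: le_esum => g _; rewrite -!EFinD lee_fin sqnormcD.
Qed.

Lemma sqnormZ (a : C) x : (sqnorm (a *: x)%R <= (sqnormc a)%:E * sqnorm x)%E.
Proof.
apply: ge_ereal_sup => _ [X [finX _]] <-.
have -> : (\sum_(g \in X) (sqnormc ((a *: x) g))%:E
    = \sum_(g \in X) (sqnormc a * sqnormc (x g))%:E)%E.
  by apply: eq_fsbigr => g _; rewrite -sqnormcM.
under eq_fsbigr do rewrite EFinM.
rewrite -ge0_mule_fsumr; last by move=> g; rewrite lee_fin sqnormc_ge0.
apply: lee_wpmul2l; first by rewrite lee_fin sqnormc_ge0.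
by apply: ereal_sup_ubound; exists X.
Qed.

Lemma sqnorm0 : sqnorm 0 = 0%E.
Proof. by apply: esum1 => g _; rewrite /sqnormc /= expr0n addr0. Qed.

Lemma ell2_submod_closed : GRing.subsemimod_closed ell2_pred.
Proof.
split; first split.
- by rewrite unfold_in /ell2_pred sqnorm0 ltry.
- move=> x y; rewrite !unfold_in => xfin yfin.
  by apply: le_lt_trans (sqnormD x y) _; rewrite !lte_add_pinfty.
- move=> a x; rewrite !unfold_in => xfin; apply: le_lt_trans (sqnormZ a x) _.
  by apply: lte_mul_pinfty; rewrite // lee_fin sqnormc_ge0.
Qed.
HB.instance Definition _ := GRing.isSubmodClosed.Build C (G -> C) ell2_pred
  ell2_submod_closed.

Definition ell2 := submod (ell2_pred : submodClosed (G -> C)).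
HB.instance Definition _ := GRing.Lmodule.on ell2.

Definition ell2_val (x : ell2) : G -> C := val x.
Coercion ell2_val : ell2 >-> Funclass.

Lemma sqnorm_bij (s : G -> G) x : bijective s -> sqnorm (x \o s) = sqnorm x.
Proof.
move=> bij_s; rewrite /sqnorm [RHS](@reindex_esum _ _ _ setT setT s) //.
by rewrite setTT_bijective.
Qed.

Lemma ell2_reindex_subproof (s : G -> G) (bij_s : bijective s) (x : ell2) :
  ell2_val x \o s \in ell2_pred.
Proof. by rewrite unfold_in /ell2_pred sqnorm_bij //; exact: (valP x). Qed.
Definition ell2_reindex (s : G -> G) (bij_s : bijective s) (x : ell2) : ell2 :=
  Sub (ell2_val x \o s) (ell2_reindex_subproof bij_s x).

Lemma mulg_bij (g : G) : bijective (fun h : G => g^-1 * h)%g.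
Proof.
exists (fun h : G => g * h)%g => h; first by rewrite mulVKg.
by rewrite mulKg.
Qed.

Lemma mulgr_bij (g : G) : bijective (fun h : G => h * g)%g.
Proof.
exists (fun h : G => h * g^-1)%g => h; first by rewrite mulgK.
by rewrite mulgVK.
Qed.

Definition ltrans (g : G) : ell2 -> ell2 := ell2_reindex (mulg_bij g).
Definition rtrans (g : G) : ell2 -> ell2 := ell2_reindex (mulgr_bij g).

Lemma ell2P (x y : ell2) : (forall g, x g = y g) -> x = y.
Proof. by move=> xy; apply/val_inj/funext. Qed.

Lemma ltransE g (x : ell2) h : ltrans g x h = x (g^-1 * h)%g.
Proof. by []. Qed.
Lemma rtransE g (x : ell2) h : rtrans g x h = x (h * g)%g.
Proof. by []. Qed.

Lemma ell2D (x y : ell2) g : (x + y : ell2) g = x g + y g.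
Proof. by []. Qed.
Lemma ell2Z a (x : ell2) g : (a *: x : ell2) g = a * x g.
Proof. by []. Qed.

Definition bounded_op (T : ell2 -> ell2) : Prop :=
  exists c : K, forall x : ell2, (sqnorm (T x) <= c%:E * sqnorm x)%E.
Definition equivariant_op (T : ell2 -> ell2) : Prop :=
  forall g (x : ell2), T (rtrans g x) = rtrans g (T x).

(* The group von Neumann algebra is the algebra of bounded operators on l^2(G)
   commuting with the right translations, and Z[G] acts through the left
   translations. Exchanging left and right, via g |-> g^-1, gives the algebra of
   operators commuting with the left translations. *)
Definition vna_pred : {pred ell2 -> ell2} := fun T =>
  `[< [/\ linear T, bounded_op T & equivariant_op T] >].

Lemma vnaP T : reflect [/\ linear T, bounded_op T & equivariant_op T]
  (T \in vna_pred).
Proof. exact: asboolP. Qed.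

Lemma bounded_op_ge0 T : bounded_op T -> exists2 c : K, 0 <= c &
  forall x : ell2, (sqnorm (T x) <= c%:E * sqnorm x)%E.
Proof.
move=> [c Tc]; exists (Num.max c 0); first by rewrite le_max lexx orbT.
move=> x; apply: le_trans (Tc x) _; apply: lee_wpmul2r; first exact: sqnorm_ge0.
by rewrite lee_fin le_max lexx.
Qed.

Lemma sqnormN (x : G -> C) : sqnorm (- x) = sqnorm x.
Proof.
apply: eq_esum => g _; congr (_%:E).
by rewrite /sqnormc -[(- x) g]/(- x g); case: (x g) => a b /=; rewrite !sqrrN.
Qed.

Lemma vna_zmod_closed : zmod_closed vna_pred.
Proof.
split=> [|S T].
  apply/vnaP; split.
  - by move=> a x y; rewrite -[RHS]/(a *: 0 + 0) scaler0 addr0.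
  - by exists 0 => x; rewrite mul0e sqnorm0.
  - by move=> g x; apply: ell2P.
move=> /vnaP [linS /bounded_op_ge0 [c c0 Sc] eqS].
move=> /vnaP [linT /bounded_op_ge0 [d d0 Td] eqT]; apply/vnaP; split.
- move=> a x y.
  change (S (a *: x + y) - T (a *: x + y) = a *: (S x - T x) + (S y - T y)).
  by rewrite linS linT opprD scalerBr addrACA.
- exists ((c + d) + (c + d)) => x.
  change (sqnorm (ell2_val (S x) + - ell2_val (T x))%R <=
    ((c + d) + (c + d))%:E * sqnorm x)%E.
  apply: le_trans (sqnormD (ell2_val (S x)) (- ell2_val (T x))) _; rewrite sqnormN.
  have cd0 : 0 <= c + d by rewrite addr_ge0.
  have STx : (sqnorm (ell2_val (S x)) + sqnorm (ell2_val (T x)) <= (c + d)%:E * sqnorm x)%E.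
    by rewrite EFinD ge0_muleDl ?lee_fin // leeD.
  by rewrite EFinD ge0_muleDl ?lee_fin // leeD.
- by move=> g x; rewrite -[LHS]/(S _ - T _) eqS eqT; apply: ell2P.
Qed.
HB.instance Definition _ := GRing.isZmodClosed.Build (ell2 -> ell2) vna_pred
  vna_zmod_closed.

Definition vna := {T : ell2 -> ell2 | T \in vna_pred}.
HB.instance Definition _ := SubChoice.copy vna {T : ell2 -> ell2 | T \in vna_pred}.
HB.instance Definition _ := [SubChoice_isSubZmodule of vna by <:].

Definition vna_fun (T : vna) : ell2 -> ell2 := val T.
Coercion vna_fun : vna >-> Funclass.

Lemma vna_ext (S T : vna) : (forall x : ell2, S x = T x) -> S = T.
Proof. by move=> ST; apply/val_inj/funext. Qed.

Lemma vnaD (S T : vna) (x : ell2) : (S + T : vna) x = S x + T x.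
Proof. by []. Qed.

Lemma vna_is_linear (T : vna) : linear T.
Proof. by have /vnaP [] := valP T. Qed.
HB.instance Definition _ (T : vna) :=
  GRing.isLinear.Build C ell2 ell2 *:%R (vna_fun T) (vna_is_linear T).

Lemma vna_one_subproof : idfun \in vna_pred.
Proof.
apply/vnaP; split=> //; exists 1 => x; by rewrite mul1e.
Qed.
Definition vna_one : vna := Sub (idfun : ell2 -> ell2) vna_one_subproof.

Lemma vna_mul_subproof (S T : vna) : S \o T \in vna_pred.
Proof.
have /vnaP [_ /bounded_op_ge0 [c c0 Sc] eqS] := valP S.
have /vnaP [_ /bounded_op_ge0 [d d0 Td] eqT] := valP T.
apply/vnaP; split.
- by move=> a x y /=; rewrite !linearP.
- exists (c * d) => x /=; apply: le_trans (Sc _) _; rewrite EFinM -muleA.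
  by apply: lee_wpmul2l; rewrite ?lee_fin.
- by move=> g x /=; rewrite [T _]eqT [S _]eqS.
Qed.
Definition vna_mul (S T : vna) : vna := Sub (S \o T) (vna_mul_subproof S T).

Lemma vna_mulA : associative vna_mul. Proof. by move=> S T U; apply: vna_ext. Qed.
Lemma vna_mul1r : left_id vna_one vna_mul.
Proof. by move=> S; apply: vna_ext. Qed.
Lemma vna_mulr1 : right_id vna_one vna_mul.
Proof. by move=> S; apply: vna_ext. Qed.
Lemma vna_mulDl : left_distributive vna_mul +%R.
Proof. by move=> S T U; apply: vna_ext. Qed.
Lemma vna_mulDr : right_distributive vna_mul +%R.
Proof.
move=> S T U; apply: vna_ext => x.
by change (S (T x + U x) = S (T x) + S (U x)); rewrite linearD.
Qed.
HB.instance Definition _ := GRing.Zmodule_isPzRing.Build vna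
  vna_mulA vna_mul1r vna_mulr1 vna_mulDl vna_mulDr.

Lemma ltrans_vna g : ltrans g \in vna_pred.
Proof.
apply/vnaP; split.
- move=> a x y; apply: ell2P => h; rewrite !(ltransE, ell2D, ell2Z).
  by [].
- by exists 1 => x; rewrite mul1e sqnorm_bij //; exact: mulg_bij.
- by move=> h x; apply: ell2P => k; rewrite !(ltransE, rtransE) mulgA.
Qed.
Definition lreg (g : G) : vna := Sub (ltrans g) (ltrans_vna g).

Lemma lreg1 : lreg 1%g = 1.
Proof. by apply: vna_ext => x; apply: ell2P => h; rewrite ltransE invg1 mul1g. Qed.
Lemma lregM : {morph lreg : g h / (g * h)%g >-> g * h}.
Proof.
move=> g h; apply: vna_ext => x; apply: ell2P => k.
by rewrite -[RHS]/(ltrans g (ltrans h x) k) !ltransE invgM mulgA.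
Qed.

Definition vna_of_gr : {rmorphism grpring int G -> vna} :=
  gr_lift (int_lift_spec lreg1 lregM).

(* The sum of an absolutely summable real family; the product of two elements
   of l^2(G) is absolutely summable. *)
Definition rsum (F : G -> K) : K :=
  fine (\esum_(g in [set: G]) (Num.max (F g) 0)%:E) -
  fine (\esum_(g in [set: G]) (Num.max (- F g) 0)%:E).
Definition csum (F : G -> C) : C :=
  Complex (rsum (fun g => complex.Re (F g))) (rsum (fun g => complex.Im (F g))).
Definition inner (x y : ell2) : C := csum (fun g => x g * (y g)^*%C).

Definition delta_fun (g : G) : G -> C := fun h => (h == g)%:R.
Lemma delta_ell2 g : delta_fun g \in ell2_pred.
Proof.
rewrite unfold_in /ell2_pred /sqnorm.
rewrite (_ : (\esum_(_ in _) _)%E = (\esum_(h in [set g]) (sqnormc (delta_fun g h))%:E)%E).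
  by rewrite esum_set1 ?ltry // lee_fin sqnormc_ge0.
rewrite [RHS]esum_mkcond; apply: eq_esum => h _; rewrite /delta_fun.
case: ifPn; rewrite ?inE //; rewrite notin_setE /= => /eqP/negbTE ->.
by rewrite /sqnormc /= expr0n addr0.
Qed.
Definition delta (g : G) : ell2 := Sub (delta_fun g) (delta_ell2 g).

Definition vna_tr (T : vna) : C := inner (T (delta 1%g)) (delta 1%g).

Definition vna_adjoint (S T : vna) : Prop :=
  forall x y : ell2, inner (S x) y = inner x (T y).

(* The adjoint of the matrix (P i j) is the matrix ((P j i)^* ). *)
Definition projection_mx n (P : 'M[vna]_n) : Prop :=
  P *m P = P /\ forall i j, vna_adjoint (P i j) (P j i).

(* For right modules the space associated with a matrix acting on the left is
   its column space {P w}, a submodule of the free right module of rank n. *)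
Section ColumnSpace.
Variables (n : nat) (P : 'M[vna]_n).
Definition colspace_pred : {pred 'cV[vna^c]_n} := fun v =>
  `[< exists w : 'cV[vna]_n, v = P *m w >].
Lemma colspace_submod_closed : GRing.subsemimod_closed colspace_pred.
Proof.
split; first split.
- by apply/asboolP; exists 0; rewrite mulmx0.
- move=> _ _ /asboolP [u ->] /asboolP [v ->]; apply/asboolP.
  by exists (u + v); rewrite mulmxDr.
- move=> a _ /asboolP [u ->]; apply/asboolP.
  exists ((a : vna^c) *: (u : 'cV[vna^c]_n)); apply/matrixP => i j.
  rewrite !mxE -[LHS]/((_ : vna) * (a : vna)) mulr_suml.
  by apply: eq_bigr => k _; rewrite !mxE; exact: (esym (@mulrA vna _ _ _)).
Qed.
HB.instance Definition _ := GRing.isSubmodClosed.Build vna^c 'cV[vna^c]_n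
  colspace_pred colspace_submod_closed.
Definition colspace : lmodType vna^c :=
  submod (colspace_pred : submodClosed 'cV[vna^c]_n).
End ColumnSpace.

(* d is the dimension of the finitely generated projective module M. *)
Definition fgproj_dim (M : lmodType vna^c) (d : K) : Prop :=
  exists (n : nat) (P : 'M[vna]_n),
    [/\ projection_mx P, isomorphic (colspace P) M
      & (d%:C)%C = \sum_i vna_tr (P i i)].

Definition l2dim (M : lmodType vna^c) : \bar K :=
  ereal_sup [set d%:E | d in [set d : K | exists S : submodClosed M,
    [/\ finitely_generated (submod S), projective (submod S)
      & fgproj_dim (submod S) d]]]%classic.

End EllTwo.

(* Main.v *)
(* A contraction of C (x) R[Gamma] in degrees <= n, projected to R[phi(G)] and
   lifted to R[G], yields a matrix F = E X + Y D over R[G], where D is the matrix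
   of d_i, the columns of E are boundaries of degree i, and F maps to 1 over
   R[Gamma]. By Strebel's condition F is injective on R[G]^k. Restricted to
   functions supported in a finite set S this injectivity bounds k|S| by the sum
   of the ranks of two finite integer matrices, for R is a nonzero commutative
   ring and an integer matrix of rank r factors through Z^r. A finite part of U
   has rank at most |S'| (b - tr J) when J is the projection onto the kernel of U
   on l^2(G)^b, so Folner sets S give
     tr (ker E) + tr (ker D) <= m
   for E of size k x m. Finally, an embedding into H_i of the projective module
   given by a projection P is a matrix A = A P with D A = 0 whose range meets
   the image of E trivially. The kernel of (A, E) is then contained in
   ker P + ker E, and rank-nullity for (A, E), whose range lies in ker D,
   turns the inequality into tr P <= 0. The projection onto the kernel of B is
   the strong limit of the even powers of 1 - t B^* B for small t > 0. *)

Require Import Defs.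
From HB Require Import structures.
From mathcomp Require Import all_boot all_order all_algebra finmap complex.
From mathcomp.multinomials Require Import monalg.
From mathcomp Require Import ring lra zify.
From mathcomp Require Import fsbigop boolp classical_sets functions cardinality filter.
From mathcomp Require Import reals constructive_ereal ereal esum.

Set Implicit Arguments.
Unset Strict Implicit.
Unset Printing Implicit Defensive.

Import Order.TTheory GRing.Theory Num.Theory.
Local Open Scope ring_scope.

(** * Hall's theorem and Folner sets *)

(** Dimensions over [R], which may have positive characteristic, cannot be compared directly with
    von Neumann dimensions. The link is the ring of integers: [E] and [D] have entries in Z[G], and
    a factorization of their finite parts through Z^r, with r the complex rank, survives in every
    [R]. The entries of [X] and [Y] live over [R] only and enter through injectivity alone. A second
    obstacle is degree n + 1, where the chain module need be neither free nor finitely generated. On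
    a finite basis of C_n the contraction involves only finitely many elements of it, and the
    boundaries of those are the columns of [E]. They may span less than all boundaries, which does
    no harm: a projective module embedded in homology meets them trivially all the more. Since D E =
    0, the range of [E] has dimension at most tr (ker D); the inequality tr (ker E) + tr (ker D) <=
    m says that this bound is attained, so that no dimension is left for homology. The passage
    through R[phi(G)] is due to phi not being onto in general: only elements over phi(G) can be
    lifted to R[G]. *)

Section Hall.
Local Open Scope fset_scope.
Local Open Scope nat_scope.
Variables (X Y : choiceType).
Implicit Types (A : X -> {fset Y}) (I J : {fset X}).

Definition cover_fset A J : {fset Y} := \bigcup_(x <- J) A x.

Lemma cover_fsetP A J y :
  reflect (exists2 x, x \in J & y \in A x) (y \in cover_fset A J).
Proof.
rewrite /cover_fset; apply: (iffP (@bigfcupP _ _ _ _ _ _)) => [[x]|[x xJ yx]].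
  2: by exists x => //; rewrite xJ.
by rewrite andbT; exists x.
Qed.

Definition hall_on A I := forall J, J `<=` I -> #|` J| <= #|` cover_fset A J|.

(* Rado: if deleting y and deleting z both fail, the two failing sets contradict
   Hall's condition for their union and intersection. *)
Lemma hall_delete A I x0 y z : hall_on A I -> x0 \in I -> y != z ->
  let del w x := if x == x0 then A x0 `\ w else A x in
  hall_on (del y) I \/ hall_on (del z) I.
Proof.
move=> hA x0I yz del; apply: contrapT => /not_orP [].
(* A set on which the condition fails after the deletion must contain [x0], since the other
   candidate sets are unchanged; it is recorded without [x0]. *)
have fail w : ~ hall_on (del w) I -> exists J, [/\ J `<=` I, x0 \notin J
    & #|` (A x0 `\ w) `|` cover_fset A J| <= #|` J|].
  move=> /existsNP [J /not_implyP [JI /negP]]; rewrite -ltnNge => lt.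
  have x0J : x0 \in J.
    apply: contraLR lt => x0J; rewrite -leqNgt; apply: leq_trans (hA J JI) _.
    apply/fsubset_leq_card/fsubsetP => u /cover_fsetP [x xJ ux].
    apply/cover_fsetP; exists x => //; rewrite /del.
    by case: eqP xJ => // ->; rewrite (negbTE x0J).
  exists (J `\ x0); split.
  - by apply: fsubset_trans JI; apply: fsubD1set.
  - by rewrite !inE eqxx.
  - rewrite -ltnS; move: lt; rewrite (cardfsD1 x0 J) x0J add1n; apply: leq_trans.
    apply/fsubset_leq_card/fsubsetP => u; rewrite inE => /orP [ux|/cover_fsetP [x]].
      by apply/cover_fsetP; exists x0 => //; rewrite /del eqxx.
    rewrite !inE => /andP [xx0 xJ] ux; apply/cover_fsetP; exists x => //.
    by rewrite /del (negbTE xx0).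
move=> /fail [J [JI x0J cJ]] /fail [L [LI x0L cL]].
pose U := (A x0 `\ y) `|` cover_fset A J; pose V := (A x0 `\ z) `|` cover_fset A L.
(* As [y != z], the sets [U] and [V] together contain all of [A x0]. So [x0] can be added to the
   union, and this extra unit produces the contradiction when the two cardinalities are added. *)
have cU : #|` x0 |` (J `|` L)| <= #|` U `|` V|.
  apply: leq_trans (hA _ _) _; first by rewrite fsubUset fsub1set x0I fsubUset JI LI.
  apply/fsubset_leq_card/fsubsetP => u /cover_fsetP [x].
  rewrite !inE => /orP [/eqP -> -> | xJL ux].
    rewrite !andbT; case: (eqVneq u y) => [->|]; last by rewrite orTb.
    by rewrite yz !orbT.
  case/orP: xJL => xx; apply/orP; [left|right]; apply/orP; right.
    by apply/cover_fsetP; exists x.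
  by apply/cover_fsetP; exists x.
have cI : #|` J `&` L| <= #|` U `&` V|.
  apply: leq_trans (hA _ _) _; first by apply: fsubset_trans JI; apply: fsubsetIl.
  apply/fsubset_leq_card/fsubsetP => u /cover_fsetP [x].
  rewrite !inE => /andP [xJ xL] ux.
  by apply/andP; split; apply/orP; right; apply/cover_fsetP; exists x.
have := leq_add cU cI; rewrite cardfsUI cardfsU1 !inE (negbTE x0J) (negbTE x0L) /=.
rewrite -addnA cardfsUI add1n => /leq_trans /(_ (leq_add cJ cL)).
by rewrite ltnn.
Qed.

(** Induction on the total size of the candidate sets: elements are deleted until every set is a
    singleton, and Hall's condition for pairs then forces distinct singletons. *)
Theorem hall_finite (y0 : Y) A I : hall_on A I ->
  exists f : X -> Y, (forall x, x \in I -> f x \in A x) /\ {in I &, injective f}.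
Proof.
have [n] := ubnP (\sum_(x <- I) #|` A x|); elim: n A => // n IHn A ltn hA.
have nz x : x \in I -> 0 < #|` A x|.
  move=> xI; have := hA [fset x]; rewrite fsub1set cardfs1 => /(_ xI) /leq_trans; apply.
  by apply/fsubset_leq_card/fsubsetP => u /cover_fsetP [x']; rewrite inE => /eqP ->.
have [|] := pselect (exists2 x, x \in I & 1 < #|` A x|).
  move=> [x0 x0I gt1].
  have /fset0Pn [y yA] : A x0 != fset0 by rewrite -cardfs_gt0 nz.
  have /fset0Pn [z] : A x0 `\ y != fset0.
    by rewrite -cardfs_gt0; move: gt1; rewrite (cardfsD1 y) yA add1n.
  rewrite !inE => /andP [zy zA].
  suff del w : w \in A x0 -> hall_on (fun x => if x == x0 then A x0 `\ w else A x) I ->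
    exists f : X -> Y, (forall x, x \in I -> f x \in A x) /\ {in I &, injective f}.
    have := hall_delete hA x0I; rewrite eq_sym in zy.
    by case/(_ _ _ zy) => /del; apply.
  move=> wA /IHn [].
    rewrite -ltnS; apply: leq_ltn_trans ltn.
    rewrite (big_fsetD1 x0) //= [X in _ <= X](big_fsetD1 x0) //= eqxx -addSn.
    apply: leq_add; first by rewrite [X in _ <= X](cardfsD1 w) wA add1n.
    rewrite big_seq [X in _ <= X]big_seq; apply: leq_sum => x.
    by rewrite !inE => /andP [/negbTE ->].
  move=> f [fA finj]; exists f; split=> // x /fA.
  by case: eqP => // ->; rewrite !inE => /andP [].
move=> no.
have one x : x \in I -> exists y, A x = [fset y].
  move=> xI; apply/cardfs1P; rewrite eqn_leq nz // andbT leqNgt; apply/negP => gt1.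
  by apply: no; exists x.
have /choice [f fA] : forall x, exists y, x \in I -> A x = [fset y].
  move=> x; have [/one [y Ay]|xI] := boolP (x \in I); first by exists y.
  by exists y0.
exists f; split=> [x /fA ->|x x' xI x'I ff]; first by rewrite inE.
apply: contrapT => /eqP xx'; have := hA [fset x; x'].
rewrite fsubUset !fsub1set xI x'I cardfs2 xx' => /(_ isT).
rewrite (_ : cover_fset A _ = [fset f x]) ?cardfs1 //.
apply/fsetP => u; apply/cover_fsetP/idP => [[w]|].
  by rewrite !inE => /orP [] /eqP -> ; rewrite fA // inE // ff.
by move=> ux; exists x; rewrite ?fA // !inE eqxx.
Qed.

(** Compactness: matchings of the finite subsets are glued along an ultrafilter on these subsets,
    which works because each [A x] is finite. *)
Theorem hall_locally_finite (y0 : Y) A : (forall J, #|` J| <= #|` cover_fset A J|) ->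
  exists f : X -> Y, (forall x, f x \in A x) /\ injective f.
Proof.
move=> hA.
have /choice [c cP] : forall S : {fset X}, exists f : X -> Y,
    (forall x, x \in S -> f x \in A x) /\ {in S &, injective f}.
  by move=> S; apply: (hall_finite y0) => J _; apply: hA.
pose F : set_system {fset X} :=
  fun P => exists I : {fset X}, forall S : {fset X}, I `<=` S -> P S.
have FF : ProperFilter F.
  split; first by move=> [I /(_ I (fsubset_refl _))].
  split.
  - by exists fset0.
  - move=> P Q [I IP] [J JQ]; exists (I `|` J) => S; rewrite fsubUset => /andP [].
    by move=> /IP PS /JQ.
  - by move=> P Q PQ [I IP]; exists I => S /IP /PQ.
have [U [UU FU]] := ultraFilterLemma FF.
have UP := @ultra_proper _ _ UU.
(* If no single value of [c S x] prevails, any finite list of values can be excluded at once, in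
   particular the list [A x]; but [c S x] lies in [A x] as soon as [S] contains [x]. *)
have pick x : exists y, U [set S : {fset X} | c S x = y]%classic.
  apply: contrapT => /forallNP no.
  have Uno : forall s : seq Y, U [set S : {fset X} | c S x \notin s]%classic.
    elim=> [|y s IHs]; first by apply: filterS (@filterT _ _ _) => S _ /=.
    have [/no //|Uy] := in_ultra_setVsetC [set S : {fset X} | c S x = y]%classic UU.
    apply: filterS (filterI Uy IHs) => S /= [/eqP cy cs].
    by rewrite inE negb_or cy.
  have Ux : U [set S : {fset X} | x \in S]%classic.
    by apply: FU; exists [fset x] => S; rewrite fsub1set.
  have [S [/= /negP nSx xS]] := @filter_ex _ _ UP _ (filterI (Uno (A x)) Ux).
  by apply: nSx; have [cSA _] := cP S; apply: cSA.
have [f fP] := choice pick.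
exists f; split=> [x|x y fxy].
  have Ux : U [set S : {fset X} | x \in S]%classic.
    by apply: FU; exists [fset x] => S; rewrite fsub1set.
  have [S [/= <- xS]] := @filter_ex _ _ UP _ (filterI (fP x) Ux).
  by have [cSA _] := cP S; apply: cSA.
have Uxy : U [set S : {fset X} | x \in S /\ y \in S]%classic.
  by apply: FU; exists [fset x; y] => S; rewrite fsubUset !fsub1set => /andP [].
have [S [[/= cx cy] [xS yS]]] := @filter_ex _ _ UP _ (filterI (filterI (fP x) (fP y)) Uxy).
by have [_ cSinj] := cP S; apply: cSinj => //; rewrite cx cy.
Qed.
End Hall.

Section Folner.
Local Open Scope fset_scope.
Local Open Scope nat_scope.
Variables (G : groupType).
Implicit Types (S T : {fset G}).

Definition fset_mul T S : {fset G} := [fset (t * s)%g | t in T, s in S].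

Lemma fset_mulP T S g :
  reflect (exists t s, [/\ t \in T, s \in S & g = (t * s)%g]) (g \in fset_mul T S).
Proof.
apply: (iffP idP) => [/imfset2P [t /= tT [s sS ->]]|[t [s [tT sS ->]]]].
  by exists t, s.
exact: in_imfset2.
Qed.

Lemma mem_fset_mul T S t s : t \in T -> s \in S -> (t * s)%g \in fset_mul T S.
Proof. by move=> tT sS; apply/fset_mulP; exists t, s. Qed.

Lemma fset_mulA T T' S : fset_mul T (fset_mul T' S) = fset_mul (fset_mul T T') S.
Proof.
apply/fsetP => g; apply/fset_mulP/fset_mulP.
  move=> [t [_ [tT /fset_mulP [t' [s [t'T sS ->]]] ->]]].
  by exists (t * t')%g, s; rewrite mem_fset_mul // mulgA.
move=> [_ [s [/fset_mulP [t [t' [tT t'T ->]]] sS ->]]].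
by exists t, (t' * s)%g; rewrite mem_fset_mul // mulgA.
Qed.

(** The first two terms of the binomial expansion of (q + 1)^q both equal q^q. Growth by the factor
    (q + 1)/q thus becomes doubling after q rounds. *)
Lemma bernoulli2 q : 0 < q -> 2 * q ^ q <= q.+1 ^ q.
Proof.
case: q => // q _; rewrite -[X in _ <= X ^ _]addn1 expnDn.
rewrite big_ord_recl /= big_ord_recl /= bin0 bin1 !exp1n subn0 /bump /= subn1 /=.
by rewrite !muln1 !mul1n -expnS mul2n -addnn addnA leq_addr.
Qed.

(** [D] is cut according to the translation by which [f] acts, one element of [s] at a time; each
    piece keeps its mean, and injectivity keeps the images disjoint. *)
Lemma piecewise_translation_mean (K : realType) (m : set G -> K) (f : G -> G) (s : seq G) :
  (forall A B, (A `&` B = set0 -> m (A `|` B) = (m A + m B)%R)%classic) ->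
  (forall g A, m [set (g * h)%g | h in A]%classic = m A) ->
  injective f -> forall D : set G, (forall g, D g -> exists2 t, t \in s & f g = (t * g)%g) ->
  m (f @` D)%classic = m D.
Proof.
move=> mD mg finj; elim: s => [|t s IHs] D Ds.
  suff -> : D = set0 by rewrite image_set0.
  by rewrite -subset0 => g /Ds [].
pose D1 := [set g | D g /\ f g = (t * g)%g]%classic.
pose D2 := [set g | D g /\ f g <> (t * g)%g]%classic.
have DE : (D = D1 `|` D2)%classic.
  apply/seteqP; split=> [g Dg|g [[]|[]]] //.
  by have [fg|fg] := pselect (f g = (t * g)%g); [left|right].
have D12 : (D1 `&` D2 = set0)%classic by rewrite -subset0 => g [[_ ?] [_ /(_ _)]].
rewrite DE image_setU !mD //; last first.
  rewrite -subset0 => _ [[g D1g <-] [h D2h /finj hg]].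
  have : (D1 `&` D2)%classic g by split=> //; rewrite -hg.
  by rewrite D12.
congr (_ + _)%R; last first.
  apply: IHs => g [Dg fg]; have [t'] := Ds g Dg.
  by rewrite inE => /orP [/eqP -> //|]; exists t'.
rewrite -(mg t D1); congr m; apply/seteqP; split=> _ [g D1g <-]; exists g => //.
  by case: D1g.
by case: D1g.
Qed.

(* If no set is invariant up to 1/q, some finite T' satisfies 2|S| <= |T' S| for all
   S, and Hall's theorem yields a paradoxical decomposition of G. *)
Theorem folner (K : realType) : amenable K G -> forall T q,
  exists2 S, S != fset0 & q * #|` fset_mul T S| < q.+1 * #|` S|.
Proof.
move=> [m [m0 m1 mD mg]] T q; apply: contrapT => no.
have grow S : q.+1 * #|` S| <= q * #|` fset_mul T S|.
  rewrite leqNgt; apply/negP => lt; apply: no; exists S => //.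
  by apply: contraTneq lt => ->; rewrite cardfs0 muln0.
have q0 : 0 < q.
  by case: q grow {no} => // /(_ [fset 1%g]); rewrite cardfs1 mul0n.
(* [T'] is a q-fold product of copies of [T]. *)
have [T' T'P] : exists T', forall S, 2 * #|` S| <= #|` fset_mul T' S|.
  suff /(_ q) [T' T'P] : forall j, exists T', forall S,
      q.+1 ^ j * #|` S| <= q ^ j * #|` fset_mul T' S|.
    exists T' => S; rewrite -(@leq_pmul2l (q ^ q)) ?expn_gt0 ?q0 //.
    apply: leq_trans (T'P S); rewrite mulnA leq_mul2r mulnC bernoulli2 //.
    by rewrite orbT.
  elim=> [|j [T' T'P]].
    exists [fset 1%g] => S; rewrite !expn0 !mul1n; apply/fsubset_leq_card/fsubsetP.
    by move=> s sS; rewrite -[s]mul1g mem_fset_mul // inE.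
  exists (fset_mul T T') => S; rewrite -fset_mulA !expnS.
  apply: (@leq_trans (q ^ j * (q.+1 * #|` fset_mul T' S|))).
    by rewrite -mulnA [X in _ <= X]mulnCA leq_pmul2l.
  by rewrite [X in _ <= X * _]mulnC -mulnA leq_mul2l grow orbT.
(* The Boolean marks one of two copies of [G]. Matching both into [G] gives two injections with
   disjoint images, each a piecewise translation by elements of [T']; both images have mean 1. *)
pose A (x : G * bool) := fset_mul T' [fset x.1].
have [|f [fA finj]] := @hall_locally_finite _ _ 1%g A.
  move=> J; pose S := [fset x.1 | x in J].
  apply: (@leq_trans (2 * #|` S|)).
    pose tag b : {fset (G * bool)%type} := [fset (g, b) | g in S].
    have tag_le b : #|` tag b| <= #|` S| by exact: leq_imfset_card.
    rewrite mul2n -addnn; apply: leq_trans (leq_add (tag_le true) (tag_le false)).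
    rewrite -cardfsUI; apply: leq_trans (leq_addr _ _).
    apply/fsubset_leq_card/fsubsetP => -[g b] xJ.
    have gS : g \in S by apply/imfsetP; exists (g, b).
    by case: b xJ => _; rewrite inE; apply/orP; [left|right]; apply/imfsetP; exists g.
  apply: leq_trans (T'P S) _; apply/fsubset_leq_card/fsubsetP.
  move=> _ /fset_mulP [t [s [tT /imfsetP [x /= xJ ->] ->]]].
  by apply/cover_fsetP; exists x => //; rewrite mem_fset_mul // inE.
have piece b : m [set f (g, b) | g in setT]%classic = 1%R.
  rewrite -m1; apply: (@piecewise_translation_mean K m (fun g => f (g, b)) T') => //.
    by move=> g h /finj [].
  move=> g _; have /fset_mulP [t [s [tT]]] := fA (g, b).
  by rewrite inE => /eqP -> ->; exists t.
have le1 B : (m B <= 1)%R.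
  rewrite -m1 -(setUv B) mD ?setICr //; rewrite lerDl; exact: m0.
have := le1 ([set f (g, true) | g in setT] `|` [set f (g, false) | g in setT])%classic.
rewrite mD ?piece; first by rewrite gerDl ler10.
by rewrite -subset0 => _ [[g _ <-] [h _ /finj]].
Qed.
End Folner.

(** * Ranks of matrices *)

Section StrongRank.
Variable R : comNzRingType.

(* The last row of A being 0, the last diagonal entry of p(A) = 0 is the constant
   coefficient of p; injectivity then cancels a factor 'X. *)
Lemma injective_not_annihilated n (A : 'M[R]_n.+1) (p : {poly R}) :
  (forall v : 'cV_n.+1, A *m v = 0 -> v = 0) -> row ord_max A = 0 ->
  p \is monic -> horner_mx A p != 0.
Proof.
move=> Ainj A0; have [s] := ubnP (size p); elim: s p => // s IHs p ltps p_monic.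
apply/negP => /eqP pA0.
pose q := drop_poly 1 p; pose c := p`_0.
have pE : p = 'X * q + c%:P.
  rewrite -{1}(poly_take_drop 1 p) addrC expr1 mulrC; congr (_ + _).
  by apply/polyP => i; rewrite coef_take_poly coefC; case: i.
have hE : A *m horner_mx A q + c%:M = 0.
  by rewrite -pA0 [in RHS]pE rmorphD rmorphM /= horner_mx_X horner_mx_C.
have c0 : c = 0.
  have := congr1 (row ord_max) hE; rewrite linearD /= row_mul A0 mul0mx add0r.
  by move/rowP/(_ ord_max); rewrite !mxE eqxx mulr1n.
have qA0 : horner_mx A q = 0.
  have /eqP := hE; rewrite c0 raddf0 addr0 => /eqP hE0.
  apply/matrixP => i j; have /Ainj : A *m col j (horner_mx A q) = 0.
    by rewrite colE mulmxA hE0 mul0mx.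
  by move/colP/(_ i); rewrite !mxE.
have [q0|q0] := eqVneq q 0.
  move: p_monic; rewrite pE q0 c0 mulr0 add0r polyC0 monicE lead_coef0 eq_sym.
  by rewrite (negbTE (oner_neq0 R)).
have pEq : p = q * 'X by rewrite pE c0 polyC0 addr0 mulrC.
have qm : q \is monic by move: p_monic; rewrite pEq !monicE lead_coefMX.
suff : horner_mx A q != 0 by rewrite qA0 eqxx.
by apply: IHs => //; move: ltps; rewrite pEq size_mulX.
Qed.

(** With fewer rows than columns, [M] could be padded by zero rows to an injective square matrix
    whose last row is 0; no monic polynomial annihilates such a matrix, against Cayley-Hamilton. *)
Lemma strong_rank_condition r n (M : 'M[R]_(r, n)) :
  (forall v : 'cV_n, M *m v = 0 -> v = 0) -> (n <= r)%N.
Proof.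
case: n M => // n M Minj; rewrite leqNgt; apply/negP; rewrite ltnS => ler.
pose A : 'M_n.+1 := \matrix_(i, j) oapp (M^~ j) 0 (insub (val i) : option 'I_r).
suff : horner_mx A (char_poly A) != 0 by rewrite Cayley_Hamilton eqxx.
apply: injective_not_annihilated (char_poly_monic A) => [v Av|].
  apply: Minj; apply/colP => i; have lti : (i < n.+1)%N by rewrite ltnS (leq_trans (ltnW _) ler).
  move/colP/(_ (Ordinal lti)): Av; rewrite !mxE => Av; rewrite -[RHS]Av.
  by apply: eq_bigr => j _; rewrite !mxE /= valK.
apply/rowP => j; rewrite !mxE /= insubN //=; by rewrite -leqNgt.
Qed.
End StrongRank.

(** In Smith normal form only the nonzero diagonal entries are kept. The factors are integral, so
    that the factorization can be mapped to any ring, whatever its characteristic. *)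
Lemma int_matrix_rank_factor (F : numFieldType) m n (M : 'M[int]_(m, n)) :
  exists r (L : 'M[int]_(m, r)) (Q : 'M[int]_(r, n)),
    M = L *m Q /\ (r <= \rank (map_mx intr M : 'M[F]_(m, n)))%N.
Proof.
have [U Uu [V Vu [d _ ->]]] := int_Smith_normal_form M.
set D := (X in U *m X *m V).
pose Z := [set i : 'I_m | (i < n)%N && (d`_i != 0)].
have ltn (k : 'I_#|Z|) : (enum_val k < n)%N.
  by have := enum_valP k; rewrite inE => /andP [].
pose c (k : 'I_#|Z|) : 'I_n := Ordinal (ltn k).
pose D1 : 'M[int]_(m, #|Z|) := \matrix_(i, k) (d`_i *+ (i == enum_val k)).
pose D2 : 'M[int]_(#|Z|, n) := \matrix_(k, j) (c k == j)%:R.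
have DE : D = D1 *m D2.
  apply/matrixP => i j; rewrite !mxE.
  have [iZ|iZ] := boolP (i \in Z).
    rewrite (bigD1 (enum_rank_in iZ i)) //= !mxE enum_rankK_in // eqxx mulr1n.
    rewrite -val_eqE /= enum_rankK_in // big1 ?addr0.
      by case: eqP => _; rewrite ?mulr1 ?mulr0 // mulr0n.
    move=> k kn; rewrite !mxE; suff /negbTE -> : i != enum_val k by rewrite mulr0n mul0r.
    apply: contraNneq kn => ik; apply/eqP/enum_val_inj.
    by rewrite enum_rankK_in.
  rewrite big1 => [|k _].
    case: eqP => // ij; move: iZ; rewrite inE ij ltn_ord /= negbK => /eqP ->.
    by [].
  rewrite !mxE; case: eqP => [ik|]; last by rewrite mulr0n mul0r.
  by move: iZ; rewrite ik enum_valP.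
exists #|Z|, (U *m D1), (D2 *m V); split; first by rewrite DE !mulmxA.
rewrite !map_mxM /=.
have unitF k (W : 'M[int]_k) : W \in unitmx -> (map_mx intr W : 'M[F]_k) \in unitmx.
  by rewrite !unitmxE det_map_mx => /(rmorph_unit (intmul (1 : F))).
rewrite mxrankMfree ?row_free_unit ?unitF // -mxrank_tr trmx_mul.
rewrite mxrankMfree ?row_free_unit ?unitmx_tr ?unitF // mxrank_tr.
(* Over [F] the nonzero entries are invertible: the witnesses are a left inverse of [D1] and a right
   inverse of [D2]. *)
apply: (@mulmx1_min_rank _ _ _ _ _
  (\matrix_(k, i) ((d`_i)%:~R^-1 *+ (enum_val k == i)))
  (\matrix_(j, k) (c k == j)%:R)).
apply/matrixP => k l; rewrite !mxE (bigD1 (c l)) //= [X in _ + X]big1 ?addr0; last first.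
  by move=> j jl; rewrite [X in _ * X]mxE eq_sym (negbTE jl) mulr0.
rewrite [X in _ * X]mxE eqxx mulr1 !mxE (bigD1 (enum_val k)) //= big1 ?addr0; last first.
  by move=> j jl; rewrite mxE eq_sym (negbTE jl) mul0r.
rewrite !mxE eqxx mulr1n -val_eqE /= mulrC.
have [<-|kl] := eqVneq k l; last first.
  have /negbTE -> : val (enum_val k) != val (enum_val l).
    by apply: contra kl => /eqP/val_inj/enum_val_inj ->.
  by rewrite mulr0n mul0r; case: eqP => // /val_inj kl1; rewrite kl1 eqxx in kl.
have := enum_valP k; rewrite inE eqxx => /andP [_ dk].
by rewrite mulr1n divff ?eqxx ?intr_eq0.
Qed.

Section PsdRank.
Variable C : numClosedFieldType.

Definition adj_mx m n (A : 'M[C]_(m, n)) : 'M[C]_(n, m) := map_mx Num.conj A^T.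

Lemma adj_mxM m n p (A : 'M[C]_(m, n)) (B : 'M[C]_(n, p)) :
  adj_mx (A *m B) = adj_mx B *m adj_mx A.
Proof. by rewrite /adj_mx trmx_mul map_mxM. Qed.

Lemma adj_mxK m n (A : 'M[C]_(m, n)) : adj_mx (adj_mx A) = A.
Proof. by apply/matrixP => i j; rewrite !mxE conjCK. Qed.

Lemma adj_mx_eq0 n (v : 'rV[C]_n) : v *m adj_mx v = 0 -> v = 0.
Proof.
move=> /matrixP /(_ 0 0); rewrite !mxE => v0; apply/rowP => i; rewrite mxE.
have /psumr_eq0P /(_ v0 i isT) : forall j : 'I_n, true -> 0 <= v 0 j * adj_mx v j 0.
  by move=> j _; rewrite !mxE -normCK exprn_ge0.
by rewrite !mxE -normCK => /eqP; rewrite expf_eq0 /= normr_eq0 => /eqP.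
Qed.

(* With Pi the orthogonal projection onto the row space of W, the trace of N is
   tr (N Pi) + tr ((1 - Pi) N (1 - Pi)), and the first summand is the rank of W. *)
Lemma rank_le_psd_trace r n (W : 'M[C]_(r, n)) (N : 'M[C]_n) :
  W *m N = W -> (forall w : 'rV_n, 0 <= (w *m N *m adj_mx w) 0 0) ->
  (\rank W)%:R <= \tr N.
Proof.
move=> WN Npos;
have [B [Bfree BN]] : exists B : 'M_(\rank W, n), row_free B /\ B *m N = B.
  exists (row_base W); split; first exact: row_base_free.
  have /submxP [X ->] : (row_base W <= W)%MS by rewrite eq_row_base.
  by rewrite -mulmxA WN.
(* The Gram matrix of a basis of the row space; it is invertible because v Gr = 0 makes v B a vector
   of norm 0. *)
pose Gr := B *m adj_mx B.
have Gu : Gr \in unitmx.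
  rewrite -row_free_unit; apply/inj_row_free => v vG.
  have /eqP : v *m B = 0.
    by apply: adj_mx_eq0; rewrite adj_mxM mulmxA -(mulmxA v) vG mul0mx.
  by rewrite mulmx_free_eq0 // => /eqP.
have Gh : adj_mx (invmx Gr) = invmx Gr.
  have GrE : adj_mx Gr = Gr by rewrite adj_mxM adj_mxK.
  rewrite -[LHS]mulmx1 -(mulmxV Gu) mulmxA -{2}GrE -adj_mxM mulmxV //.
  by rewrite /adj_mx trmx1 map_mx1 mul1mx.
pose Pi := adj_mx B *m invmx Gr *m B; pose Q := 1%:M - Pi.
have PiPi : Pi *m Pi = Pi.
  by rewrite /Pi -!mulmxA (mulmxA B) -/Gr (mulmxA (invmx Gr) Gr) mulVmx // mul1mx.
have PiN : Pi *m N = Pi by rewrite /Pi -mulmxA BN.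
have Qh : adj_mx Q = Q.
  rewrite /Q /adj_mx linearB /= trmx1 map_mxB map_mx1; congr (_ - _).
  by rewrite -/(adj_mx Pi) /Pi !adj_mxM adj_mxK Gh mulmxA.
have QQ : Q *m Q = Q.
  by rewrite /Q mulmxBl mul1mx mulmxBr mulmx1 PiPi subrr subr0.
have -> : \tr N = \tr Pi + \tr (Q *m N *m adj_mx Q).
  rewrite Qh [\tr (Q *m N *m Q)]mxtrace_mulC mulmxA QQ /Q mulmxBl mul1mx PiN linearB /=.
  by rewrite addrC subrK.
have -> : \tr Pi = (\rank W)%:R.
  by rewrite /Pi -mulmxA mxtrace_mulC -mulmxA mulVmx // mxtrace1.
rewrite lerDl; apply: sumr_ge0 => i _.
have := Npos (row i Q); rewrite -row_mul !mxE; congr (_ <= _).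
by apply: eq_bigr => j _; rewrite !mxE.
Qed.
End PsdRank.

(** * The Hilbert space of square-summable functions *)

Section Summation.
Variables (K : realType) (G : groupType).
Implicit Types (F A B : G -> K) (a b : K).

Definition tsum F : \bar K := (\esum_(g in [set: G]) (F g)%:E)%E.

Lemma tsum_ge0 F : (forall g, 0 <= F g) -> (0 <= tsum F)%E.
Proof. by move=> F0; apply: esum_ge0 => g _; rewrite lee_fin. Qed.

Lemma tsum_le F A : (forall g, F g <= A g) -> (tsum F <= tsum A)%E.
Proof. by move=> FA; apply: le_esum => g _; rewrite lee_fin. Qed.

Lemma tsumD F A : (forall g, 0 <= F g) -> (forall g, 0 <= A g) ->
  tsum (fun g => F g + A g) = (tsum F + tsum A)%E.
Proof.
move=> F0 A0; rewrite /tsum -esumD => [|g _|g _]; rewrite ?lee_fin //.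
Qed.

Lemma tsumZ_le a F : 0 <= a -> (forall g, 0 <= F g) ->
  (tsum (fun g => a * F g)%R <= a%:E * tsum F)%E.
Proof.
move=> a0 F0; apply: ge_ereal_sup => _ [X [finX _]] <-.
under eq_fsbigr do rewrite EFinM.
rewrite -ge0_mule_fsumr; last by move=> g; rewrite lee_fin.
apply: lee_wpmul2l; first by rewrite lee_fin.
by apply: ereal_sup_ubound; exists X.
Qed.

Lemma tsumZ a F : 0 <= a -> (forall g, 0 <= F g) ->
  tsum (fun g => a * F g) = (a%:E * tsum F)%E.
Proof.
move=> a0 F0; apply/eqP; rewrite eq_le tsumZ_le //=.
have [->|an0] := eqVneq a 0.
  by rewrite mul0e tsum_ge0 // => g; rewrite mul0r.
have {an0} a0 : 0 < a by rewrite lt_def an0.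
have aF0 g : 0 <= a * F g by rewrite mulr_ge0 // ltW.
have ai : 0 <= a^-1 by rewrite invr_ge0 ltW.
have aE : (0 <= a%:E)%E by rewrite lee_fin ltW.
have := lee_wpmul2l aE (tsumZ_le ai aF0).
rewrite muleA -EFinM divff ?gt_eqF // mul1e; congr (_ * _ <= _)%E.
by apply: eq_esum => g _; rewrite mulKf ?gt_eqF.
Qed.

Definition summ F := (tsum (fun g => `|F g|%R) < +oo)%E.

Lemma tsum_fin F : (forall g, 0 <= F g) -> (tsum F < +oo)%E ->
  tsum F = (fine (tsum F))%:E.
Proof. by move=> F0 Foo; rewrite fineK // ge0_fin_numE // tsum_ge0. Qed.

Lemma summ_le F A : (forall g, `|F g| <= A g) -> (tsum A < +oo)%E -> summ F.
Proof. by move=> FA; apply: le_lt_trans; apply: tsum_le. Qed.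

Lemma tsum_le_lt F A : (forall g, F g <= A g) -> (tsum A < +oo)%E -> (tsum F < +oo)%E.
Proof. by move=> FA; apply: le_lt_trans; apply: tsum_le. Qed.

(** Pointwise, positive part plus [B] equals negative part plus [A]. Independence of the
    decomposition is what makes [rsum] additive and homogeneous. *)
Lemma rsum_split F A B : (forall g, 0 <= A g) -> (forall g, 0 <= B g) ->
  (forall g, F g = A g - B g) -> (tsum A < +oo)%E -> (tsum B < +oo)%E ->
  rsum F = fine (tsum A) - fine (tsum B).
Proof.
move=> A0 B0 FE Aoo Boo; rewrite /rsum.
rewrite -/(tsum (fun g => Num.max (F g) 0)) -/(tsum (fun g => Num.max (- F g) 0)).
set P := fun g => Num.max (F g) 0; set N := fun g => Num.max (- F g) 0.
have P0 g : 0 <= P g by rewrite le_max lexx orbT.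
have N0 g : 0 <= N g by rewrite le_max lexx orbT.
have Poo : (tsum P < +oo)%E.
  by apply: tsum_le_lt Aoo => g; rewrite ge_max A0 andbT FE gerBl.
have Noo : (tsum N < +oo)%E.
  by apply: tsum_le_lt Boo => g; rewrite ge_max B0 andbT FE opprB gerBl.
have : (tsum P + tsum B = tsum N + tsum A)%E.
  rewrite -!tsumD //; apply: eq_esum => g _; congr (_%:E); rewrite /P /N FE.
  by case: (leP (A g - B g) 0) => h; case: (leP (- (A g - B g)) 0) => h'; lra.
rewrite (tsum_fin P0) // (tsum_fin N0) // (tsum_fin A0) // (tsum_fin B0) //.
by rewrite -!EFinD => -[]; lra.
Qed.

Definition pospart F g := Num.max (F g) 0.
Definition negpart F g := Num.max (- F g) 0.
Lemma pospart_ge0 F g : 0 <= pospart F g. Proof. by rewrite le_max lexx orbT. Qed.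
Lemma negpart_ge0 F g : 0 <= negpart F g. Proof. by rewrite le_max lexx orbT. Qed.
Lemma posnegE F g : F g = pospart F g - negpart F g.
Proof.
rewrite /pospart /negpart.
by case: (leP (F g) 0) => h; case: (leP (- F g) 0) => h'; lra.
Qed.
Lemma pospart_fin F : summ F -> (tsum (pospart F) < +oo)%E.
Proof. by apply: tsum_le_lt => g; rewrite ge_max normr_ge0 ler_norm. Qed.
Lemma negpart_fin F : summ F -> (tsum (negpart F) < +oo)%E.
Proof. by move=> sF; apply: tsum_le_lt sF => g; rewrite ge_max normr_ge0 andbT -normrN ler_norm. Qed.

Lemma rsumE F : rsum F = fine (tsum (pospart F)) - fine (tsum (negpart F)).
Proof. by []. Qed.

Hint Resolve pospart_ge0 negpart_ge0 : core.

Lemma rsumD F A : summ F -> summ A -> rsum (fun g => F g + A g) = rsum F + rsum A.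
Proof.
move=> sF sA; rewrite (@rsum_split _ (fun g => pospart F g + pospart A g)
  (fun g => negpart F g + negpart A g)).
- rewrite !tsumD ?fineD ?ge0_fin_numE ?tsum_ge0 ?(pospart_fin sF) ?(negpart_fin sF)
    ?(pospart_fin sA) ?(negpart_fin sA) //.
  by rewrite !rsumE; ring.
- by move=> g; rewrite addr_ge0.
- by move=> g; rewrite addr_ge0.
- by move=> g; rewrite (posnegE F) (posnegE A); ring.
- by rewrite tsumD // lte_add_pinfty // ?(pospart_fin sF) ?(pospart_fin sA).
- by rewrite tsumD // lte_add_pinfty // ?(negpart_fin sF) ?(negpart_fin sA).
Qed.

Lemma rsumN F : summ F -> rsum (fun g => - F g) = - rsum F.
Proof.
move=> sF; rewrite (@rsum_split _ (negpart F) (pospart F)) ?rsumE ?opprB; first by [].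
- by [].
- by [].

- by move=> g; rewrite {1}posnegE opprB.
- exact: negpart_fin.
- exact: pospart_fin.
Qed.

Lemma rsumZ a F : summ F -> rsum (fun g => a * F g) = a * rsum F.
Proof.
have pos b : 0 <= b -> summ F -> rsum (fun g => b * F g) = b * rsum F.
  move=> b0 sF; rewrite (@rsum_split _ (fun g => b * pospart F g) (fun g => b * negpart F g)).
  - rewrite !tsumZ // rsumE mulrBr !fineM // ge0_fin_numE ?tsum_ge0 //.
      exact: negpart_fin.
    exact: pospart_fin.
  - by move=> g; rewrite mulr_ge0.
  - by move=> g; rewrite mulr_ge0.
  - by move=> g; rewrite {1}(posnegE F) mulrBr.
  - by rewrite tsumZ // lte_mul_pinfty // ?lee_fin // (pospart_fin sF).
  - by rewrite tsumZ // lte_mul_pinfty // ?lee_fin // (negpart_fin sF).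
move=> sF; have [/pos -> //|a0] := leP 0 a.
have na0 : 0 <= - a by lra.
have := pos _ na0 sF; rewrite -[a * rsum F]opprK -mulNr => <-; rewrite -rsumN.
  by congr rsum; apply/funext => g; rewrite mulNr opprK.
rewrite /summ (_ : (fun g => _) = (fun g => - a * `|F g|)).
  by rewrite tsumZ // lte_mul_pinfty // ?lee_fin //; apply: tsum_ge0.
by apply/funext => g; rewrite normrM ger0_norm.
Qed.

Lemma summZ a F : summ F -> summ (fun g => a * F g).
Proof.
move=> sF; rewrite /summ (_ : (fun g => _) = (fun g => `|a| * `|F g|)).
  by rewrite tsumZ // lte_mul_pinfty // ?lee_fin //; apply: tsum_ge0.
by apply/funext => g; rewrite normrM.
Qed.

Lemma rsum_ge0E F : (forall g, 0 <= F g) -> (tsum F < +oo)%E -> rsum F = fine (tsum F).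
Proof.
move=> F0 Foo; have z : tsum (fun=> 0) = 0%E :> \bar K by apply: esum1.
by rewrite (@rsum_split _ F (fun=> 0)) ?z ?subr0 // => g; rewrite subr0.
Qed.

Lemma tsum_single g F : (forall h, h != g -> F h = 0) -> 0 <= F g ->
  tsum F = (F g)%:E.
Proof.
move=> Fg F0; rewrite /tsum -[RHS](@esum_set1 _ _ g (fun g => (F g)%:E)) ?lee_fin //.
rewrite [RHS]esum_mkcond; apply: eq_esum => h _; case: ifPn => //.
by rewrite notin_setE /= => /eqP /Fg ->.
Qed.

Lemma rsum_single g F : (forall h, h != g -> F h = 0) -> rsum F = F g.
Proof.
move=> Fg; rewrite rsumE !(@tsum_single g) //=; first by rewrite -posnegE.
  by move=> h /Fg Fh; rewrite /negpart Fh oppr0 maxxx.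
by move=> h /Fg Fh; rewrite /pospart Fh maxxx.
Qed.

Lemma rsum_bij (s : G -> G) F : bijective s -> rsum (F \o s) = rsum F.
Proof.
move=> bs; rewrite !rsumE; congr (fine _ - fine _);
  by rewrite /tsum [RHS](@reindex_esum _ _ _ setT setT s) // setTT_bijective.
Qed.
End Summation.

Section Inner.
Variables (K : realType) (G : groupType).
Local Notation C := (K[i]).
Local Notation L2 := (ell2 K G).
Implicit Types (F A : G -> C) (x y z : L2) (a b : C) (g h : G).

Definition csumm F := summ (fun g => complex.Re (F g)) /\ summ (fun g => complex.Im (F g)).

Lemma csumD F A : csumm F -> csumm A -> csum (fun g => F g + A g) = csum F + csum A.
Proof.
move=> [F1 F2] [A1 A2]; rewrite /csum -[RHS]/(Complex _ _) -!rsumD //.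
by congr Complex; congr rsum; apply/funext => g; case: (F g) (A g) => [? ?] [? ?].
Qed.

Lemma csumZ a F : csumm F -> csum (fun g => a * F g) = a * csum F.
Proof.
case: a => u v [F1 F2]; apply/eqP; rewrite eq_complex /csum.
apply/andP; split; apply/eqP.
  transitivity (rsum (fun g => u * complex.Re (F g) + - v * complex.Im (F g))).
    by congr rsum; apply/funext => g; case: (F g) => p q; rewrite mulNr.
  by rewrite rsumD ?rsumZ ?mulNr //; exact: summZ.
transitivity (rsum (fun g => u * complex.Im (F g) + v * complex.Re (F g))).
  by congr rsum; apply/funext => g; case: (F g).
by rewrite rsumD ?rsumZ //; exact: summZ.
Qed.

Lemma csum_conj F : csumm F -> csum (fun g => (F g)^*%C) = (csum F)^*%C.
Proof.
move=> [F1 F2]; rewrite /csum -[RHS]/(Complex _ _) -rsumN //.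
by congr Complex; congr rsum; apply/funext => g; case: (F g) => [? ?].
Qed.

Lemma csum_single g F : (forall h, h != g -> F h = 0) -> csum F = F g.
Proof.
move=> Fg; rewrite /csum !(@rsum_single _ _ g) => [|h /Fg -> //|h /Fg -> //].
by case: (F g).
Qed.

Lemma csum_bij (s : G -> G) F : bijective s -> csum (F \o s) = csum F.
Proof.
move=> bs; rewrite /csum -(rsum_bij (fun g => complex.Re (F g)) bs).
by rewrite -(rsum_bij (fun g => complex.Im (F g)) bs).
Qed.

Lemma sqnorm_fin x : (sqnorm x < +oo)%E.
Proof. exact: (valP x). Qed.

Lemma inner_csumm x y : csumm (fun g => x g * (y g)^*%C).
Proof.
have fin : (tsum (fun g => (sqnormc (x g) + sqnormc (y g))%R) < +oo)%E.
  rewrite tsumD; try by move=> g; apply: sqnormc_ge0.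
  by rewrite lte_add_pinfty // sqnorm_fin.
split; apply: summ_le fin => g; case: (x g) (y g) => [p q] [r s];
  rewrite /sqnormc /= ler_norml; apply/andP; split.
- have := sqr_ge0 (p + r); have := sqr_ge0 (q + s); have := sqr_ge0 p;
  have := sqr_ge0 q; have := sqr_ge0 r; have := sqr_ge0 s; lra.
- have := sqr_ge0 (p - r); have := sqr_ge0 (q - s); have := sqr_ge0 p;
  have := sqr_ge0 q; have := sqr_ge0 r; have := sqr_ge0 s; lra.
- have := sqr_ge0 (p - s); have := sqr_ge0 (q + r); have := sqr_ge0 p;
  have := sqr_ge0 q; have := sqr_ge0 r; have := sqr_ge0 s; lra.
- have := sqr_ge0 (p + s); have := sqr_ge0 (q - r); have := sqr_ge0 p;
  have := sqr_ge0 q; have := sqr_ge0 r; have := sqr_ge0 s; lra.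
Qed.

Lemma innerDl x y z : inner (x + y) z = inner x z + inner y z.
Proof.
rewrite /inner -csumD; try exact: inner_csumm.
by congr csum; apply/funext => g; rewrite -mulrDl.
Qed.

Lemma innerZl a x y : inner (a *: x) y = a * inner x y.
Proof.
rewrite /inner -csumZ; last exact: inner_csumm.
by congr csum; apply/funext => g; rewrite mulrA.
Qed.

Lemma conjcM a b : (a * b)^*%C = a^*%C * b^*%C.
Proof. by case: a b => [p q] [r s]; congr Complex; rewrite /=; ring. Qed.
Lemma conjcD a b : (a + b)^*%C = a^*%C + b^*%C.
Proof. by case: a b => [p q] [r s]; congr Complex; rewrite /=; ring. Qed.

Lemma inner_conj x y : inner y x = (inner x y)^*%C.
Proof.
rewrite /inner -csum_conj; last exact: inner_csumm.
by congr csum; apply/funext => g; rewrite conjcM conjcK mulrC.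
Qed.

Lemma innerDr x y z : inner x (y + z) = inner x y + inner x z.
Proof. by rewrite inner_conj innerDl conjcD -!inner_conj. Qed.

Lemma innerZr a x y : inner x (a *: y) = a^*%C * inner x y.
Proof. by rewrite inner_conj innerZl conjcM -inner_conj. Qed.

Lemma innerNl x y : inner (- x) y = - inner x y.
Proof. by rewrite -scaleN1r innerZl mulN1r. Qed.
Lemma innerNr x y : inner x (- y) = - inner x y.
Proof.
by rewrite inner_conj innerNl [in RHS]inner_conj; case: (inner y x) => p q.
Qed.
Lemma innerBl x y z : inner (x - y) z = inner x z - inner y z.
Proof. by rewrite innerDl innerNl. Qed.
Lemma innerBr x y z : inner x (y - z) = inner x y - inner x z.
Proof. by rewrite innerDr innerNr. Qed.
Lemma inner0l y : inner 0 y = 0.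
Proof. by rewrite -(subrr y) innerBl subrr. Qed.
Lemma inner0r y : inner y 0 = 0.
Proof. by rewrite -(subrr y) innerBr subrr. Qed.

Lemma inner_suml (I : Type) (s : seq I) (P : pred I) (F : I -> L2) y :
  inner (\sum_(i <- s | P i) F i) y = \sum_(i <- s | P i) inner (F i) y.
Proof.
by elim/big_rec2: _ => [|i u v _ <-]; rewrite ?inner0l // innerDl.
Qed.
Lemma inner_sumr (I : Type) (s : seq I) (P : pred I) (F : I -> L2) y :
  inner y (\sum_(i <- s | P i) F i) = \sum_(i <- s | P i) inner y (F i).
Proof.
by elim/big_rec2: _ => [|i u v _ <-]; rewrite ?inner0r // innerDr.
Qed.

Lemma Re_sum (I : Type) (s : seq I) (P : pred I) (F : I -> C) :
  complex.Re (\sum_(i <- s | P i) F i) = \sum_(i <- s | P i) complex.Re (F i).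
Proof. by elim/big_rec2: _ => [//|i u v _ <-]; case: (F i) v => [? ?] []. Qed.

Lemma deltaE (g h : G) : delta K g h = (h == g)%:R.
Proof. by []. Qed.

Lemma inner_delta x g : inner x (delta K g) = x g.
Proof.
rewrite /inner (@csum_single g) => [|h /negbTE hg]; rewrite deltaE.
  by rewrite eqxx /= oppr0 mulr1.
by rewrite hg /= oppr0 mulr0.
Qed.

Lemma inner_ext x y : (forall z, inner x z = inner y z) -> x = y.
Proof. by move=> xy; apply: ell2P => g; rewrite -!inner_delta. Qed.

(** The square of the norm. Limits and operator bounds are stated for squares, without roots, at the
    price of a factor 2 in the triangle inequality. *)
Definition nrm2 x : K := fine (sqnorm x).

Lemma nrm2E x : sqnorm x = (nrm2 x)%:E.
Proof. by rewrite fineK // ge0_fin_numE ?sqnorm_fin // sqnorm_ge0. Qed.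

Lemma nrm2_ge0 x : 0 <= nrm2 x.
Proof. by rewrite -lee_fin -nrm2E sqnorm_ge0. Qed.

Lemma inner_nrm2 x : inner x x = (nrm2 x)%:C%C.
Proof.
rewrite /inner /csum; congr Complex.
  rewrite rsum_ge0E.
  - congr fine; apply: eq_esum => g _; congr (_%:E).
    by case: (x g) => p q; rewrite /sqnormc /=; ring.
  - by move=> g; case: (x g) => p q /=; rewrite mulrN opprK addr_ge0 // -expr2 sqr_ge0.
  - apply: le_lt_trans (sqnorm_fin x); apply: tsum_le => g.
    by case: (x g) => p q /=; rewrite mulrN opprK /sqnormc /= !expr2.
rewrite (_ : (fun g => _) = fun=> 0); last first.
  by apply/funext => g; case: (x g) => p q /=; ring.
by rewrite (@rsum_single _ _ 1%g).
Qed.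

Lemma nrm2D x y : nrm2 (x + y) = nrm2 x + complex.Re (inner x y) *+ 2 + nrm2 y.
Proof.
have /(congr1 (@complex.Re K)) := inner_nrm2 (x + y).
rewrite !(innerDl, innerDr) !inner_nrm2 (inner_conj x y) /= => <-.
by case: (inner x y) => p q /=; ring.
Qed.

Lemma nrm2Z a x : nrm2 (a *: x) = sqnormc a * nrm2 x.
Proof.
have /(congr1 (@complex.Re K)) := inner_nrm2 (a *: x).
by rewrite innerZl innerZr inner_nrm2 /= => <-; case: a => p q; rewrite /sqnormc /=; ring.
Qed.

Lemma nrm2N x : nrm2 (- x) = nrm2 x.
Proof. by rewrite -scaleN1r nrm2Z /sqnormc /=; ring. Qed.

Lemma nrm2B x y : nrm2 (x - y) = nrm2 x - complex.Re (inner x y) *+ 2 + nrm2 y.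
Proof. by rewrite nrm2D nrm2N innerNr raddfN mulNrn. Qed.

Lemma nrm2_0 : nrm2 0 = 0.
Proof. by rewrite -(scale0r 0) nrm2Z /sqnormc /=; ring. Qed.

Lemma nrm2_coord x g : sqnormc (x g) <= nrm2 x.
Proof.
rewrite -lee_fin -nrm2E; apply: esum_ge.
exists [set g]%classic; first by split=> //; exact: finite_set1.
by rewrite fsbig_set1.
Qed.

Lemma sqnormc_eq0 a : (sqnormc a == 0) = (a == 0).
Proof.
by case: a => p q; rewrite /sqnormc /= paddr_eq0 ?sqr_ge0 // !sqrf_eq0 eq_complex /=.
Qed.

Lemma nrm2_eq0 x : nrm2 x <= 0 -> x = 0.
Proof.
move=> x0; apply: ell2P => g; apply/eqP; rewrite -sqnormc_eq0 eq_le sqnormc_ge0.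
by rewrite (le_trans (nrm2_coord x g)).
Qed.

Lemma nrm2D_le x y : nrm2 (x + y) <= (nrm2 x + nrm2 y) *+ 2.
Proof.
have := nrm2_ge0 (x - y); rewrite nrm2B nrm2D.
have := nrm2_ge0 x; have := nrm2_ge0 y; rewrite !mulr2n; lra.
Qed.

(** Expansion of the squared norm of [nrm2 y *: x - inner x y *: y], divided by [nrm2 y]. *)
Lemma cauchy_schwarz x y : sqnormc (inner x y) <= nrm2 x * nrm2 y.
Proof.
have [y0|y0] := leP (nrm2 y) 0.
  by rewrite (nrm2_eq0 y0) inner0r nrm2_0 mulr0 /sqnormc /= expr0n addr0.
have := nrm2_ge0 ((nrm2 y)%:C%C *: x - inner x y *: y).
rewrite nrm2B !nrm2Z innerZl innerZr.
rewrite (_ : complex.Re _ = nrm2 y * sqnormc (inner x y)); last first.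
  by case: (inner x y) => p q; rewrite /sqnormc /=; ring.
rewrite (_ : sqnormc (nrm2 y)%:C%C = nrm2 y ^+ 2); last by rewrite /sqnormc /=; ring.
rewrite (_ : _ + _ = nrm2 y * (nrm2 x * nrm2 y - sqnormc (inner x y))); last by ring.
by rewrite pmulr_rge0 // subr_ge0.
Qed.

Lemma nrm2_fin_le x (c : K) :
  (forall s : seq G, uniq s -> \sum_(g <- s) sqnormc (x g) <= c) -> nrm2 x <= c.
Proof.
move=> xs; rewrite -lee_fin -nrm2E; apply: ge_ereal_sup => _ [X [finX _]] <-.
by rewrite fsbig_finite //= sumEFin lee_fin xs ?fset_uniq.
Qed.

Lemma ell2_of_fin_le (x : G -> C) (c : K) :
  (forall s : seq G, uniq s -> \sum_(g <- s) sqnormc (x g) <= c) -> x \in @ell2_pred K G.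
Proof.
move=> xs; rewrite unfold_in; apply: (@le_lt_trans _ _ c%:E); last exact: ltry.
apply: ge_ereal_sup => _ [X [finX _]] <-.
by rewrite fsbig_finite //= sumEFin lee_fin xs ?fset_uniq.
Qed.

Lemma nrm2_finite_sum (s : seq G) (a : G -> C) : uniq s ->
  nrm2 (\sum_(g <- s) a g *: delta K g) = \sum_(g <- s) sqnormc (a g).
Proof.
move=> us; rewrite -[LHS]/(complex.Re (nrm2 _)%:C%C) -inner_nrm2.
rewrite inner_sumr Re_sum big_seq [RHS]big_seq; apply: eq_bigr => g gs.
rewrite innerZr inner_delta.
have -> : ell2_val (\sum_(i <- s) a i *: delta K i) g = a g; last first.
  by case: (a g) => p q; rewrite /sqnormc /=; ring.
rewrite -inner_delta inner_suml (bigD1_seq g) //= big1 ?addr0 => [|h hg].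
  by rewrite innerZl inner_delta deltaE eqxx mulr1.
by rewrite innerZl inner_delta deltaE eq_sym (negbTE hg) mulr0.
Qed.

Lemma nrm2_approx x (e : K) : 0 < e -> exists s : seq G,
  uniq s /\ nrm2 (x - \sum_(g <- s) x g *: delta K g) <= e.
Proof.
move=> e0.
have : (exists2 y, [set \sum_(g \in X) (sqnormc (x g))%:E | X in fsets [set: G]]%E%classic y &
    (sqnorm x - e%:E < y)%E).
  by apply: ereal_sup_gt; rewrite -[X in (_ < X)%E]/(sqnorm x) nrm2E -EFinB lte_fin ltrBlDr ltrDl.
move=> [_ [X [finX _] <-]]; rewrite fsbig_finite //= sumEFin nrm2E -EFinB lte_fin.
set s := (X in \sum_(g <- X) _) => lt_e; exists s; have us : uniq s by exact: fset_uniq.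
split=> //; rewrite nrm2B inner_sumr.
have -> : complex.Re (\sum_(g <- s) inner x (x g *: delta K g)) = \sum_(g <- s) sqnormc (x g).
  rewrite Re_sum; apply: eq_bigr => g _; rewrite innerZr inner_delta.
  by case: (x g) => p q; rewrite /sqnormc /=; ring.
by rewrite nrm2_finite_sum //; move: lt_e; lra.
Qed.
End Inner.

(** * Operators of the group von Neumann algebra *)

Lemma real_cauchy_limit (K : realType) (a : nat -> K) :
  (forall e, 0 < e -> exists N, forall k l, (N <= k)%N -> (N <= l)%N -> `|a k - a l| <= e) ->
  exists r, forall e, 0 < e -> exists N, forall k, (N <= k)%N -> `|a k - r| <= e.
Proof.
(* [E] consists of the eventual lower bounds of the sequence, so [sup E] is its lower limit. *)
move=> ac; pose E := [set y | exists N, forall k, (N <= k)%N -> y <= a k]%classic.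
have Ele e N : (forall k l, (N <= k)%N -> (N <= l)%N -> `|a k - a l| <= e) ->
    E (a N - e) /\ ubound E (a N + e).
  move=> aN; split; first by exists N => k Nk; have := aN k N Nk (leqnn N); rewrite ler_norml; lra.
  move=> y [M yM]; have := yM (maxn N M) (leq_maxr _ _).
  have := aN (maxn N M) N (leq_maxl _ _) (leqnn N); rewrite ler_norml; lra.
exists (sup E) => e e0; have e2 : 0 < e / 2 by lra.
have [N aN] := ac _ e2; exists N => k Nk.
have [EN Eub] := Ele _ _ aN.
have := @ub_le_sup _ E (ex_intro _ _ Eub) _ EN.
have := @ge_sup _ E _ (ex_intro _ _ EN) Eub.
by have := aN k N Nk (leqnn N); rewrite !ler_norml; lra.
Qed.

Section Operators.
Variables (K : realType) (G : groupType).
Local Notation C := (K[i]).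
Local Notation L2 := (ell2 K G).
Local Notation NG := (vna K G).
Implicit Types (x y z : L2) (S T : NG) (u : nat -> L2).

Lemma inner_rtrans (g : G) x y : inner (rtrans g x) y = inner x (rtrans g^-1%g y).
Proof.
rewrite /inner -[RHS](csum_bij _ (mulgr_bij g)); congr csum; apply/funext => h /=.
by rewrite !rtransE mulgK.
Qed.

Lemma rtrans_delta (g h : G) : rtrans g (delta K h) = delta K (h * g^-1)%g.
Proof.
by apply: ell2P => k; rewrite rtransE !deltaE (can2_eq (mulgK g) (mulgVK g)).
Qed.

Lemma vna_rtrans T (g : G) x : T (rtrans g x) = rtrans g (T x).
Proof. by have /vnaP [_ _] := valP T; apply. Qed.

Lemma vna_bound T : exists2 c : K, 0 <= c & forall x, nrm2 (T x) <= c * nrm2 x.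
Proof.
have /vnaP [_ /bounded_op_ge0 [c c0 Tc] _] := valP T; exists c => // x.
by rewrite -lee_fin EFinM -!nrm2E; exact: Tc.
Qed.

Lemma vnaDE (S T : NG) x : (S + T : NG) x = S x + T x. Proof. by []. Qed.
Lemma vnaME (S T : NG) x : (S * T : NG) x = S (T x). Proof. by []. Qed.
Lemma vna1E x : (1 : NG) x = x. Proof. by []. Qed.
Lemma vna_funD T x y : T (x + y) = T x + T y.
Proof. by have := vna_is_linear T 1 x y; rewrite !scale1r. Qed.
Lemma vna_fun0 T : T 0 = 0.
Proof. by apply: (@addIr _ (T 0)); rewrite -vna_funD !add0r. Qed.
Lemma vna_funZ T (a : C) x : T (a *: x) = a *: T x.
Proof. by have := vna_is_linear T a x 0; rewrite vna_fun0 !addr0. Qed.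
Lemma vna_funB T x y : T (x - y) = T x - T y.
Proof. by rewrite vna_funD -scaleN1r vna_funZ scaleN1r. Qed.
Lemma vna_fun_sum T (I : Type) (s : seq I) (P : pred I) (F : I -> L2) :
  T (\sum_(i <- s | P i) F i) = \sum_(i <- s | P i) T (F i).
Proof. by elim/big_rec2: _ => [|i v w _ <-]; rewrite ?vna_fun0 // vna_funD. Qed.

Lemma vna_sumE (I : Type) (s : seq I) (P : pred I) (F : I -> NG) x :
  (\sum_(i <- s | P i) F i : NG) x = \sum_(i <- s | P i) F i x.
Proof. by elim/big_rec2: _ => // i v w _ <-; rewrite vnaDE. Qed.

Section Star.
Variable T : NG.

(** The only possible coordinates of the adjoint at [x], since its value at g has to be its inner
    product with the basis vector at g. *)
Definition star_fun x : G -> C := fun g => inner x (T (delta K g)).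

(** Let t be the sum and [z] the truncation of [star_fun x] to [s]. Then t = <x, T z>, and
    Cauchy-Schwarz with |T z|^2 <= c t gives t^2 <= c |x|^2 t, from which t is cancelled. *)
Lemma star_fun_fin_le (c : K) x : 0 <= c -> (forall y, nrm2 (T y) <= c * nrm2 y) ->
  forall s : seq G, uniq s -> \sum_(g <- s) sqnormc (star_fun x g) <= c * nrm2 x.
Proof.
move=> c0 Tc s us; set t := \sum_(g <- s) _.
have t0 : 0 <= t by apply: sumr_ge0 => g _; exact: sqnormc_ge0.
pose z := \sum_(g <- s) star_fun x g *: delta K g.
have xz : inner x (T z) = t%:C%C.
  rewrite /z vna_fun_sum inner_sumr /t rmorph_sum; apply: eq_bigr => g _.
  rewrite vna_funZ innerZr -/(star_fun x g).
  case: (star_fun x g) => p q; apply/eqP; rewrite eq_complex /sqnormc /=.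
  by apply/andP; split; apply/eqP; ring.
have := cauchy_schwarz x (T z); rewrite xz.
have := Tc z; rewrite /z nrm2_finite_sum // -/t => Tz.
rewrite (_ : sqnormc _ = t * t); last by rewrite /sqnormc /=; ring.
move=> /le_trans /(_ (ler_wpM2l (nrm2_ge0 x) Tz)).
have [t1|t1] := leP t 0; first by move=> _; rewrite (le_trans t1) // mulr_ge0 // nrm2_ge0.
by rewrite mulrA ler_pM2r // mulrC.
Qed.

Lemma star_fun_ell2 x : star_fun x \in @ell2_pred K G.
Proof.
have [c c0 Tc] := vna_bound T.
exact: ell2_of_fin_le (star_fun_fin_le x c0 Tc).
Qed.
Definition star_op x : L2 := Sub (star_fun x) (star_fun_ell2 x).

(** The identity holds for finitely supported [y] by construction, and both sides are continuous in
    [y]. The constant [M] collects the two Cauchy-Schwarz bounds for the remainder [r]; its summand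
    1 keeps it positive. *)
Lemma star_op_adjoint x y : inner (star_op x) y = inner x (T y).
Proof.
have [c c0 Tc] := vna_bound T; apply/eqP; rewrite -subr_eq0 -sqnormc_eq0.
rewrite eq_le sqnormc_ge0 andbT; apply/ler_addgt0Pr => e e0; rewrite add0r.
pose M := (nrm2 (star_op x) + nrm2 x * c + 1) *+ 2.
have M0 : 0 < M.
  rewrite pmulrn_rgt0 // ltr_wpDl // addr_ge0 ?mulr_ge0 ?nrm2_ge0 //.
have [s [us rs]] := nrm2_approx y (divr_gt0 e0 M0).
set r := y - _ in rs.
have yE : y = \sum_(g <- s) y g *: delta K g + r by rewrite /r addrC subrK.
have -> : inner (star_op x) y - inner x (T y) = inner (star_op x) r - inner x (T r).
  rewrite {1 2}yE vna_funD !innerDr.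
  suff -> : inner (star_op x) (\sum_(g <- s) y g *: delta K g) =
      inner x (T (\sum_(g <- s) y g *: delta K g)).
    by rewrite opprD addrACA subrr add0r.
  rewrite vna_fun_sum !inner_sumr; apply: eq_bigr => g _.
  by rewrite vna_funZ !innerZr inner_delta.
apply: le_trans (sqnormcD _ _) _.
rewrite (_ : sqnormc (- _) = sqnormc (inner x (T r))); last first.
  by case: (inner x (T r)) => p q; rewrite /sqnormc /=; ring.
have h1 := cauchy_schwarz (star_op x) r; have h2 := cauchy_schwarz x (T r).
have h3 : nrm2 x * nrm2 (T r) <= nrm2 x * c * nrm2 r.
  by rewrite -mulrA; apply: ler_wpM2l (Tc r); exact: nrm2_ge0.
have h4 : M * nrm2 r <= e by rewrite -ler_pdivlMl // mulrC.
have r0 := nrm2_ge0 r.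
apply: le_trans h4; rewrite /M mulr2n; nra.
Qed.

Lemma star_op_vna : star_op \in @vna_pred K G.
Proof.
apply/vnaP; split.
- move=> a x y; apply: inner_ext => z.
  by rewrite innerDl innerZl !star_op_adjoint innerDl innerZl.
- have [c c0 Tc] := vna_bound T; exists c => x.
  by rewrite !nrm2E -EFinM lee_fin; apply: nrm2_fin_le; apply: star_fun_fin_le.
- move=> g x; apply: inner_ext => y.
  by rewrite inner_rtrans !star_op_adjoint inner_rtrans vna_rtrans.
Qed.
Definition star : NG := Sub star_op star_op_vna.

Lemma starE x y : inner (star x) y = inner x (T y).
Proof. exact: star_op_adjoint. Qed.
End Star.

Lemma starP S T : (forall x y, inner (S x) y = inner x (T y)) -> S = star T.
Proof.
by move=> ST; apply: vna_ext => x; apply: inner_ext => y; rewrite ST starE.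
Qed.

Lemma starK : involutive star.
Proof.
move=> T; apply/esym/starP => x y.
by rewrite inner_conj -starE -inner_conj.
Qed.
Lemma star1 : star 1 = 1. Proof. by apply/esym/starP. Qed.
Lemma starM S T : star (S * T) = star T * star S.
Proof. by apply/esym/starP => x y; rewrite !vnaME !starE. Qed.
Lemma star_is_zmod_morphism : zmod_morphism star.
Proof.
move=> S T; apply/esym/starP => x y.
by rewrite -[LHS]/(inner (star S x - star T x) y) innerBl !starE -innerBr.
Qed.
HB.instance Definition _ := GRing.isZmodMorphism.Build NG NG star star_is_zmod_morphism.

Lemma vna_adjointE S T : vna_adjoint S T -> star S = T.
Proof. by move=> ST; rewrite (starP ST) starK. Qed.

Section Scalar.
Variable r : K.
Lemma vna_scalar_subproof : (fun x : L2 => (r%:C%C : C) *: x) \in @vna_pred K G.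
Proof.
apply/vnaP; split.
- move=> a x y; apply: ell2P => g; rewrite !(ell2D, ell2Z).
  by rewrite mulrDr mulrCA.
- exists (r ^+ 2) => x.
  have rx : nrm2 ((r%:C%C : C) *: x) = r ^+ 2 * nrm2 x.
    by rewrite nrm2Z /sqnormc /= expr0n addr0.
  by rewrite (nrm2E ((r%:C%C : C) *: x)) (nrm2E x) -EFinM lee_fin rx.
- by move=> g x; apply: ell2P => h; rewrite rtransE !ell2Z rtransE.
Qed.
Definition vna_scalar : NG := Sub (fun x : L2 => (r%:C%C : C) *: x) vna_scalar_subproof.
Lemma vna_scalarE x : vna_scalar x = (r%:C%C : C) *: x. Proof. by []. Qed.
Lemma vna_scalar_central T : vna_scalar * T = T * vna_scalar.
Proof. by apply: vna_ext => x; rewrite !vnaME !vna_scalarE vna_funZ. Qed.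
Lemma star_scalar : star vna_scalar = vna_scalar.
Proof.
apply/esym/starP => x y; rewrite !vna_scalarE innerZl innerZr.
by congr (_ * _); rewrite /= oppr0.
Qed.
End Scalar.

Lemma vna_scalarM r r' : vna_scalar r * vna_scalar r' = vna_scalar (r * r').
Proof.
by apply: vna_ext => x; rewrite vnaME !vna_scalarE scalerA rmorphM.
Qed.
Lemma vna_scalar1 : vna_scalar 1 = 1.
Proof. by apply: vna_ext => x; rewrite vna_scalarE scale1r. Qed.

Lemma vna_trE T : vna_tr T = T (delta K 1%g) 1%g.
Proof. exact: inner_delta. Qed.

Lemma vna_tr_delta T (g : G) : T (delta K g) g = vna_tr T.
Proof.
have -> : delta K g = rtrans g^-1%g (delta K 1%g) by rewrite rtrans_delta invgK mul1g.
by rewrite vna_rtrans rtransE mulgV vna_trE.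
Qed.

Lemma vna_tr_is_zmod_morphism : zmod_morphism (@vna_tr K G).
Proof. by move=> S T; rewrite !vna_trE. Qed.
HB.instance Definition _ := GRing.isZmodMorphism.Build NG C (@vna_tr K G)
  vna_tr_is_zmod_morphism.

(** Moving [S] to its adjoint and using equivariance exhibits the trace as the coefficient at 1 of a
    convolution; the substitution of g^-1 for g then yields the trace property. *)
Lemma vna_trM S T : vna_tr (S * T) =
  csum (fun g => T (delta K 1%g) g * S (delta K 1%g) g^-1%g).
Proof.
rewrite /vna_tr vnaME -{1}(starK S) starE /inner; congr csum.
apply/funext => g; congr (_ * _).
rewrite -inner_delta starE inner_conj inner_delta conjcK.
have -> : delta K g = rtrans g^-1%g (delta K 1%g) by rewrite rtrans_delta invgK mul1g.
by rewrite vna_rtrans rtransE mul1g.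
Qed.

Lemma vna_trC S T : vna_tr (S * T) = vna_tr (T * S).
Proof.
have bij_inv : bijective (fun g : G => g^-1%g) by exists (fun g => g^-1%g); exact: invgK.
rewrite !vna_trM -[RHS](csum_bij _ bij_inv); congr csum.
by apply/funext => g /=; rewrite invgK mulrC.
Qed.

Lemma vna_tr_star_ge0 T : 0 <= vna_tr (star T * T).
Proof.
by rewrite /vna_tr vnaME starE inner_nrm2 -[0]/((0 : K)%:C%C) lecR nrm2_ge0.
Qed.

Definition tends u x := forall e : K, 0 < e -> exists N, forall k, (N <= k)%N ->
  nrm2 (u k - x) <= e.
Definition ctends (a : nat -> C) (b : C) := forall e : K, 0 < e ->
  exists N, forall k, (N <= k)%N -> sqnormc (a k - b) <= e.

Lemma ctends_unique (a : nat -> C) b b' : ctends a b -> ctends a b' -> b = b'.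
Proof.
move=> ab ab'; apply/eqP; rewrite -subr_eq0 -sqnormc_eq0 eq_le sqnormc_ge0 andbT.
apply/ler_addgt0Pr => e e0; rewrite add0r; have e4 : 0 < e / 4 by lra.
have [N aN] := ab _ e4; have [M aM] := ab' _ e4.
have := aN _ (leq_maxl N M); have := aM _ (leq_maxr N M); move: (a _) => z h1 h2.
rewrite (_ : b - b' = (z - b') + (b - z)); last by rewrite [RHS]addrC addrA subrK.
apply: le_trans (sqnormcD _ _) _.
rewrite (_ : sqnormc (b - z) = sqnormc (z - b)); first by lra.
by case: (z) (b) => [? ?] [? ?]; rewrite /sqnormc /=; ring.
Qed.

Lemma ctends_ge0 (a : nat -> C) b : ctends a b -> (forall k, 0 <= a k) -> 0 <= b.
Proof.
move=> ab a0; case: b ab => p q ab.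
have small e : 0 < e -> - e <= p /\ q ^+ 2 <= e.
  (* The bound e^2 serves the real part, which is compared without squares; the bound e serves the
     square of the imaginary part. *)
  move=> e0; have ee : 0 < Num.min e (e ^+ 2) by rewrite lt_min e0 exprn_gt0.
  have [N aN] := ab _ ee; have := aN N (leqnn N); have := a0 N.
  case: (a N) => s t; rewrite lecE /= => /andP [/eqP -> s0].
  rewrite le_min /sqnormc /= => /andP [h1 h2]; split.
    rewrite leNgt; apply/negP => h3.
    have h4 : e ^+ 2 < (s - p) ^+ 2.
      have h5 : e < s - p by lra.
      by rewrite ltr_pXn2r // nnegrE; lra.
    have := sqr_ge0 (0 - q); lra.
  have -> : q ^+ 2 = (0 - q) ^+ 2 by ring.
  by have := sqr_ge0 (s - p); lra.
rewrite lecE /=; apply/andP; split.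
  rewrite -sqrf_eq0 eq_le sqr_ge0 andbT; apply/ler_addgt0Pr => e /small [_].
  by rewrite add0r.
by apply/ler_addgt0Pr => e /small [+ _]; lra.
Qed.

Lemma tends_ext u u' x : (forall k, u k = u' k) -> tends u x -> tends u' x.
Proof. by move=> uu ux e /ux [N uN]; exists N => k /uN; rewrite uu. Qed.

Lemma tends_cst x : tends (fun=> x) x.
Proof. by move=> e e0; exists 0%N => k _; rewrite subrr nrm2_0 ltW. Qed.

Lemma tends_shift u x : tends u x -> tends (fun k => u k.+1) x.
Proof. by move=> ux e /ux [N uN]; exists N => k Nk; apply: uN; rewrite leqW. Qed.

Lemma tends_inner u x y : tends u x -> ctends (fun k => inner (u k) y) (inner x y).
Proof.
move=> ux e e0; have y1 : 0 < nrm2 y + 1 by have := nrm2_ge0 y; lra.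
have [N uN] := ux _ (divr_gt0 e0 y1); exists N => k /uN h.
rewrite -innerBl; apply: le_trans (cauchy_schwarz _ _) _.
rewrite ler_pdivlMr // in h; apply: le_trans h.
by rewrite ler_wpM2l ?nrm2_ge0 // lerDl.
Qed.

Lemma tends_unique u x y : tends u x -> tends u y -> x = y.
Proof.
move=> ux uy; apply: inner_ext => z.
exact: ctends_unique (tends_inner z ux) (tends_inner z uy).
Qed.

Lemma tendsD u v x y : tends u x -> tends v y -> tends (fun k => u k + v k) (x + y).
Proof.
move=> ux vy e e0; have e4 : 0 < e / 4 by lra.
have [N uN] := ux _ e4; have [M vM] := vy _ e4; exists (maxn N M) => k.
rewrite geq_max => /andP [/uN h1 /vM h2].
rewrite opprD addrACA; apply: le_trans (nrm2D_le _ _) _; rewrite mulr2n; lra.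
Qed.

Lemma tendsZ (a : C) u x : tends u x -> tends (fun k => a *: u k) (a *: x).
Proof.
move=> ux e e0; have a1 : 0 < sqnormc a + 1 by have := sqnormc_ge0 a; lra.
have [N uN] := ux _ (divr_gt0 e0 a1); exists N => k /uN h.
rewrite -scalerBr nrm2Z; rewrite ler_pdivlMr // in h; apply: le_trans h.
by rewrite mulrC ler_wpM2l ?nrm2_ge0 // lerDl.
Qed.

Lemma tends_vna T u x : tends u x -> tends (fun k => T (u k)) (T x).
Proof.
have [c c0 Tc] := vna_bound T => ux e e0; have c1 : 0 < c + 1 by lra.
have [N uN] := ux _ (divr_gt0 e0 c1); exists N => k /uN h.
rewrite -vna_funB; apply: le_trans (Tc _) _; rewrite ler_pdivlMr // in h.
by apply: le_trans h; rewrite mulrC ler_wpM2l ?nrm2_ge0 // lerDl.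
Qed.

Lemma tends_rtrans (g : G) u x : tends u x -> tends (fun k => rtrans g (u k)) (rtrans g x).
Proof.
move=> ux e /ux [N uN]; exists N => k /uN; congr (_ <= _).
suff -> : rtrans g (u k) - rtrans g x = rtrans g (u k - x).
  by rewrite /nrm2 sqnorm_bij //; exact: mulgr_bij.
by apply: ell2P.
Qed.

Lemma tends_sum (I : Type) (s : seq I) (u : I -> nat -> L2) (x : I -> L2) :
  (forall i, tends (u i) (x i)) ->
  tends (fun k => \sum_(i <- s) u i k) (\sum_(i <- s) x i).
Proof.
move=> ux; elim: s => [|i s IHs].
  by apply: tends_ext (tends_cst _) => k; rewrite !big_nil.
rewrite big_cons; apply: tends_ext (tendsD (ux i) IHs) => k.
by rewrite big_cons.
Qed.

(** The factor 4 is not sharp; it serves to show that a strong limit of contractions is bounded. *)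
Lemma tends_le u x (c : K) : tends u x -> (forall k, nrm2 (u k) <= c) -> nrm2 x <= c *+ 4.
Proof.
move=> ux uc; apply/ler_addgt0Pr => e e0; have e2 : 0 < e / 2 by lra.
have [N uN] := ux _ e2; have := uN N (leqnn N); have := uc N.
have -> : nrm2 x = nrm2 (u N + (- (u N - x))) by rewrite opprB addrC subrK.
have := nrm2D_le (u N) (- (u N - x)); rewrite nrm2N.
have := nrm2_ge0 (u N); rewrite -[(_ + _) *+ 2]mulr_natr -[c *+ 4]mulr_natr; lra.
Qed.

Lemma Re_le_sqnormc (a : C) (e : K) : 0 <= e -> sqnormc a <= e ^+ 2 ->
  `|complex.Re a| <= e /\ `|complex.Im a| <= e.
Proof.
case: a => p q e0; rewrite /sqnormc /= => h.
have hp : `|p| ^+ 2 <= e ^+ 2 by rewrite real_normK ?num_real //; have := sqr_ge0 q; lra.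
have hq : `|q| ^+ 2 <= e ^+ 2 by rewrite real_normK ?num_real //; have := sqr_ge0 p; lra.
by split; [move: hp|move: hq]; rewrite ler_pXn2r // nnegrE.
Qed.

(** The limit [v] is taken coordinatewise. Estimates over finite sets of coordinates, uniform in the
    set, show that u_k - v is square-summable and small for large k. *)
Lemma ell2_complete u :
  (forall e : K, 0 < e -> exists N, forall k l, (N <= k)%N -> (N <= l)%N ->
    nrm2 (u k - u l) <= e) -> exists x, tends u x.
Proof.
move=> uc.
have ug (g : G) : exists z : C, ctends (fun k => u k g) z.
  have small e : 0 < e -> exists N, forall k l, (N <= k)%N -> (N <= l)%N ->
      `|complex.Re (u k g) - complex.Re (u l g)| <= e /\
      `|complex.Im (u k g) - complex.Im (u l g)| <= e.
    move=> e0; have [N uN] := uc _ (exprn_gt0 2 e0); exists N => k l Nk Nl.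
    have := le_trans (nrm2_coord (u k - u l) g) (uN k l Nk Nl).
    rewrite -[(u k - u l : L2) g]/(u k g - u l g) => /(Re_le_sqnormc (ltW e0)).
    by case: (u k g) (u l g) => [? ?] [? ?].
  have [p pP] := @real_cauchy_limit K (fun k => complex.Re (u k g))
    (fun e e0 => let: ex_intro N h := small e e0 in ex_intro _ N (fun k l a b => (h k l a b).1)).
  have [q qP] := @real_cauchy_limit K (fun k => complex.Im (u k g))
    (fun e e0 => let: ex_intro N h := small e e0 in ex_intro _ N (fun k l a b => (h k l a b).2)).
  (* Since d <= 1, the two squares are at most d each, hence at most e / 2. *)
  exists (Complex p q) => e e0; pose d := Num.min 1 (e / 2).
  have d0 : 0 < d by rewrite lt_min; apply/andP; split; lra.
  have d1 : d <= 1 by rewrite ge_min lexx.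
  have d2 : d <= e / 2 by rewrite ge_min lexx orbT.
  have [N pN] := pP _ d0; have [M qM] := qP _ d0; exists (maxn N M) => k.
  rewrite geq_max => /andP [/pN h1 /qM h2].
  case: (u k g) h1 h2 => s t; rewrite /sqnormc /= !ler_norml => h1 h2.
  have : (s - p) ^+ 2 <= d * 1 by nra.
  have : (t - q) ^+ 2 <= d * 1 by nra.
  lra.
have [v vP] := choice ug.
have finite_limit (s : seq G) e : 0 < e -> exists N, forall k, (N <= k)%N ->
    \sum_(g <- s) sqnormc (u k g - v g) <= e.
  elim: s e => [|g s IHs] e e0; first by exists 0%N => k _; rewrite big_nil ltW.
  have e2 : 0 < e / 2 by lra.
  have [N uN] := vP g _ e2; have [M uM] := IHs _ e2; exists (maxn N M) => k.
  by rewrite geq_max big_cons => /andP [/uN + /uM]; lra.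
have fin_le e N : 0 < e -> (forall k l, (N <= k)%N -> (N <= l)%N -> nrm2 (u k - u l) <= e) ->
    forall k, (N <= k)%N -> forall s : seq G, uniq s ->
    \sum_(g <- s) sqnormc (u k g - v g) <= e * 4.
  move=> e0 uN k Nk s us; have [M sM] := finite_limit s e e0.
  set l := maxn N M; have Nl : (N <= l)%N by exact: leq_maxl.
  apply: (@le_trans _ _ (\sum_(g <- s) (sqnormc (u k g - u l g) * 2 + sqnormc (u l g - v g) * 2))).
    apply: ler_sum => g _; have := sqnormcD (u k g - u l g) (u l g - v g).
    by rewrite addrA subrK; lra.
  rewrite big_split /= -!mulr_suml.
  have := sM l (leq_maxr _ _); have := uN k l Nk Nl; have -> : e * 4 = e * 2 + e * 2 by ring.
  suff : \sum_(g <- s) sqnormc (u k g - u l g) <= nrm2 (u k - u l) by lra.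
  rewrite -lee_fin -nrm2E; apply: esum_ge; exists [set` s]%classic.
    by split=> //; exact: finite_seq.
  rewrite -fsbig_seq //= sumEFin lee_fin; exact: lexx.
have [N uN] := uc 1 ltr01.
have wP := ell2_of_fin_le (fin_le _ _ ltr01 uN N (leqnn N)).
pose w : L2 := Sub (fun g => u N g - v g) wP.
(* Its coordinates are those of [v]; square-summability has been obtained for the difference [w]
   only. *)
exists (u N - w) => e e0; have e4 : 0 < e / 4 by lra.
have [M uM] := uc _ e4; exists M => k Mk.
have -> : e = e / 4 * 4 by lra.
apply: nrm2_fin_le => s us; have := fin_le _ _ e4 uM k Mk s us.
congr (_ <= _); apply: eq_bigr => g _; congr sqnormc.
rewrite -[RHS]/(u k g - (u N g - (u N g - v g))); ring.
Qed.
End Operators.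

(** * Matrices of operators *)

Section Matrices.
Variables (K : realType) (G : groupType).
Local Notation C := (K[i]).
Local Notation L2 := (ell2 K G).
Local Notation NG := (vna K G).

Definition mact m n (M : 'M[NG]_(m, n)) (x : 'I_n -> L2) : 'I_m -> L2 :=
  fun i => \sum_j M i j (x j).
Definition vin n (x y : 'I_n -> L2) : C := \sum_i inner (x i) (y i).
Definition vnrm n (x : 'I_n -> L2) : K := \sum_i nrm2 (x i).
Definition dag m n (M : 'M[NG]_(m, n)) : 'M[NG]_(n, m) := map_mx (@star K G) M^T.
Definition mtr n (M : 'M[NG]_n) : C := \sum_i vna_tr (M i i).
Definition single n (j : 'I_n) (x : L2) : 'I_n -> L2 := fun i => if i == j then x else 0.

Lemma mact_mul m n p (A : 'M[NG]_(m, n)) (B : 'M[NG]_(n, p)) x :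
  mact (A *m B) x = mact A (mact B x).
Proof.
apply/funext => i; rewrite /mact; under [RHS]eq_bigr do rewrite vna_fun_sum.
rewrite exchange_big; apply: eq_bigr => j _; rewrite mxE vna_sumE.
by apply: eq_bigr => l _.
Qed.

Lemma mact_single m n (M : 'M[NG]_(m, n)) i j x : mact M (single j x) i = M i j x.
Proof.
rewrite /mact /single (bigD1 j) //= eqxx big1 ?addr0 // => l /negbTE ->.
by rewrite vna_fun0.
Qed.

Lemma mact_inj m n (M N : 'M[NG]_(m, n)) : (forall x, mact M x = mact N x) -> M = N.
Proof.
move=> MN; apply/matrixP => i j; apply: vna_ext => x.
by rewrite -!mact_single MN.
Qed.

Lemma mact1 n (x : 'I_n -> L2) : mact 1%:M x = x.
Proof.
apply/funext => i; rewrite /mact (bigD1 i) //= mxE eqxx big1 ?addr0 //.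
by move=> j /negbTE ji; rewrite mxE eq_sym ji.
Qed.

Lemma mactB m n (M N : 'M[NG]_(m, n)) x i : mact (M - N) x i = mact M x i - mact N x i.
Proof. by rewrite /mact -sumrB; apply: eq_bigr => j _; rewrite !mxE. Qed.

Lemma mact0 m n (x : 'I_n -> L2) i : mact (0 : 'M[NG]_(m, n)) x i = 0.
Proof. by rewrite /mact big1 // => j _; rewrite mxE. Qed.

Lemma vin_dag m n (M : 'M[NG]_(m, n)) x y : vin (mact M x) y = vin x (mact (dag M) y).
Proof.
rewrite /vin /mact; under eq_bigr do rewrite inner_suml.
under [RHS]eq_bigr do rewrite inner_sumr.
rewrite exchange_big; apply: eq_bigr => j _; apply: eq_bigr => i _.
by rewrite !mxE -starE starK.
Qed.

Lemma vin_vnrm n (x : 'I_n -> L2) : vin x x = (vnrm x)%:C%C.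
Proof. by rewrite /vnrm rmorph_sum; apply: eq_bigr => i _; rewrite inner_nrm2. Qed.

Lemma vnrmB n (x y : 'I_n -> L2) :
  vnrm (fun i => x i - y i) = vnrm x - complex.Re (vin x y) *+ 2 + vnrm y.
Proof.
rewrite /vnrm /vin Re_sum -sumrMnl -sumrB -big_split.
by apply: eq_bigr => i _; rewrite /= nrm2B.
Qed.

Lemma vnrm_ge0 n (x : 'I_n -> L2) : 0 <= vnrm x.
Proof. by apply: sumr_ge0 => i _; exact: nrm2_ge0. Qed.

Lemma nrm2_le_vnrm n (x : 'I_n -> L2) i : nrm2 (x i) <= vnrm x.
Proof.
rewrite /vnrm (bigD1 i) //= lerDl; apply: sumr_ge0 => j _; exact: nrm2_ge0.
Qed.

Lemma vnrm_single n (j : 'I_n) x : vnrm (single j x) = nrm2 x.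
Proof.
rewrite /vnrm /single (bigD1 j) //= eqxx big1 ?addr0 // => l /negbTE ->.
exact: nrm2_0.
Qed.

Lemma dagM m n p (A : 'M[NG]_(m, n)) (B : 'M[NG]_(n, p)) :
  dag (A *m B) = dag B *m dag A.
Proof.
apply/matrixP => i j; rewrite !mxE raddf_sum /=; apply: eq_bigr => l _.
by rewrite !mxE starM.
Qed.
Lemma dagK m n (M : 'M[NG]_(m, n)) : dag (dag M) = M.
Proof. by apply/matrixP => i j; rewrite !mxE starK. Qed.
Lemma dagB m n (M N : 'M[NG]_(m, n)) : dag (M - N) = dag M - dag N.
Proof. by apply/matrixP => i j; rewrite !mxE raddfB. Qed.
Lemma dag1 n : dag (1%:M : 'M[NG]_n) = 1%:M.
Proof.
apply/matrixP => i j; rewrite !mxE eq_sym; case: eqP => _ /=; first exact: star1.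
by rewrite !mulr0n raddf0.
Qed.
Lemma dagX n (M : 'M[NG]_n) k : dag (M ^+ k) = dag M ^+ k.
Proof.
elim: k => [|k IHk]; first by rewrite !expr0; exact: dag1.
by rewrite exprS exprSr -!mulmxE dagM IHk.
Qed.

Lemma projection_mx_dag n (P : 'M[NG]_n) : projection_mx P -> dag P = P /\ P *m P = P.
Proof.
by move=> [PP Padj]; split=> //; apply/matrixP => i j; rewrite !mxE; apply: vna_adjointE.
Qed.

Lemma mtrB n (M N : 'M[NG]_n) : mtr (M - N) = mtr M - mtr N.
Proof. by rewrite /mtr -sumrB; apply: eq_bigr => i _; rewrite !mxE raddfB. Qed.
Lemma mtr_mulC m n (A : 'M[NG]_(m, n)) (B : 'M[NG]_(n, m)) :
  mtr (A *m B) = mtr (B *m A).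
Proof.
rewrite /mtr; under eq_bigr do rewrite mxE raddf_sum.
under [RHS]eq_bigr do rewrite mxE raddf_sum.
rewrite exchange_big; apply: eq_bigr => i _; apply: eq_bigr => j _.
exact: vna_trC.
Qed.
Lemma mtr_dag_ge0 m n (M : 'M[NG]_(m, n)) : 0 <= mtr (dag M *m M).
Proof.
apply: sumr_ge0 => i _; rewrite mxE raddf_sum; apply: sumr_ge0 => j _.
by rewrite !mxE; exact: vna_tr_star_ge0.
Qed.
Lemma mtr1 n : mtr (1%:M : 'M[NG]_n) = n%:R.
Proof.
rewrite /mtr; under eq_bigr => i _.
  rewrite mxE eqxx vna_trE vna1E deltaE eqxx; over.
by rewrite sumr_const card_ord.
Qed.

Lemma vna_sum_bound (n : nat) (T : 'I_n -> NG) : exists2 c : K, 0 <= c &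
  forall x, nrm2 (\sum_i T i (x i)) <= c * vnrm x.
Proof.
rewrite /vnrm; elim: n T => [|n IHn] T.
  by exists 0 => // x; rewrite !big_ord0 nrm2_0 mulr0.
have [c c0 Tc] := IHn (fun i => T (lift ord0 i)).
have [d d0 Td] := vna_bound (T ord0).
exists ((c + d) * 2) => [|x]; first by rewrite mulr_ge0 // addr_ge0.
rewrite !big_ord_recl; apply: le_trans (nrm2D_le _ _) _.
have := Tc (fun i => x (lift ord0 i)); have := Td (x ord0).
have := nrm2_ge0 (x ord0).
have : 0 <= \sum_i nrm2 (x (lift ord0 i)).
  by apply: sumr_ge0 => i _; exact: nrm2_ge0.
rewrite mulr2n; nra.
Qed.

Lemma mact_bound m n (M : 'M[NG]_(m, n)) : exists2 c : K, 0 <= c &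
  forall x, vnrm (mact M x) <= c * vnrm x.
Proof.
have /choice [c cP] : forall i, exists c : K, 0 <= c /\
    forall x, nrm2 (mact M x i) <= c * vnrm x.
  by move=> i; have [c c0 Tc] := vna_sum_bound (M i); exists c.
exists (\sum_i c i); first by apply: sumr_ge0 => i _; have [] := cP i.
move=> x; rewrite /vnrm mulr_suml; apply: ler_sum => i _.
by have [_] := cP i; apply.
Qed.

Lemma strong_limit (T : nat -> NG) :
  (forall k x, nrm2 (T k x) <= nrm2 x) ->
  (forall x, exists y, tends (fun k => T k x) y) ->
  exists L : NG, forall x, tends (fun k => T k x) (L x).
Proof.
move=> Tle /choice [f fP].
have fvna : f \in @vna_pred K G.
  apply/vnaP; split.
  - move=> a x y; apply: tends_unique (fP _) _.
    apply: tends_ext (tendsD (tendsZ a (fP x)) (fP y)) => k.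
    by rewrite vna_funD vna_funZ.
  - exists 4 => x; rewrite !nrm2E -EFinM lee_fin.
    by rewrite mulrC mulr_natr; apply: tends_le (fP x) _ => k.
  - move=> g x; apply: tends_unique (fP _) _.
    apply: tends_ext (tends_rtrans g (fP x)) => k.
    by rewrite vna_rtrans.
by exists (Sub f fvna).
Qed.

Definition smtends m n (A : nat -> 'M[NG]_(m, n)) (M : 'M[NG]_(m, n)) :=
  forall i j x, tends (fun k => A k i j x) (M i j x).

Lemma smtends_mull m n p (B : 'M[NG]_(m, n)) A (M : 'M[NG]_(n, p)) :
  smtends A M -> smtends (fun k => B *m A k) (B *m M).
Proof.
move=> AM i j x; rewrite mxE vna_sumE.
apply: tends_ext (tends_sum _ (fun l => tends_vna (B i l) (AM l j x))) => k.
by rewrite mxE vna_sumE.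
Qed.

Lemma smtends_mulr m n p (B : 'M[NG]_(n, p)) A (M : 'M[NG]_(m, n)) :
  smtends A M -> smtends (fun k => A k *m B) (M *m B).
Proof.
move=> AM i j x; rewrite mxE vna_sumE.
apply: tends_ext (tends_sum _ (fun l => AM i l (B l j x))) => k.
by rewrite mxE vna_sumE.
Qed.

Lemma smtends_unique m n (A : nat -> 'M[NG]_(m, n)) M N :
  smtends A M -> smtends A N -> M = N.
Proof.
move=> AM AN; apply/matrixP => i j; apply: vna_ext => x.
exact: tends_unique (AM i j x) (AN i j x).
Qed.

Lemma smtends_ext m n (A A' : nat -> 'M[NG]_(m, n)) M :
  (forall k, A k = A' k) -> smtends A M -> smtends A' M.
Proof. by move=> AA' AM i j x; apply: tends_ext (AM i j x) => k; rewrite AA'. Qed.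

Lemma smtends_cst m n (M : 'M[NG]_(m, n)) : smtends (fun=> M) M.
Proof. by move=> i j x; exact: tends_cst. Qed.

Lemma smtends_dag n (A : nat -> 'M[NG]_n) M :
  smtends A M -> (forall k, dag (A k) = A k) -> dag M = M.
Proof.
move=> AM Ad; apply/matrixP => i j; rewrite !mxE; apply/esym/starP => x y.
apply: ctends_unique (tends_inner y (AM i j x)) _.
rewrite inner_conj => e e0; have [N AN] := tends_inner x (AM j i y) e0.
exists N => k /AN; congr (_ <= _).
have -> : A k i j = star (A k j i) by rewrite -[in LHS](Ad k) !mxE.
rewrite starE [inner x (A k j i y)]inner_conj.
by case: (inner _ _) (inner _ _) => [p q] [s t]; rewrite /sqnormc /=; ring.
Qed.

Lemma ctendsD (a b : nat -> C) (x y : C) :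
  ctends a x -> ctends b y -> ctends (fun k => a k + b k) (x + y).
Proof.
move=> ux vy e e0; have e4 : 0 < e / 4 by lra.
have [N uN] := ux _ e4; have [M vM] := vy _ e4; exists (maxn N M) => k.
rewrite geq_max => /andP [/uN h1 /vM h2].
rewrite opprD addrACA; apply: le_trans (sqnormcD _ _) _; lra.
Qed.

Lemma smtends_tr n (A : nat -> 'M[NG]_n) M :
  smtends A M -> ctends (fun k => mtr (A k)) (mtr M).
Proof.
move=> AM; rewrite /mtr; elim: (index_enum _) => [|i s IHs].
  move=> e e0; exists 0%N => k _; rewrite !big_nil subrr /sqnormc /=.
  by rewrite expr0n addr0 ltW.
rewrite big_cons => e e0.
have [N uN] := ctendsD (tends_inner (delta K 1%g) (AM i i (delta K 1%g))) IHs e0.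
by exists N => k /uN; rewrite big_cons.
Qed.

Lemma decreasing_cauchy (a : nat -> K) : (forall k, 0 <= a k) ->
  (forall k, a k.+1 <= a k) ->
  forall e, 0 < e -> exists N, forall k l, (N <= k)%N -> (N <= l)%N -> a k - a l <= e.
Proof.
move=> a0 aS e e0.
have mono k l : (k <= l)%N -> a l <= a k.
  move=> /subnK <-; elim: (l - k)%N => // d IHd.
  by rewrite addSn (le_trans (aS _)).
pose E := [set y | exists k, y = - a k]%classic.
have Eub : ubound E 0 by move=> _ [k ->]; rewrite oppr_le0.
have Ene : E (- a 0%N) by exists 0%N.
have [|y [N ->] yE] := @sup_adherent _ E e e0; first by split; [exists (- a 0%N)|exists 0].
exists N => k l Nk Nl; have := mono N k Nk.
have : - a l <= sup E by apply: (@ub_le_sup _ E); [exists 0|exists l].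
lra.
Qed.

(** Let a_k = |S^k v|^2, a decreasing sequence. As [S] is self-adjoint, <S^(2k) v, S^(2l) v> =
    a_(k+l), so |S^(2k) v - S^(2l) v|^2 = a_(2k) - 2 a_(k+l) + a_(2l), which tends to 0. Even
    exponents avoid the oscillation at the eigenvalue -1. *)
Lemma contraction_limit n (S : 'M[NG]_n) : dag S = S ->
  (forall x, vnrm (mact S x) <= vnrm x) ->
  exists J : 'M[NG]_n, smtends (fun k => S ^+ k.*2) J.
Proof.
move=> Sd Sc.
have adj x y k : vin (mact (S ^+ k) x) y = vin x (mact (S ^+ k) y).
  by rewrite vin_dag dagX Sd.
have mactX x k l : mact (S ^+ (k + l)) x = mact (S ^+ k) (mact (S ^+ l) x).
  by rewrite exprD -mulmxE mact_mul.
have Sck k x : vnrm (mact (S ^+ k) x) <= vnrm x.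
  elim: k => [|k IHk]; first by rewrite expr0 [mact _ _]mact1.
  by rewrite exprS -mulmxE mact_mul (le_trans (Sc _)).
have cau i j x : exists y, tends (fun k => ((S ^+ k.*2) i j : NG) x) y.
  apply: ell2_complete => e e0; pose v := single j x.
  pose a k := vnrm (mact (S ^+ k) v).
  have e2 : 0 < e / 2 by lra.
  have [||N aN] := @decreasing_cauchy a _ _ _ e2.
  - by move=> k; exact: vnrm_ge0.
  - by move=> k; rewrite /a -add1n mactX expr1.
  exists N => k l Nk Nl; rewrite -!mact_single -/v.
  apply: le_trans (nrm2_le_vnrm (fun i => mact (S ^+ k.*2) v i - mact (S ^+ l.*2) v i) i) _.
  rewrite vnrmB.
  have -> : vin (mact (S ^+ k.*2) v) (mact (S ^+ l.*2) v) = (a (k + l)%N)%:C%C.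
    rewrite -vin_vnrm (adj v _ k.*2) (adj v _ (k + l)%N).
    rewrite -(mactX v k.*2) -(mactX v (k + l)%N).
    by rewrite -!addnn addnACA.
  have := aN k.*2 (k + l)%N; have := aN l.*2 (k + l)%N.
  rewrite -!addnn !(leq_trans Nk (leq_addr _ _)) !(leq_trans Nl (leq_addr _ _)).
  by rewrite /= -[vnrm _ *+ 2]mulr_natr /a => /(_ isT isT) h1 /(_ isT isT) h2; lra.
have /choice [J JP] : forall ij : 'I_n * 'I_n, exists L : NG,
    forall x, tends (fun k => ((S ^+ k.*2) ij.1 ij.2 : NG) x) (L x).
  move=> [i j] /=; apply: (strong_limit (T := fun k => (S ^+ k.*2) i j)) => // k x.
  rewrite -mact_single (le_trans (nrm2_le_vnrm _ _)) // (le_trans (Sck _ _)) //.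
  by rewrite vnrm_single.
by exists (\matrix_(i, j) J (i, j)) => i j x; rewrite mxE; exact: JP (i, j) x.
Qed.

Lemma contraction_projection n (S : 'M[NG]_n) : dag S = S ->
  (forall x, vnrm (mact S x) <= vnrm x) ->
  exists J : 'M[NG]_n, [/\ dag J = J, J *m J = J, S *m (S *m J) = J,
    forall m (Z : 'M[NG]_(n, m)), S *m Z = Z -> J *m Z = Z
    & ctends (fun k => mtr (S ^+ k.*2)) (mtr J)].
Proof.
move=> Sd Sc; have [J JP] := contraction_limit Sd Sc.
have SSJ : S *m (S *m J) = J.
  apply: smtends_unique (smtends_mull S (smtends_mull S JP)) _.
  move=> i j x; apply: tends_ext (tends_shift (JP i j x)) => k.
  by rewrite doubleS !exprS.
have SJ k : S ^+ k.*2 *m J = J.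
  elim: k => [|k IHk]; first by rewrite expr0 [_ *m _]mul1mx.
  by rewrite doubleS !exprSr -!mulmxE -!mulmxA SSJ.
exists J; split=> //.
- by apply: smtends_dag JP _ => k; rewrite dagX Sd.
- apply: smtends_unique (smtends_mulr J JP) _.
  by apply: smtends_ext (smtends_cst J) => k; rewrite SJ.
- move=> m Z SZ; apply: smtends_unique (smtends_mulr Z JP) _.
  apply: smtends_ext (smtends_cst Z) => k; elim: (k.*2) => [|l IHl].
    by rewrite expr0 [_ *m _]mul1mx.
  by rewrite exprSr -mulmxE -mulmxA SZ -IHl.
- exact: smtends_tr.
Qed.
End Matrices.

(** * Projections onto kernels and rank-nullity for the trace *)

Section KernelProjection.
Variables (K : realType) (G : groupType).
Local Notation C := (K[i]).
Local Notation L2 := (ell2 K G).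
Local Notation NG := (vna K G).

(** That the range of [J] is all of the kernel is expressed through matrices [Z] over the von
    Neumann algebra, the form in which traces can be compared. *)
Definition kernel_projection k q (B : 'M[NG]_(k, q)) (J : 'M[NG]_q) : Prop :=
  [/\ dag J = J, J *m J = J, B *m J = 0 &
    forall m (Z : 'M[NG]_(q, m)), B *m Z = 0 -> J *m Z = Z].

Lemma one_sub_power n (S : 'M[NG]_n) m :
  1%:M - S ^+ m = (1%:M - S) *m (\sum_(i < m) S ^+ i).
Proof.
have h : S ^+ m - 1%:M = (S - 1%:M) *m (\sum_(i < m) S ^+ i) := subrX1 S m.
by rewrite -opprB h -mulNmx opprB.
Qed.

(* With S = 1 - B^* B and S' = 1 - B B^*, the trace of 1 - S^(2l) equals that of
   1 - S'^(2l), and N - (1 - S'^(2l)) = N S'^(2l) N is positive. *)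
Lemma contraction_kernel_projection k q (B : 'M[NG]_(k, q)) :
  (forall x, vnrm (mact B x) <= vnrm x) ->
  (forall x, vnrm (mact (dag B) x) <= vnrm x) ->
  exists2 J : 'M[NG]_q, kernel_projection B J &
    forall N : 'M[NG]_k, dag N = N -> N *m N = N -> N *m B = B ->
    q%:R - mtr J <= mtr N.
Proof.
move=> Bc Bdc; pose S : 'M[NG]_q := 1%:M - dag B *m B.
pose S' : 'M[NG]_k := 1%:M - B *m dag B.
have Sd : dag S = S by rewrite dagB dag1 dagM dagK.
have S'd : dag S' = S' by rewrite dagB dag1 dagM dagK.
(* |S x|^2 = |x|^2 - 2 |B x|^2 + |B^* B x|^2, and the adjoint of [B] is a contraction. *)
have Sn x : vnrm (mact S x) <= vnrm x - vnrm (mact B x).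
  rewrite (_ : mact S x = fun i => x i - mact (dag B *m B) x i); last first.
    by apply/funext => i; rewrite mactB mact1.
  rewrite vnrmB mact_mul -vin_dag vin_vnrm /=.
  by have := Bdc (mact B x); rewrite -[vnrm _ *+ 2]mulr_natr; lra.
have Sc x : vnrm (mact S x) <= vnrm x.
  by apply: le_trans (Sn x) _; rewrite gerBl vnrm_ge0.
have [J [Jd JJ SSJ Jfix Jtr]] := contraction_projection Sd Sc.
exists J; first split=> //.
- apply: mact_inj => x; apply/funext => i; rewrite mact_mul mact0.
  set y := mact J x; apply: nrm2_eq0; apply: le_trans (nrm2_le_vnrm _ i) _.
  (* S S y = y and self-adjointness make [S] preserve the norm of [y]; by [Sn] the loss of norm is
     at least |B y|^2, which therefore vanishes. *)
  have yE : vnrm y = vnrm (mact S y).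
    have SSy : mact S (mact S y) = y by rewrite /y -(mact_mul S J) -(mact_mul S) SSJ.
    by have := vin_vnrm (mact S y); rewrite vin_dag Sd SSy vin_vnrm => -[].
  by have := Sn y; lra.
- move=> m Z BZ; apply: Jfix.
  by rewrite mulmxBl mul1mx -mulmxA BZ mulmx0 subr0.
move=> N Nd NN NB; rewrite -(mtr1 K G q) -subr_ge0.
pose Zk l := S' ^+ l *m N.
suff trE l : mtr (dag (Zk l) *m Zk l) = mtr N - (mtr (1%:M : 'M[NG]_q) - mtr (S ^+ l.*2)).
  have cst a b : ctends (fun k => mtr (S ^+ k.*2)) b -> ctends (fun k => a + mtr (S ^+ k.*2)) (a + b).
    by move=> ub e /ub [M uM]; exists M => i /uM; rewrite opprD addrACA subrr add0r.
  have lim := cst (mtr N - mtr (1%:M : 'M[NG]_q)) _ Jtr.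
  rewrite opprB addrA addrAC; apply: (ctends_ge0 lim) => l.
  by rewrite addrAC -addrA -opprB -trE mtr_dag_ge0.
have BS i : B *m S ^+ i = S' ^+ i *m B.
  elim: i => [|i IHi]; first by rewrite !expr0 [B *m _]mulmx1 [_ *m B]mul1mx.
  rewrite !exprSr -!mulmxE mulmxA IHi -!mulmxA; congr (_ *m _).
  by rewrite mulmxBr mulmx1 mulmxBl mul1mx mulmxA.
pose Y := 1%:M - S' ^+ l.*2.
have YE : Y = B *m dag B *m (\sum_(i < l.*2) S' ^+ i).
  by rewrite /Y one_sub_power opprB addrC subrK.
have NY : N *m Y = Y by rewrite YE !mulmxA NB.
have Yd : dag Y = Y by rewrite /Y dagB dag1 dagX S'd.
have YN : Y *m N = Y by rewrite -[LHS]dagK dagM Nd Yd NY Yd.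
have -> : dag (Zk l) *m Zk l = N - Y.
  rewrite /Zk dagM dagX S'd Nd -mulmxA [S' ^+ l *m (_ *m N)]mulmxA.
  rewrite (_ : S' ^+ l *m S' ^+ l = 1%:M - Y); last first.
    by rewrite /Y opprB addrC subrK -addnn exprD mulmxE.
  by rewrite mulmxBl mulmxBr mul1mx NN YN NY.
rewrite mtrB -[X in _ = _ - X]mtrB; congr (_ - _).
rewrite one_sub_power YE.
have -> : 1%:M - S = dag B *m B by rewrite /S opprB addrC subrK.
have BA : B *m (\sum_(i < l.*2) S ^+ i) = (\sum_(i < l.*2) S' ^+ i) *m B.
  by rewrite mulmx_sumr mulmx_suml; apply: eq_bigr => i _; rewrite BS.
rewrite [LHS](mtr_mulC (B *m dag B)) mulmxA -BA.
by rewrite [LHS](mtr_mulC _ (dag B)) mulmxA.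
Qed.

Lemma mact_scalar n r (x : 'I_n -> L2) i :
  mact ((vna_scalar G r)%:M : 'M[NG]_n) x i = (r%:C%C : C) *: x i.
Proof.
rewrite /mact (bigD1 i) //= mxE eqxx big1 ?addr0 => [|j /negbTE ji].
  by rewrite mulr1n vna_scalarE.
by rewrite mxE eq_sym ji.
Qed.

(** The trace inequality is one half of rank-nullity: q - tr J is the dimension of the closed range
    of [B], and [N] is any projection whose range contains it. The general case follows from that of
    contractions by a scaling, which does not change the kernel. *)
Lemma kernel_projection_exists k q (B : 'M[NG]_(k, q)) :
  exists2 J : 'M[NG]_q, kernel_projection B J &
    forall N : 'M[NG]_k, dag N = N -> N *m N = N -> N *m B = B ->
    q%:R - mtr J <= mtr N.
Proof.
have [c c0 Bc] := mact_bound B; have [d d0 Bd] := mact_bound (dag B).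
(* Scaling by e^-1 multiplies squared norms by e^-2; since e is at least 1, [c] and [d], both [B']
   and its adjoint become contractions. *)
pose e := c + d + 1; have e1 : 1 <= e by rewrite /e; lra.
have e0 : 0 < e by lra.
have ne : e != 0 by rewrite gt_eqF.
pose t := vna_scalar G e^-1; pose B' : 'M[NG]_(k, q) := t%:M *m B.
have vscale n (x : 'I_n -> L2) : vnrm (mact (t%:M : 'M[NG]_n) x) = e^-1 ^+ 2 * vnrm x.
  rewrite /vnrm mulr_sumr; apply: eq_bigr => i _.
  by rewrite mact_scalar nrm2Z /sqnormc /= expr0n addr0.
have ei1 : e^-1 ^+ 2 * e <= 1.
  by rewrite expr2 -mulrA mulVf // mulr1 invf_le1.
have shrink (v w f : K) : 0 <= v -> 0 <= f -> f <= e -> w <= f * v -> e^-1 ^+ 2 * w <= v.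
  move=> v0 f0 fe wv; apply: le_trans (ler_wpM2l (sqr_ge0 _) wv) _.
  rewrite mulrA -[X in _ <= X]mul1r ler_wpM2r //; apply: le_trans ei1.
  by rewrite ler_wpM2l ?sqr_ge0.
have tB m n (M : 'M[NG]_(m, n)) : t%:M *m M = M *m t%:M.
  rewrite mul_scalar_mx; apply/matrixP => i j; rewrite !mxE (bigD1 j) //= big1 ?addr0.
    by rewrite mxE eqxx mulr1n; exact: vna_scalar_central.
  by move=> l /negbTE lj; rewrite mxE lj mulr0.
have dagt n : dag (t%:M : 'M[NG]_n) = t%:M.
  apply/matrixP => i j; rewrite !mxE eq_sym raddfMn /=.
  by rewrite /= star_scalar.
have tinv n : (vna_scalar G e)%:M *m t%:M = 1%:M :> 'M[NG]_n.
  by rewrite -scalar_mxM /t vna_scalarM divff // vna_scalar1.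
have B'0 m (Z : 'M[NG]_(q, m)) : (B' *m Z = 0) <-> (B *m Z = 0).
  rewrite /B' -mulmxA; split=> [tZ|->]; last by rewrite mulmx0.
  by rewrite -[B *m Z]mul1mx -tinv -mulmxA tZ mulmx0.
have [||J [Jd JJ BJ Jfix] Jtr] := @contraction_kernel_projection k q B'.
- move=> x; rewrite /B' mact_mul vscale; apply: shrink (Bc x) => //; last by rewrite /e; lra.
  exact: vnrm_ge0.
- move=> x; rewrite /B' dagM dagt -tB mact_mul vscale.
  by apply: shrink (Bd x) => //; [exact: vnrm_ge0|rewrite /e; lra].
exists J; first by split=> // [|m Z]; [exact/B'0|move/B'0; exact: Jfix].
by move=> N Nd NN NB; apply: Jtr => //; rewrite /B' mulmxA -tB -mulmxA NB.
Qed.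
End KernelProjection.

(** * Comparison of traces for a projective module embedded in homology *)

Section TraceArgument.
Variables (K : realType) (G : groupType).
Local Notation C := (K[i]).
Local Notation NG := (vna K G).

Lemma mtr_block m n (A : 'M[NG]_m) (B : 'M[NG]_(m, n)) (B' : 'M[NG]_(n, m)) (D : 'M[NG]_n) :
  mtr (block_mx A B B' D) = mtr A + mtr D.
Proof.
rewrite /mtr big_split_ord /=; congr (_ + _); apply: eq_bigr => i _.
  by rewrite block_mxEul.
by rewrite block_mxEdr.
Qed.

Lemma dag_block m n (A : 'M[NG]_m) (B : 'M[NG]_(m, n)) (B' : 'M[NG]_(n, m)) (D : 'M[NG]_n) :
  dag (block_mx A B B' D) = block_mx (dag A) (dag B') (dag B) (dag D).
Proof. by rewrite /dag tr_block_mx map_block_mx. Qed.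

Lemma dag0 m n : dag (0 : 'M[NG]_(m, n)) = 0.
Proof. by apply/matrixP => i j; rewrite !mxE raddf0. Qed.

(** Q - P is M^* M for M = (1 - P) Q, because P Q = Q P = P. *)
Lemma mtr_projection_le n (P Q : 'M[NG]_n) : dag P = P -> P *m P = P ->
  dag Q = Q -> Q *m Q = Q -> Q *m P = P -> mtr P <= mtr Q.
Proof.
move=> Pd PP Qd QQ QP; rewrite -subr_ge0 -mtrB.
have PQ : P *m Q = P by rewrite -[LHS]dagK dagM Qd Pd QP Pd.
suff -> : Q - P = dag ((1%:M - P) *m Q) *m ((1%:M - P) *m Q) by exact: mtr_dag_ge0.
rewrite dagM dagB dag1 Pd Qd mulmxBr mulmx1 QP mulmxBl mulmxBl mul1mx PQ.
by rewrite !mulmxBr QQ QP PQ PP subrr subr0.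
Qed.

(* With J the projection onto ker (A, E), the last hypothesis on A gives
   J <= (1 - P) + JE, while p + m - tr J <= tr JD because (A, E) maps into ker D. *)
Lemma trace_le0_of_homology_embedding k' k m p (D : 'M[NG]_(k', k)) (E : 'M[NG]_(k, m))
    (A : 'M[NG]_(k, p)) (P : 'M[NG]_p) (JD : 'M[NG]_k) (JE : 'M[NG]_m) :
  kernel_projection D JD -> kernel_projection E JE ->
  D *m E = 0 -> D *m A = 0 -> A *m P = A -> dag P = P -> P *m P = P ->
  (forall (v : 'cV[NG]_p) (u : 'cV[NG]_m), A *m v = E *m u -> P *m v = 0) ->
  mtr JE + mtr JD <= m%:R -> mtr P <= 0.
Proof.
move=> [JDd JDJD _ JDfix] [JEd JEJE _ JEfix] DE DA AP Pd PP inj le_m.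
pose B : 'M[NG]_(k, p + m) := row_mx A E.
have [J [Jd JJ BJ _] Jtr] := kernel_projection_exists B.
have DB : D *m B = 0 by rewrite mul_mx_row DA DE row_mx0.
have h2 := Jtr JD JDd JDJD (JDfix _ _ DB).
have AEJ : A *m usubmx J + E *m dsubmx J = 0 by rewrite -mul_row_col vsubmxK.
have PJ : P *m usubmx J = 0.
  apply/matrixP => i j.
  have /inj : A *m col j (usubmx J) = E *m (- col j (dsubmx J)).
    rewrite mulmxN; apply/eqP; rewrite -subr_eq0 opprK; apply/eqP.
    by rewrite !colE !mulmxA -mulmxDl AEJ mul0mx.
  rewrite colE mulmxA -colE => /colP /(_ i).
  by rewrite !mxE.
have EJ : E *m dsubmx J = 0.
  by rewrite -AEJ -[in RHS]AP -mulmxA PJ mulmx0 add0r.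
pose Q : 'M[NG]_(p + m) := block_mx (1%:M - P) 0 0 JE.
have Qd : dag Q = Q by rewrite dag_block !dag0 dagB dag1 Pd JEd.
have QQ : Q *m Q = Q.
  rewrite mulmx_block !mul0mx !mulmx0 !addr0 !add0r JEJE.
  by rewrite mulmxBl mul1mx mulmxBr mulmx1 PP subrr subr0.
have QJ : Q *m J = J.
  rewrite -[J in LHS]vsubmxK mul_block_col !mul0mx addr0 add0r mulmxBl mul1mx PJ subr0.
  by rewrite (JEfix _ _ EJ) vsubmxK.
have trQ : mtr Q = p%:R - mtr P + mtr JE by rewrite /Q mtr_block mtrB mtr1.
have h3 := mtr_projection_le Jd JJ Qd QQ QJ; rewrite trQ -subr_ge0 in h3.
rewrite -subr_ge0 in h2; rewrite -subr_ge0 in le_m.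
(* The three nonnegative differences add up to - tr P: m - tr JE - tr JD, then tr JD - (p + m - tr
   J), then p - tr P + tr JE - tr J. *)
rewrite -oppr_ge0; have := addr_ge0 (addr_ge0 le_m h2) h3; congr (0 <= _).
rewrite natrD; move: (mtr J) (mtr P) (mtr JE) (mtr JD) (m%:R) (p%:R) => *; ring.
Qed.
End TraceArgument.

(** * Finite parts of group ring matrices *)

Section FiniteIndices.
Variable G : groupType.
Implicit Type S : {fset G}.

(** Pairs of a coordinate and an element of [S] are enumerated by ordinals, so that the finite parts
    are ordinary matrices with a rank. *)
Definition ixcard b S := #|{: 'I_b * S}|.
Definition ix b S (k : 'I_(ixcard b S)) : 'I_b * G :=
  ((enum_val k).1, val (enum_val k).2).

Lemma ixcardE b S : ixcard b S = (b * #|` S|)%N.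
Proof. by rewrite /ixcard card_prod card_ord cardfE. Qed.

Lemma ix_mem b S (k : 'I_(ixcard b S)) : (ix k).2 \in S.
Proof. exact: valP. Qed.

Lemma ix_inj b S : injective (@ix b S).
Proof.
move=> k l [h1 h2]; apply: enum_val_inj.
by case: (enum_val k) (enum_val l) h1 h2 => [i s] [j t] /= -> /val_inj ->.
Qed.

Lemma ix_surj b S j g : g \in S -> exists k : 'I_(ixcard b S), ix k = (j, g).
Proof.
by move=> gS; exists (enum_rank (j, [` gS]%fset)); rewrite /ix enum_rankK.
Qed.

Lemma ix_sum b S (V : nmodType) (F : 'I_b * G -> V) :
  \sum_(k < ixcard b S) F (ix k) = \sum_j \sum_(g <- S) F (j, g).
Proof.
transitivity (\sum_(p : 'I_b * S) F (p.1, val p.2)).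
  by rewrite [RHS](reindex _ (onW_bij _ (@enum_val_bij _))).
rewrite -(pair_bigA _ (fun j (s : S) => F (j, val s))) /=.
by apply: eq_bigr => j _; rewrite big_seq_fsetE.
Qed.
End FiniteIndices.

Section GroupRingMatrices.
Variables (A : pzRingType) (G : groupType).
Local Notation AG := (grpring A G).
Implicit Type S : {fset G}.

Lemma mcoeff_gr a (g h : G) : (gr a g : AG)@_h = a *+ (g == h).
Proof. exact: mcoeffU. Qed.

Lemma mcoeff_sum (I : Type) (s : seq I) (P : pred I) (F : I -> AG) h :
  (\sum_(i <- s | P i) F i)@_h = \sum_(i <- s | P i) (F i)@_h.
Proof. exact: raddf_sum. Qed.

Lemma mcoeff_mul_gr (x : AG) r g h : (x * gr r g)@_h = x@_(h * g^-1)%g * r.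
Proof.
move: x; apply: malg_additive_ext.
- by move=> x y; rewrite mulrBl mcoeffB.
- by move=> x y; rewrite mcoeffB mulrBl.
move=> a l; rewrite -[<< a *g l >>]/(gr a l) gr_mulE !mcoeff_gr.
rewrite -(can2_eq (mulgK g) (mulgVK g)).
by case: eqP => _; rewrite ?mulr1n // !mulr0n mul0r.
Qed.

Lemma gr_inj (x y : AG) : (forall g, x@_g = y@_g) -> x = y.
Proof. by move=> xy; apply/malgP. Qed.

(* The matrix of U between functions supported in S and functions restricted to S'. *)
Definition fmat a b S' S (U : 'M[AG]_(a, b)) : 'M[A]_(ixcard a S', ixcard b S) :=
  \matrix_(x, y) (U (ix x).1 (ix y).1)@_((ix x).2 * (ix y).2^-1)%g.

Definition fvec b S (v : 'cV[A]_(ixcard b S)) : 'cV[AG]_b :=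
  \col_j \sum_(y | (ix y).1 == j) gr (v y 0) (ix y).2.

Definition supported a b (T : {fset G}) (U : 'M[AG]_(a, b)) :=
  forall i j g, (U i j)@_g != 0 -> g \in T.

Lemma supportedS a b (T T' : {fset G}) (U : 'M[AG]_(a, b)) :
  (T `<=` T')%fset -> supported T U -> supported T' U.
Proof. by move=> /fsubsetP TT' sU i j g /sU /TT'. Qed.

Lemma supported_exists a b (U : 'M[AG]_(a, b)) : exists T, supported T U.
Proof.
exists (\bigcup_(p <- enum {: 'I_a * 'I_b}) msupp (U p.1 p.2))%fset => i j g Ug.
apply/(@bigfcupP _ _ _ _ _ _); exists (i, j); first by rewrite mem_enum.
by rewrite -mcoeff_neq0.
Qed.

Lemma fvec_coef b S (v : 'cV[A]_(ixcard b S)) j g :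
  (fvec v j 0)@_g = \sum_(y | ix y == (j, g)) v y 0.
Proof.
rewrite mxE mcoeff_sum big_mkcond [RHS]big_mkcond; apply: eq_bigr => y _.
rewrite mcoeff_gr; case: (ix y) => i h; rewrite xpair_eqE /=.
by case: eqP => //= _; case: eqP => _; rewrite ?mulr1n ?mulr0n.
Qed.

Lemma fvec_coef_in b S (v : 'cV[A]_(ixcard b S)) y :
  (fvec v (ix y).1 0)@_(ix y).2 = v y 0.
Proof.
rewrite fvec_coef -surjective_pairing (big_pred1 y) // => z.
by rewrite (inj_eq (@ix_inj _ _ _)).
Qed.

Lemma fvec_coef_out b S (v : 'cV[A]_(ixcard b S)) j g : g \notin S ->
  (fvec v j 0)@_g = 0.
Proof.
move=> gS; rewrite fvec_coef big_pred0 // => y; apply: contraNF gS => /eqP yE.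
by have := ix_mem y; rewrite yE.
Qed.

Lemma fvec_eq0 b S (v : 'cV[A]_(ixcard b S)) : fvec v = 0 -> v = 0.
Proof.
move=> v0; apply/colP => y; rewrite -fvec_coef_in v0 !mxE; exact: mcoeff0.
Qed.

Lemma mulmx_fvec_coef a b S (U : 'M[AG]_(a, b)) (v : 'cV[A]_(ixcard b S)) i h :
  ((U *m fvec v) i 0)@_h =
  \sum_y (U i (ix y).1)@_(h * (ix y).2^-1)%g * v y 0.
Proof.
rewrite mxE mcoeff_sum; under eq_bigr => j _.
  rewrite mxE mulr_sumr mcoeff_sum big_mkcond; over.
rewrite exchange_big; apply: eq_bigr => y _ /=.
rewrite (bigD1 (ix y).1) //= eqxx mcoeff_mul_gr big1 ?addr0 // => j.
by rewrite eq_sym => /negbTE ->.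
Qed.

Lemma fmat_mulmx_coef a b S' S (U : 'M[AG]_(a, b)) (v : 'cV[A]_(ixcard b S)) x :
  (fmat S' S U *m v) x 0 = ((U *m fvec v) (ix x).1 0)@_(ix x).2.
Proof. by rewrite mulmx_fvec_coef mxE; apply: eq_bigr => y _; rewrite mxE. Qed.

Lemma mulmx_fvec_coef_out a b S' S T (U : 'M[AG]_(a, b)) (v : 'cV[A]_(ixcard b S)) i h :
  supported T U -> (fset_mul T S `<=` S')%fset -> h \notin S' ->
  ((U *m fvec v) i 0)@_h = 0.
Proof.
move=> sU TS hS'; rewrite mulmx_fvec_coef big1 // => y _.
suff /eqP -> : (U i (ix y).1)@_(h * (ix y).2^-1)%g == 0 by rewrite mul0r.
apply: contraNT hS' => /sU hT; apply: (fsubsetP TS).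
by rewrite -[h](mulgVK (ix y).2) mem_fset_mul ?ix_mem.
Qed.

(** The product is supported in T S, so that restriction to [S'] loses nothing. *)
Lemma mulmx_fvec a b S' S T (U : 'M[AG]_(a, b)) (v : 'cV[A]_(ixcard b S)) :
  supported T U -> (fset_mul T S `<=` S')%fset ->
  U *m fvec v = fvec (fmat S' S U *m v).
Proof.
move=> sU TS; apply/colP => i; apply: gr_inj => h.
have [hS'|hS'] := boolP (h \in S'); last first.
  by rewrite (mulmx_fvec_coef_out _ _ sU TS hS') fvec_coef_out.
have [x xE] := ix_surj i hS'.
by have := fvec_coef_in (fmat S' S U *m v) x; rewrite xE fmat_mulmx_coef xE /= => ->.
Qed.
End GroupRingMatrices.

Lemma gr_mapE (A : pzRingType) (G H : groupType) (phi : {multiplicative G -> H}) n (g : G) :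
  gr_map A phi (gr n g) = gr n%:~R (phi g).
Proof.
pose f : {additive A -> grpring A H} :=
  HB.pack (fun r : A => gr r (phi g) : grpring A H)
    (GRing.isZmodMorphism.Build _ _ _ (@gr_is_zmod_morphism A H (phi g))).
rewrite -[gr_map _ _ _]/(gr_lift (gr_map_spec A phi) (gr n g)) gr_liftE mulrzl.
by rewrite -[gr 1 _]/(f 1) -raddfMz.
Qed.

Section BaseRing.
Variables (R : comNzRingType) (G : groupType).

Definition gr_of_int : {rmorphism grpring int G -> grpring R G} := gr_map R idfun.

Lemma gr_of_int_coef (x : grpring int G) g : (gr_of_int x)@_g = (x@_g)%:~R.
Proof.
move: x; apply: malg_additive_ext.
- by move=> x y; rewrite raddfB mcoeffB.
- by move=> x y; rewrite mcoeffB rmorphB.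
move=> n h; rewrite -[<< n *g h >>]/(gr n h) gr_mapE !mcoeff_gr.
by case: eqP => _; rewrite ?mulr1n // !mulr0n.
Qed.

Lemma supported_gr_of_int a b T (U : 'M[grpring int G]_(a, b)) :
  supported T U -> supported T (map_mx gr_of_int U).
Proof.
move=> sU i j g; rewrite mxE gr_of_int_coef => h; apply: (sU i j).
by apply: contraNneq h => ->.
Qed.

Lemma fmat_gr_of_int a b S' S (U : 'M[grpring int G]_(a, b)) :
  fmat S' S (map_mx gr_of_int U) = map_mx intr (fmat S' S U) :> 'M[R]_(_, _).
Proof. by apply/matrixP => x y; rewrite !mxE gr_of_int_coef. Qed.

Variable F : numFieldType.

(** The finite parts are E = L Q and D = L' Q'. A vector supported in [S] and killed by both Q X and
    Q' is killed by E X and by Y D, hence is 0; so the stacked matrix with r + s rows is injective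
    over [R]. [S1] contains what [X] and [D] make of [S], and [S2] what [E] makes of [S1]. *)
Lemma injective_rank_bound k' k m (E : 'M[grpring int G]_(k, m))
    (D : 'M[grpring int G]_(k', k)) (X : 'M[grpring R G]_(m, k))
    (Y : 'M[grpring R G]_(k, k')) (T S S1 S2 : {fset G}) :
  (forall v : 'cV_k, (map_mx gr_of_int E *m X + Y *m map_mx gr_of_int D) *m v = 0 -> v = 0) ->
  supported T E -> supported T D -> supported T X ->
  (fset_mul T S `<=` S1)%fset -> (fset_mul T S1 `<=` S2)%fset ->
  (k * #|` S| <= \rank (map_mx intr (fmat S2 S1 E) : 'M[F]_(_, _)) +
     \rank (map_mx intr (fmat S1 S D) : 'M[F]_(_, _)))%N.
Proof.
move=> Finj sE sD sX TS TS1.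
have [r [L [Q [EE rE]]]] := int_matrix_rank_factor F (fmat S2 S1 E).
have [s [L' [Q' [DE sDr]]]] := int_matrix_rank_factor F (fmat S1 S D).
apply: leq_trans (leq_add rE sDr); rewrite -ixcardE.
pose M : 'M[R]_(r + s, ixcard k S) :=
  col_mx (map_mx intr Q *m fmat S1 S X) (map_mx intr Q').
apply: (@strong_rank_condition R _ _ M) => v.
rewrite mul_col_mx => /eqP; rewrite col_mx_eq0 => /andP [/eqP Qv /eqP Q'v].
apply/fvec_eq0/Finj; rewrite mulmxDl -!mulmxA.
rewrite (mulmx_fvec _ sX TS) (mulmx_fvec _ (supported_gr_of_int sE) TS1).
rewrite (mulmx_fvec _ (supported_gr_of_int sD) TS) !fmat_gr_of_int EE DE !map_mxM /=.
rewrite -!mulmxA Q'v (mulmxA (map_mx intr Q)) Qv !mulmx0.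
have fvec0 b (S' : {fset G}) : fvec (0 : 'cV[R]_(ixcard b S')) = 0.
  by apply/colP => j; rewrite !mxE big1 // => y _; rewrite mxE /gr raddf0.
by rewrite !fvec0 mulmx0 addr0.
Qed.
End BaseRing.

(** * Complex ranks of finite parts against von Neumann traces *)

Section RankTrace.
Variables (K : realType) (G : groupType).
Local Notation C := (K[i]).
Local Notation L2 := (ell2 K G).
Local Notation NG := (vna K G).
Local Notation ZG := (grpring int G).

Lemma vna_intE (n : int) (x : L2) : (n%:~R : NG) x = (n%:~R : C) *: x.
Proof.
have nat m : (m%:R : NG) x = (m%:R : C) *: x.
  elim: m => [|m IHm]; first by rewrite scale0r.
  by rewrite mulrS [in RHS]mulrS scalerDl scale1r -IHm.
case: n => m; first exact: nat.
by rewrite NegzE !mulrNz scaleNr -nat.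
Qed.

Lemma vna_of_grE (u : ZG) (x : L2) h (S : {fset G}) :
  (forall g, g \notin S -> u@_(h * g^-1)%g = 0) ->
  (vna_of_gr K G u : NG) x h = \sum_(g <- S) (u@_(h * g^-1)%g)%:~R * x g.
Proof.
move=> uS.
pose f g := (h * g^-1)%g; pose S' := [fset f g | g in S]%fset.
have finj : injective f by move=> s t /mulgI /invg_inj.
have uS' : (msupp u `<=` S')%fset.
  apply/fsubsetP => t; rewrite -mcoeff_neq0 => ut; apply/imfsetP.
  have tE : t = f (t^-1 * h)%g by rewrite /f invgM invgK mulVKg.
  exists (t^-1 * h)%g => //=; apply: contraNT ut => /uS /eqP.
  by rewrite -/(f _) -tE.
have -> : vna_of_gr K G u = \sum_(t <- S') (u@_t)%:~R * lreg K t.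
  exact: (malg_liftEw (@gr_lift_coef_additive int NG G _ _) uS').
rewrite big_imfset; last by move=> s t _ _ /finj.
rewrite vna_sumE -inner_delta inner_suml; apply: eq_bigr => g _.
by rewrite inner_delta vnaME vna_intE ell2Z ltransE /f invgM invgK mulgVK.
Qed.

Lemma rank_fmat_le a b (U : 'M[ZG]_(a, b)) (S' S S2 : {fset G}) : (S `<=` S2)%fset ->
  (\rank (map_mx intr (fmat S' S U) : 'M[C]_(_, _)) <=
   \rank (map_mx intr (fmat S' S2 U) : 'M[C]_(_, _)))%N.
Proof.
move=> /fsubsetP SS2.
have -> : map_mx intr (fmat S' S U) = map_mx intr (fmat S' S2 U) *m
    (\matrix_(y, z) (ix y == ix z)%:R) :> 'M[C]_(ixcard a S', ixcard b S).
  apply/matrixP => x z; rewrite !mxE.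
  have [y yE] := ix_surj (ix z).1 (SS2 _ (ix_mem z)).
  have {}yE : ix y = ix z by rewrite yE -surjective_pairing.
  rewrite (bigD1 y) //= big1 ?addr0 => [|y' y'y].
    by rewrite !mxE yE eqxx mulr1.
  by rewrite !mxE -yE (inj_eq (@ix_inj _ _ _)) (negbTE y'y) mulr0.
exact: mxrankM_maxl.
Qed.

(* The rows of the finite part of U are annihilated by the compression of J to S2,
   so its rank is at most the trace of the compression of 1 - J. *)
Lemma rank_trace_bound a b (U : 'M[ZG]_(a, b)) (J : 'M[NG]_b) (T S' S2 : {fset G}) :
  dag J = J -> J *m J = J -> map_mx (vna_of_gr K G) U *m J = 0 ->
  supported T U -> (forall t, t \in T -> t^-1%g \in T) ->
  (fset_mul T S' `<=` S2)%fset ->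
  (\rank (map_mx intr (fmat S' S2 U) : 'M[C]_(_, _)))%:R <=
    (#|` S2|)%:R * (b%:R - mtr J).
Proof.
move=> Jd JJ UJ sU TV TS; set n := ixcard b S2.
pose d (y : 'I_n) : 'I_b -> L2 := single (ix y).1 (delta K (ix y).2).
pose Q : 'M[C]_n := \matrix_(x, y) mact J (d y) (ix x).1 (ix x).2.
set W := map_mx intr (fmat S' S2 U) : 'M[C]_(_, _).
(* A row of [U] at h in [S'] involves only elements of T^-1 h, and these lie in [S2] as [T] is
   symmetric. So the truncated row sees all of U J, which is 0. *)
have WQ : W *m Q = 0.
  apply/matrixP => x y; rewrite !mxE.
  have := congr1 (fun M : 'M[NG]_(a, b) => mact M (d y) (ix x).1 (ix x).2) UJ.
  rewrite mact_mul mact0 => UJ0; rewrite -[RHS]UJ0 /mact -inner_delta inner_suml.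
  transitivity (\sum_(j < b) \sum_(g <- S2) ((U (ix x).1 j)@_((ix x).2 * g^-1)%g)%:~R *
     mact J (d y) j g).
    rewrite -(ix_sum S2 (fun p : 'I_b * G => ((U (ix x).1 p.1)@_((ix x).2 * p.2^-1)%g)%:~R *
      mact J (d y) p.1 p.2)).
    by apply: eq_bigr => z _; rewrite !mxE.
  apply: eq_bigr => j _; rewrite inner_delta mxE (@vna_of_grE _ _ _ S2) //.
  move=> g gS2; apply/eqP; apply: contraNT gS2 => /sU /TV gT.
  apply: (fsubsetP TS); rewrite -[g](mulgVK (ix x).2) mem_fset_mul ?ix_mem //.
  by move: gT; rewrite invgM invgK.
(* By equivariance a diagonal coefficient is the same at every group element, so the compression has
   trace |S2| tr J. *)
have trQ : \tr (1%:M - Q) = (#|` S2|)%:R * (b%:R - mtr J).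
  rewrite (_ : \tr (1%:M - Q) = n%:R - \tr Q); last by rewrite linearB /= mxtrace1.
  have -> : \tr Q = (#|` S2|)%:R * mtr J.
    rewrite /mxtrace; transitivity (\sum_(x < n) vna_tr (J (ix x).1 (ix x).1)).
      by apply: eq_bigr => x _; rewrite mxE /d mact_single vna_tr_delta.
    rewrite (ix_sum S2 (fun p => vna_tr (J p.1 p.1))) /mtr mulr_sumr.
    apply: eq_bigr => j _ /=.
    by rewrite big_const_seq count_predT iter_addr_0 mulr_natl.
  by rewrite /n ixcardE natrM [b%:R * _]mulrC -mulrBr.
rewrite -trQ; apply: rank_le_psd_trace => [|w].
  by rewrite mulmxBr WQ mulmx1 subr0.
(* The conjugates compensate for [inner] being conjugate-linear in its second argument; the
   quadratic form of 1 - Q at [w] becomes that of the projection 1 - J at [om]. *)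
pose om : 'I_b -> L2 := fun j => \sum_(x | (ix x).1 == j) (w 0 x)^*%C *: delta K (ix x).2.
have omE j : om j = \sum_x (w 0 x)^*%C *: d x j.
  rewrite /om big_mkcond; apply: eq_bigr => x _; rewrite /d /single eq_sym.
  by case: eqP => // _; rewrite scaler0.
have vin_om (y : 'I_b -> L2) : vin y om = \sum_x w 0 x * y (ix x).1 (ix x).2.
  rewrite /vin; under eq_bigr do rewrite omE inner_sumr.
  rewrite exchange_big; apply: eq_bigr => x _.
  rewrite (bigD1 (ix x).1) //= /d /single eqxx innerZr inner_delta conjcK.
  by rewrite big1 ?addr0 // => j /negbTE ->; rewrite scaler0 inner0r.
have mact_om (M : 'M[NG]_b) i h : mact M om i h = \sum_x (w 0 x)^*%C * mact M (d x) i h.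
  rewrite /mact -inner_delta; under eq_bigr do rewrite omE vna_fun_sum.
  rewrite exchange_big inner_suml; apply: eq_bigr => x _.
  under eq_bigr do rewrite vna_funZ.
  by rewrite -scaler_sumr innerZl inner_delta.
have -> : (w *m (1%:M - Q) *m adj_mx w) 0 0 = vin (mact (1%:M - J) om) om.
  rewrite vin_om mxE.
  transitivity (\sum_x \sum_y w 0 x * ((1%:M - Q) x y * (w 0 y)^*%C)).
    under eq_bigr do rewrite mxE mulr_suml.
    rewrite exchange_big; apply: eq_bigr => x _; apply: eq_bigr => y _.
    by rewrite !mxE mulrA.
  apply: eq_bigr => x _; rewrite -mulr_sumr; congr (_ * _).
  rewrite mact_om; apply: eq_bigr => y _; rewrite mulrC; congr (_ * _).
  rewrite mactB mact1 !mxE /d /single.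
  rewrite -[RHS]/((if _ then _ else 0 : L2) _ - _); congr (_ - _).
  rewrite -[x == y](inj_eq (@ix_inj _ _ _)).
  by case: (ix x) (ix y) => [i g] [j h]; rewrite xpair_eqE; case: eqP.
have PP : (1%:M - J) *m (1%:M - J) = 1%:M - J.
  by rewrite mulmxBl mul1mx mulmxBr mulmx1 JJ subrr subr0.
have Pd : dag (1%:M - J) = 1%:M - J by rewrite dagB dag1 Jd.
rewrite -PP mact_mul vin_dag Pd vin_vnrm -[0]/((0 : K)%:C%C) lecR.
exact: vnrm_ge0.
Qed.
End RankTrace.

Section KernelTraces.
Variables (K : realType) (G : groupType) (R : comNzRingType).
Local Notation C := (K[i]).
Local Notation NG := (vna K G).
Local Notation ZG := (grpring int G).

Lemma le_of_approx (a b : K) : (forall q : nat, q%:R * a <= q.+1%:R * b) -> a <= b.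
Proof.
move=> h; rewrite leNgt; apply/negP => ba.
have b0 : 0 <= b by have := h 0%N; rewrite mul0r mul1r.
have [q qP] : exists q : nat, b / (a - b) < q%:R.
  by exists (Num.bound (b / (a - b))); rewrite archi_boundP // divr_ge0 // subr_ge0 ltW.
move: qP; rewrite ltr_pdivrMr ?subr_gt0 //; have := h q.
rewrite -natr1; lra.
Qed.

Lemma symmetric_fset_exists (T : {fset G}) : exists T' : {fset G},
  [/\ (T `<=` T')%fset, 1%g \in T' & forall t, t \in T' -> t^-1%g \in T'].
Proof.
exists (1%g |` (T `|` [fset t^-1%g | t in T]))%fset; split.
- by apply/fsubsetP => t tT; rewrite !inE tT /= orbT.
- by rewrite !inE eqxx.
move=> t; rewrite !inE => /orP [/eqP ->|/orP [tT|/imfsetP [s /= sT ->]]].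
- by rewrite invg1 eqxx.
- by apply/orP; right; apply/orP; right; apply/imfsetP; exists t.
- by rewrite invgK sT orbT.
Qed.

Lemma fsubset_mul (T S : {fset G}) : 1%g \in T -> (S `<=` fset_mul T S)%fset.
Proof.
by move=> T1; apply/fsubsetP => s sS; rewrite -[s]mul1g mem_fset_mul.
Qed.

(** The finite rank bounds combine to k |S| <= |T3 S| (m - tr JE + k - tr JD) for every finite [S].
    Folner sets for [T3] make |T3 S| / |S| arbitrarily close to 1. *)
Lemma kernel_trace_bound k' k m (E : 'M[ZG]_(k, m)) (D : 'M[ZG]_(k', k))
    (X : 'M[grpring R G]_(m, k)) (Y : 'M[grpring R G]_(k, k'))
    (JE : 'M[NG]_m) (JD : 'M[NG]_k) :
  amenable K G ->
  (forall v : 'cV_k,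
    (map_mx (gr_of_int R G) E *m X + Y *m map_mx (gr_of_int R G) D) *m v = 0 -> v = 0) ->
  dag JE = JE -> JE *m JE = JE -> map_mx (vna_of_gr K G) E *m JE = 0 ->
  dag JD = JD -> JD *m JD = JD -> map_mx (vna_of_gr K G) D *m JD = 0 ->
  mtr JE + mtr JD <= m%:R.
Proof.
move=> amen Finj JEd JEJE EJE JDd JDJD DJD.
have [TE sE] := supported_exists E; have [TD sD] := supported_exists D.
have [TX sX] := supported_exists X.
have [T [TT T1 TV]] := symmetric_fset_exists (TE `|` TD `|` TX)%fset.
have {}sE : supported T E.
  apply: supportedS sE; apply: fsubset_trans TT.
  by rewrite -fsetUA fsubsetUl.
have {}sD : supported T D.
  by apply: supportedS sD; apply: fsubset_trans TT; rewrite fsetUAC fsubsetUr.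
have {}sX : supported T X by apply: supportedS sX; apply: fsubset_trans TT; rewrite fsubsetUr.
pose dl : C := m%:R - mtr JE + (k%:R - mtr JD).
(* Three factors: one for [X] and [D], one for [E], and one for the enlarged column set in
   [rank_trace_bound]. *)
pose T3 := fset_mul T (fset_mul T T).
have key S : (k * #|` S|)%:R <= (#|` fset_mul T3 S|)%:R * dl.
  pose S1 := fset_mul T S; pose S2 := fset_mul T S1; pose S3 := fset_mul T S2.
  have S3E : fset_mul T3 S = S3 by rewrite /T3 -!fset_mulA.
  have S01 : (S `<=` S1)%fset by exact: fsubset_mul.
  have S12 : (S1 `<=` S2)%fset by exact: fsubset_mul.
  have S23 : (S2 `<=` S3)%fset by exact: fsubset_mul.
  have := injective_rank_bound C Finj sE sD sX (fsubset_refl S1) (fsubset_refl S2).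
  rewrite -(ler_nat C) natrD => /le_trans; apply; rewrite S3E mulrDr.
  apply: lerD.
    apply: le_trans (rank_trace_bound JEd JEJE EJE sE TV (fsubset_refl S3)).
    by rewrite ler_nat; apply: rank_fmat_le; apply: fsubset_trans S12 S23.
  apply: le_trans (rank_trace_bound JDd JDJD DJD sD TV S23).
  rewrite ler_nat; apply: rank_fmat_le; apply: fsubset_trans S01 _.
  exact: fsubset_trans S12 S23.
have dl_ge0 : 0 <= dl.
  have := key [fset 1%g]%fset.
  have T31 : 1%g \in T3.
    by apply: (fsubsetP (fsubset_trans (fsubset_mul T T1) (fsubset_mul _ T1))).
  have c0 : (0 < #|` fset_mul T3 [fset 1%g]%fset|)%N.
    rewrite cardfs_gt0; apply/fset0Pn; exists 1%g.
    by apply/fset_mulP; exists 1%g, 1%g; rewrite mulg1 inE.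
  by move=> /(le_trans (ler0n _ _)); rewrite pmulr_rge0 // ltr0n.
(* A nonnegative complex number is real; this moves the inequality to [K], where the archimedean
   argument takes place. *)
have [d dE] : exists d : K, dl = d%:C%C.
  exists (complex.Re dl); move: dl_ge0; rewrite lecE => /andP [/eqP].
  by case: (dl) => x y /= -> _.
have : k%:R <= d.
  apply: le_of_approx => q; have [S S0 lt] := folner amen T3 q.
  have := key S; rewrite dE.
  have nC n : (n%:R : C) = (n%:R : K)%:C%C by rewrite rmorph_nat.
  rewrite !nC -rmorphM /= lecR natrM => le1.
  have s0 : 0 < (#|` S|)%:R :> K by rewrite ltr0n cardfs_gt0.
  have d0 : 0 <= d by move: dl_ge0; rewrite dE -[0]/((0 : K)%:C%C) lecR.
  rewrite -(ler_pM2r s0) -mulrA.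
  have /(ler_wpM2l (ler0n K q)) le2 := le1; apply: (le_trans le2).
  rewrite mulrA [X in _ <= X]mulrAC ler_wpM2r // -!natrM ler_nat; exact: ltnW.
rewrite -lecR -dE rmorph_nat -subr_ge0 => h.
rewrite -subr_ge0; move: h; congr (0 <= _); rewrite /dl; ring.
Qed.
End KernelTraces.

(** * Strebel's condition *)

Section GroupRingFunctor.
Variables (A : pzRingType) (G H : groupType) (psi : {multiplicative G -> H}).

Definition gr_const (a : A) : grpring A H := gr a 1%g.
Lemma gr_const_is_zmod_morphism : zmod_morphism gr_const.
Proof. exact: gr_is_zmod_morphism. Qed.
Lemma gr_const_is_monoid_morphism : monoid_morphism gr_const.
Proof. by split=> // a b; rewrite /gr_const gr_mulE mulg1. Qed.
HB.instance Definition _ := GRing.isZmodMorphism.Build A (grpring A H) gr_const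
  gr_const_is_zmod_morphism.
HB.instance Definition _ := GRing.isMonoidMorphism.Build A (grpring A H) gr_const
  gr_const_is_monoid_morphism.

Lemma gr_functor_spec : gr_lift_spec (gr_const : {rmorphism A -> grpring A H})
  (fun g => gr 1 (psi g)).
Proof.
split; first by rewrite gmul_one.
  by move=> g h; rewrite gr_mulE mulr1 gmulfM.
by move=> a g; rewrite /GRing.comm /gr_const !gr_mulE mulr1 mul1r mulg1 mul1g.
Qed.

Definition gr_functor : {rmorphism grpring A G -> grpring A H} := 
  locked (gr_lift gr_functor_spec : {rmorphism grpring A G -> grpring A H}).

Lemma gr_functorE a g : gr_functor (gr a g) = gr a (psi g).
Proof.
have -> : gr_functor (gr a g) = gr_lift gr_functor_spec (gr a g) by rewrite /gr_functor -lock.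
by rewrite gr_liftE gr_mulE mulr1 mul1g.
Qed.
End GroupRingFunctor.

Section Kernel.
Variables (R : comNzRingType) (G Gamma : groupType) (phi : {multiplicative G -> Gamma}).
Local Notation N := (gker phi).
Local Notation RN := (grpring R N).
Local Notation RG := (grpring R G).
Local Notation RGa := (grpring R Gamma).

Lemma augmentationE a (n : N) : augmentation R N (gr a n) = a.
Proof.
by rewrite -[augmentation _ _ _]/(gr_lift (@augmentation_spec R N) (gr a n)) gr_liftE mulr1.
Qed.

Lemma gr_map_gr_functor (x : grpring int G) : gr_map R phi x = gr_functor R phi (gr_of_int R G x).
Proof.
move: x; apply: malg_additive_ext.
- by move=> x y; rewrite raddfB.
- by move=> x y; rewrite !raddfB.
by move=> n g; rewrite -[<< _ *g _ >>]/(gr n g) !gr_mapE gr_functorE.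
Qed.

Definition ker_incl : {rmorphism RN -> RG} := gr_functor R (val : {multiplicative N -> G}).

Lemma ker_inclE a (n : N) : ker_incl (gr a n) = gr a (val n).
Proof. exact: gr_functorE. Qed.

Lemma gr_functor_ker_incl (x : RN) : gr_functor R phi (ker_incl x) = gr (augmentation R N x) 1%g.
Proof.
move: x; apply: malg_additive_ext.
- by move=> x y; rewrite !raddfB.
- by move=> x y; rewrite !raddfB /= gr_is_zmod_morphism.
move=> a n; rewrite -[<< _ *g _ >>]/(gr a n) ker_inclE gr_functorE augmentationE; congr gr.
exact/eqP/(valP n).
Qed.

Lemma coset_rep_exists : exists coset_rep : Gamma -> G, forall g, phi (coset_rep (phi g)) = phi g.
Proof.
have /choice [coset_rep repP] : forall c : Gamma, exists g, (exists h, phi h = c) -> phi g = c.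
  move=> c; have [[h hc]|no] := pselect (exists h, phi h = c); first by exists h.
  by exists 1%g => /no.
by exists coset_rep => g; apply: repP; exists g.
Qed.

(* Arbitrary outside the image of phi. *)
Definition coset_rep : Gamma -> G := sval (cid coset_rep_exists).
Lemma coset_repE g : phi (coset_rep (phi g)) = phi g.
Proof. exact: (svalP (cid coset_rep_exists)). Qed.

Lemma ker_part_subproof g : ((coset_rep (phi g))^-1 * g)%g \in gker_pred phi.
Proof.
rewrite unfold_in; apply/eqP/(@mulgI _ (phi (coset_rep (phi g)))).
by rewrite -gmulfM mulVKg mulg1 coset_repE.
Qed.
Definition ker_part g : N := Sub ((coset_rep (phi g))^-1 * g)%g (ker_part_subproof g).

Lemma coset_rep_ker_part g : (coset_rep (phi g) * val (ker_part g))%g = g.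
Proof. by rewrite /= mulVKg. Qed.

Lemma phi_mul_ker g (n : N) : phi (g * val n)%g = phi g.
Proof. by rewrite gmulfM (eqP (valP n)) mulg1. Qed.

Lemma ker_partM g (n : N) : ker_part (g * val n)%g = (ker_part g * n)%g.
Proof. by apply: val_inj; rewrite /= phi_mul_ker mulgA. Qed.

Variable k : nat.

(** A separate name under which R[G]^k carries the right action of R[N], N being the kernel of
    [phi]. *)
Definition rgcol := 'cV[RG]_k.
HB.instance Definition _ := GRing.Zmodule.copy rgcol 'cV[RG]_k.
Definition rgcol_scale (a : RN^c) (v : rgcol) : rgcol := \col_i (v i 0 * ker_incl a).
Lemma rgcol_scalerA a b v : rgcol_scale a (rgcol_scale b v) = rgcol_scale (a * b) v.
Proof.
apply/colP => i; rewrite !mxE -mulrA; congr (_ * _).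
exact: (esym (rmorphM ker_incl (b : RN) (a : RN))).
Qed.
Lemma rgcol_scale1r : left_id 1 rgcol_scale.
Proof. by move=> v; apply/colP => i; rewrite !mxE [ker_incl _]rmorph1 mulr1. Qed.
Lemma rgcol_scalerDr : right_distributive rgcol_scale +%R.
Proof. by move=> a u v; apply/colP => i; rewrite !mxE mulrDl. Qed.
Lemma rgcol_scalerDl v : {morph rgcol_scale^~ v : a b / a + b}.
Proof. by move=> a b; apply/colP => i; rewrite !mxE [ker_incl _]rmorphD mulrDr. Qed.
HB.instance Definition _ := GRing.Zmodule_isLmodule.Build RN^c rgcol
  rgcol_scalerA rgcol_scale1r rgcol_scalerDr rgcol_scalerDl.

Lemma rgcol_scaleE (a : RN) (v : rgcol) i : ((a : RN^c) *: v) i 0 = v i 0 * ker_incl a.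
Proof. by rewrite mxE. Qed.

Definition rgsingle (j : 'I_k) (x : RG) : rgcol := \col_i (if i == j then x else 0).

Lemma rgsingle_is_zmod_morphism j : zmod_morphism (rgsingle j).
Proof.
by move=> x y; apply/colP => i; rewrite !mxE; case: eqP => // _; rewrite subr0.
Qed.

Lemma rgsingle_sum (v : rgcol) : v = \sum_j rgsingle j (v j 0).
Proof.
apply/colP => i; rewrite summxE (bigD1 i) //= mxE eqxx big1 ?addr0 // => j.
by rewrite mxE eq_sym => /negbTE ->.
Qed.

Lemma rgsingle_scale j (x : RG) (a : RN) : (a : RN^c) *: rgsingle j x = rgsingle j (x * ker_incl a).
Proof.
by apply/colP => i; rewrite !mxE; case: eqP => // _; rewrite mul0r.
Qed.

(* RG is free over RN on the coset representatives, and
   g = coset_coset_rep (phi g) * ker_part g. *)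
Lemma rgsingle_gr j a g :
  rgsingle j (gr a g) = (gr a (ker_part g) : RN^c) *: rgsingle j (gr 1 (coset_rep (phi g))).
Proof. by rewrite rgsingle_scale ker_inclE gr_mulE mul1r coset_rep_ker_part. Qed.

Lemma conv_scalerA (M : lmodType RN^c) (a b : RN) (x : M) :
  (a : RN^c) *: ((b : RN^c) *: x) = ((b * a : RN) : RN^c) *: x.
Proof. exact: scalerA. Qed.

(** Freeness on the coset representatives, in each of the k coordinates: images of the basis
    elements are lifted through [p] and extended R[N]-linearly. The basis may be infinite. *)
Lemma rgcol_projective : projective (rgcol : lmodType RN^c).
Proof.
move=> M Q p h psurj.
have /choice [x xP] : forall jc : 'I_k * Gamma, exists x : M,
    p x = h (rgsingle jc.1 (gr 1 (coset_rep jc.2))).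
  by move=> jc; exact: psurj.
pose L j (u : RG) : M := malg_lift (fun g a => (gr a (ker_part g) : RN^c) *: x (j, phi g)) u.
have Fadd j g : zmod_morphism (fun a => (gr a (ker_part g) : RN^c) *: x (j, phi g)).
  by move=> a b; rewrite gr_is_zmod_morphism scalerBl.
have LB j : zmod_morphism (L j) by exact: malg_lift_is_zmod_morphism.
have LU j a g : L j (gr a g) = (gr a (ker_part g) : RN^c) *: x (j, phi g).
  exact: malg_liftU.
have Llin j (a : RN) (u : RG) : L j (u * ker_incl a) = (a : RN^c) *: L j u.
  move: u; apply: malg_additive_ext.
  - by move=> u v; rewrite mulrBl LB.
  - by move=> u v; rewrite LB scalerBr.
  move=> b g; rewrite -[<< _ *g _ >>]/(gr b g); move: a; apply: malg_additive_ext.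
  - by move=> a c; rewrite raddfB mulrBr LB.
  - by move=> a c; exact: scalerBl.
  move=> c n; rewrite -[<< c *g n >>]/(gr c n).
  rewrite ker_inclE gr_mulE !LU [RHS]conv_scalerA.
  by rewrite gr_mulE ker_partM phi_mul_ker.
pose kf (v : rgcol) : M := \sum_j L j (v j 0).
have kf_lin : linear kf.
  move=> a u v; rewrite /kf scaler_sumr -big_split; apply: eq_bigr => j _ /=.
  rewrite -Llin -(zmod_morphismD (LB j)); congr (L j _).
  by rewrite mxE rgcol_scaleE.
pose kl : {linear rgcol -> M} := HB.pack kf (GRing.isLinear.Build RN^c rgcol M *:%R kf kf_lin).
exists kl => v; rewrite [in RHS](rgsingle_sum v) linear_sum.
rewrite -[LHS]/(p (\sum_j L j (v j 0))) linear_sum; apply: eq_bigr => j _.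
move: (v j 0); apply: malg_additive_ext.
- by move=> u w; rewrite LB linearB.
- by move=> u w; rewrite rgsingle_is_zmod_morphism linearB.
move=> a g; rewrite -[<< _ *g _ >>]/(gr a g) LU linearZ_LR xP /=.
by rewrite [in RHS]rgsingle_gr linearZ_LR.
Qed.

Definition in_image (c : Gamma) : bool := `[< exists g, phi g = c >].

(** An additive, in general not multiplicative, lift of R[phi(G)] to R[G], extended by 0 to the
    elements of [Gamma] outside the image. *)
Definition gr_section_coef (c : Gamma) (a : R) : RG := if in_image c then gr a (coset_rep c) else 0.
Lemma gr_section_coef_add c : zmod_morphism (gr_section_coef c).
Proof.
by move=> a b; rewrite /gr_section_coef; case: in_image; rewrite ?subr0 // gr_is_zmod_morphism.
Qed.
Definition gr_section (x : RGa) : RG := malg_lift gr_section_coef x.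
Lemma gr_section_is_zmod_morphism : zmod_morphism gr_section.
Proof. exact: malg_lift_is_zmod_morphism gr_section_coef_add. Qed.
Lemma gr_section_gr a c : gr_section (gr a c) = if in_image c then gr a (coset_rep c) else 0.
Proof. exact: malg_liftU gr_section_coef_add _ _. Qed.

Lemma in_image_phi g : in_image (phi g). Proof. by apply/asboolP; exists g. Qed.

Lemma gr_functor_gr_section_gr a c :
  gr_functor R phi (gr_section (gr a c)) = if in_image c then gr a c else 0.
Proof.
rewrite gr_section_gr; case: ifP => [/asboolP [g <-]|_]; last by rewrite raddf0.
by rewrite gr_functorE coset_repE.
Qed.

Lemma in_image_mull g c : in_image (phi g * c)%g = in_image c.
Proof.
apply/asboolP/asboolP => [[h hE]|[h <-]]; last by exists (g * h)%g; rewrite gmulfM.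
exists (g^-1 * h)%g; apply/(@mulgI _ (phi g)).
by rewrite -gmulfM mulVKg.
Qed.
Lemma in_image_mulr g c : in_image (c * phi g)%g = in_image c.
Proof.
apply/asboolP/asboolP => [[h hE]|[h <-]]; last by exists (h * g)%g; rewrite gmulfM.
exists (h * g^-1)%g; apply/(@mulIg _ (phi g)).
by rewrite -gmulfM mulgVK.
Qed.

(* gr_functor \o gr_section is the projection of R[Gamma] onto R[phi(G)], which is
   linear over Z[G] on both sides. *)
Lemma gr_functor_gr_section_mull (x : grpring int G) (y : RGa) :
  gr_functor R phi (gr_section (gr_map R phi x * y)) = gr_map R phi x * gr_functor R phi (gr_section y).
Proof.
move: y; apply: malg_additive_ext.
- by move=> y z; rewrite mulrBr gr_section_is_zmod_morphism raddfB.
- by move=> y z; rewrite gr_section_is_zmod_morphism raddfB mulrBr.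
move=> a c; rewrite -[<< _ *g _ >>]/(gr a c); move: x; apply: malg_additive_ext.
- by move=> y z; rewrite raddfB mulrBl gr_section_is_zmod_morphism raddfB.
- by move=> y z; rewrite raddfB mulrBl.
move=> n g; rewrite -[<< _ *g _ >>]/(gr n g) gr_mapE gr_mulE !gr_functor_gr_section_gr in_image_mull.
by case: in_image; rewrite ?mulr0 // gr_mulE.
Qed.

Lemma gr_functor_gr_section_mulr (x : grpring int G) (y : RGa) :
  gr_functor R phi (gr_section (y * gr_map R phi x)) = gr_functor R phi (gr_section y) * gr_map R phi x.
Proof.
move: y; apply: malg_additive_ext.
- by move=> y z; rewrite mulrBl gr_section_is_zmod_morphism raddfB.
- by move=> y z; rewrite gr_section_is_zmod_morphism raddfB mulrBl.
move=> a c; rewrite -[<< _ *g _ >>]/(gr a c); move: x; apply: malg_additive_ext.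
- by move=> y z; rewrite raddfB mulrBr gr_section_is_zmod_morphism raddfB.
- by move=> y z; rewrite raddfB mulrBr.
move=> n g; rewrite -[<< _ *g _ >>]/(gr n g) gr_mapE gr_mulE !gr_functor_gr_section_gr in_image_mulr.
by case: in_image; rewrite ?mul0r // gr_mulE.
Qed.

Local Notation aug := (augmentation R N).
Local Notation Tens := (basechange aug (rgcol : lmodType RN^c)).
Local Notation one := (1 : R).
Local Notation tns := (@tens RN rgcol (restr aug)).

Lemma tens_scale (v : rgcol) (a : RN) (r : R) :
  tns ((a : RN^c) *: v) r = tns v (aug a * r : restr aug).
Proof. by have [_ _ ->] := tens_balanced (rgcol : lmodType RN^c) (restr aug). Qed.

Lemma tns_is_zmod_morphism : zmod_morphism (fun v : rgcol => tns v one : Tens).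
Proof.
have [tD _ _] := tens_balanced (rgcol : lmodType RN^c) (restr aug).
by move=> u w; apply/eqP; rewrite eq_sym subr_eq -tD subrK.
Qed.

(* Every tensor is of the form v (x) 1, and v (x) 1 depends only on the image of v
   over R[Gamma]; hence tensor_to_group_ring identifies the base change with its image. *)
Lemma tens_gr_section (v : rgcol) :
  tns (\col_i gr_section (gr_functor R phi (v i 0))) one = tns v one.
Proof.
have -> : \col_i gr_section (gr_functor R phi (v i 0)) =
    \sum_j rgsingle j (gr_section (gr_functor R phi (v j 0))).
  by rewrite [LHS]rgsingle_sum; apply: eq_bigr => j _; rewrite mxE.
rewrite [in RHS](rgsingle_sum v).
pose t : {additive rgcol -> Tens} := HB.pack
  ((fun v : rgcol => tns v one) : rgcol -> Tens)
  (GRing.isZmodMorphism.Build _ _ _ tns_is_zmod_morphism).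
rewrite -[LHS]/(t _) -[RHS]/(t _) !raddf_sum; apply: eq_bigr => j _.
move: (v j 0); apply: malg_additive_ext.
- by move=> x y; rewrite raddfB gr_section_is_zmod_morphism rgsingle_is_zmod_morphism raddfB.
- by move=> x y; rewrite rgsingle_is_zmod_morphism raddfB.
move=> a g; rewrite -[<< _ *g _ >>]/(gr a g) gr_functorE gr_section_gr in_image_phi.
have key h : tns (rgsingle j (gr a h)) one = tns (rgsingle j (gr 1 (coset_rep (phi h)))) (a * one).
  by rewrite rgsingle_gr tens_scale augmentationE.
rewrite -[LHS]/(tns (rgsingle j (gr a (coset_rep (phi g)))) one).
by rewrite -[RHS]/(tns (rgsingle j (gr a g)) one) !key coset_repE.
Qed.

Definition tensor_to_group_ring_bilinear (v : rgcol) (r : restr aug) : 'cV[RGa]_k :=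
  \col_i (gr_functor R phi (v i 0) * gr (r : R) 1%g).

Lemma tensor_to_group_ring_balanced : balanced tensor_to_group_ring_bilinear.
Proof.
split.
- by move=> r u v; apply/colP => i; rewrite !mxE rmorphD mulrDl.
- move=> v r s; apply/colP => i; rewrite !mxE -mulrDr; congr (_ * _).
  exact: (raddfD (@gr_const R Gamma)).
- move=> v a r; apply/colP => i; rewrite !mxE rmorphM gr_functor_ker_incl -mulrA gr_mulE mulg1.
  by [].
Qed.
Definition tensor_to_group_ring (t : Tens) : 'cV[RGa]_k := tens_lift tensor_to_group_ring_bilinear t.
Lemma tensor_to_group_ringE v r : tensor_to_group_ring (tns v r) = tensor_to_group_ring_bilinear v r.
Proof. exact: (tens_liftE tensor_to_group_ring_balanced). Qed.
Lemma tensor_to_group_ring_is_zmod_morphism : zmod_morphism tensor_to_group_ring.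
Proof. exact: (tens_lift_is_zmod_morphism tensor_to_group_ring_balanced). Qed.

Lemma tensor_to_group_ring_inj : injective tensor_to_group_ring.
Proof.
(* The left inverse of [tensor_to_group_ring]: moving r across the tensor sign turns v (x) r into (v
   r) (x) 1, to which [tens_gr_section] applies. *)
pose rho (w : 'cV[RGa]_k) : Tens := tns (\col_i gr_section (w i 0)) one.
have rhoB : zmod_morphism rho.
  move=> w w'; rewrite /rho -[RHS]tns_is_zmod_morphism; congr (tns _ one).
  by apply/colP => i; rewrite !mxE gr_section_is_zmod_morphism.
suff thetaK : cancel tensor_to_group_ring rho by exact: can_inj thetaK.
apply: tens_additive_ext.
- exact: zmod_morphism_comp rhoB tensor_to_group_ring_is_zmod_morphism.
- by [].
move=> v r; rewrite tensor_to_group_ringE /rho.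
have -> : tns v r = tns ((gr (r : R) 1%g : RN^c) *: v) one.
  by rewrite tens_scale augmentationE mulr1.
rewrite -[RHS]tens_gr_section; congr (tns _ one); apply/colP => i.
rewrite [LHS]mxE [RHS]mxE; congr gr_section.
by rewrite rgcol_scaleE rmorphM gr_functor_ker_incl augmentationE [LHS]mxE.
Qed.

Definition rgmul (F : 'M[RG]_k) (v : rgcol) : rgcol := F *m v.
Lemma rgmul_is_linear F : linear (rgmul F).
Proof.
move=> a u v; rewrite /rgmul mulmxDr; congr (_ + _).
apply/colP => i; rewrite rgcol_scaleE !mxE mulr_suml; apply: eq_bigr => j _.
by rewrite rgcol_scaleE mulrA.
Qed.
HB.instance Definition _ F := GRing.isLinear.Build RN^c rgcol rgcol *:%R (rgmul F)
  (rgmul_is_linear F).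

(** Under the embedding [tensor_to_group_ring], the base change of [F] along the augmentation
    becomes multiplication by the image of [F] over R[Gamma], which is 1. It is therefore injective,
    and Strebel's condition passes this on to [F]. *)
Lemma strebel_injective (F : 'M[RG]_k) : strebel R N ->
  map_mx (gr_functor R phi) F = 1%:M -> forall v : 'cV[RG]_k, F *m v = 0 -> v = 0.
Proof.
move=> str F1 v Fv; apply: (str rgcol rgcol (rgmul F)); last by rewrite linear0.
- exact: rgcol_projective.
- exact: rgcol_projective.
move=> t u tu; apply: tensor_to_group_ring_inj.
suff thF s : tensor_to_group_ring (bc_map aug (rgmul F) s) = tensor_to_group_ring s.
  by rewrite -thF tu thF.
move: s; apply: tens_additive_ext.
- apply: zmod_morphism_comp tensor_to_group_ring_is_zmod_morphism _.
  exact: tens_map_is_zmod_morphism.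
- exact: tensor_to_group_ring_is_zmod_morphism.
move=> w r; rewrite -[bc_map _ _ _]/(tens_map (rgmul F) idfun _) tens_mapE.
rewrite [LHS]tensor_to_group_ringE [RHS]tensor_to_group_ringE; apply/colP => i.
rewrite [LHS]mxE [RHS]mxE.
congr (_ * _); have := congr1 (fun M : 'M[RGa]_k => (M *m map_mx (gr_functor R phi) w) i 0) F1.
by rewrite -map_mxM mul1mx !mxE.
Qed.
End Kernel.

(** * Bases, base change and contractions *)

Section Bases.
Variables (A : pzRingType) (M : lmodType A^c).

(* The coordinates c m of m are written on the right: m = sum_j e_j . c_j. *)
Definition is_basis k (e : 'I_k -> M) (c : M -> 'cV[A]_k) : Prop :=
  [/\ forall m, m = \sum_j (c m j 0 : A^c) *: e j,
      forall m m', c (m + m') = c m + c m',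
      forall (a : A) m, c ((a : A^c) *: m) = \col_j (c m j 0 * a)
    & forall i, c (e i) = delta_mx i 0].

Lemma fg_free_basis : fg_free M -> exists k (e : 'I_k -> M) c, is_basis e c.
Proof.
move=> [k [f [g fK gK]]].
exists k, (fun j => f (delta_mx 0 j)), (fun m => \col_j (g m 0 j : A)).
have gD m m' : g (m + m') = g m + g m'.
  by apply: (can_inj fK); rewrite linearD !gK.
have gZ (a : A^c) m : g (a *: m) = a *: g m.
  by apply: (can_inj fK); rewrite linearZ !gK.
split.
- move=> m; rewrite -{1}(gK m) {1}[g m]row_sum_delta linear_sum.
  by apply: eq_bigr => j _; rewrite linearZ mxE.
- by move=> m m'; apply/colP => j; rewrite !mxE gD mxE.
- by move=> a m; apply/colP => j; rewrite !mxE gZ mxE.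
- by move=> i; apply/colP => j; rewrite !mxE fK mxE eqxx andbT.
Qed.
End Bases.

Section Tensors.
Local Open Scope quotient_scope.
Variables (A : pzRingType) (M : lmodType A^c) (N : lmodType A).

Lemma tens_sum (t : tensor M N) :
  exists s : seq (M * N), t = \sum_(p <- s) tens p.1 p.2.
Proof.
have [tDl tDr _] := tens_balanced M N.
have tB m : zmod_morphism (tens m : N -> tensor M N).
  by move=> x y; apply/eqP; rewrite eq_sym subr_eq -tDr subrK.
pose tm m : {additive N -> tensor M N} :=
  HB.pack (tens m : N -> tensor M N) (GRing.isZmodMorphism.Build _ _ _ (tB m)).
rewrite -[t](@reprK _ {ideal_quot (@tensor_null A M N : zmodClosed _)}).
move: (repr _) => x.
exists [seq (p.1, p.2 *~ x@_p) | p <- msupp x]; rewrite big_map /=.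
move: x; apply: (@malg_additive_ext int _ (tensor M N)
  (fun x => \pi_{ideal_quot (@tensor_null A M N : zmodClosed _)} x)
  (malg_lift (fun p z => tens p.1 (p.2 *~ z)))).
- by move=> x y; rewrite raddfB.
- by apply: malg_lift_is_zmod_morphism => p z z'; rewrite mulrzBr tB.
move=> z [m n]; rewrite malg_liftU => [|p a b]; last by rewrite mulrzBr tB.
rewrite -[RHS]/(tm m (n *~ z)) raddfMz /=.
have -> : << z *g (m, n) >> = << 1%Z *g (m, n) >> *~ z :> {malg int[(M * N)%type]}.
  by rewrite -raddfMz /= intz.
by rewrite raddfMz.
Qed.
End Tensors.

Section BaseChangeBasis.
Variables (A B : pzRingType) (f : {rmorphism A -> B}).

Section Coordinates.
Variables (M : lmodType A^c) (k : nat) (e : 'I_k -> M) (c : M -> 'cV[A]_k).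
Hypothesis ec : is_basis e c.

(** The coordinates of m (x) b in the basis e_j (x) 1 of the base change. *)
Definition cob_bilinear (m : M) (b : restr f) : 'cV[B]_k := \col_j (f (c m j 0) * (b : B)).
Lemma cob_balanced : balanced cob_bilinear.
Proof.
have [_ cD cZ _] := ec; split.
- by move=> b m m'; apply/colP => j; rewrite [LHS]mxE cD mxE rmorphD mulrDl !mxE.
- by move=> m b b'; apply/colP => j; rewrite !mxE mulrDr.
- by move=> m a b; apply/colP => j; rewrite [LHS]mxE cZ mxE rmorphM [RHS]mxE -mulrA.
Qed.
Definition cob (t : basechange f M) : 'cV[B]_k := tens_lift cob_bilinear t.
Lemma cobE m (b : restr f) : cob (tens m b) = \col_j (f (c m j 0) * (b : B)).
Proof. exact: (tens_liftE cob_balanced). Qed.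
Lemma cobB : zmod_morphism cob.
Proof. exact: (tens_lift_is_zmod_morphism cob_balanced). Qed.
Lemma cobD t u : cob (t + u) = cob t + cob u.
Proof. exact: (zmod_morphismD cobB). Qed.
Lemma cob0 : cob 0 = 0.
Proof. by rewrite -(subrr 0) cobB subrr. Qed.
Lemma cob_sum (I : Type) (s : seq I) (F : I -> basechange f M) :
  cob (\sum_(i <- s) F i) = \sum_(i <- s) cob (F i).
Proof. by elim/big_rec2: _ => [|i u v _ <-]; rewrite ?cob0 ?cobD. Qed.
Lemma cobZ (b : B) t : cob ((b : B^c) *: t) = \col_j (cob t j 0 * b).
Proof.
move: t; apply: (@tens_additive_ext _ _ _ _
  (fun t : basechange f M => cob ((b : B^c) *: t))
  (fun t : basechange f M => \col_j (cob t j 0 * b))).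
- by move=> t u; rewrite scalerBr cobB.
- by move=> t u; rewrite cobB; apply/colP => j; rewrite !mxE mulrBl.
move=> m n; rewrite -[_ *: _]/(bc_scale (b : B^c) (tens m n)) bc_scaleE !cobE.
by apply/colP => j; rewrite !mxE mulrA.
Qed.

Definition bcbasis j : basechange f M := tens (e j) ((1 : B) : restr f).

Lemma bc_scale_tens (b : B) m (x : restr f) :
  (b : B^c) *: (tens m x : basechange f M) = tens m (((x : B) * b) : restr f).
Proof. exact: bc_scaleE. Qed.

Lemma cob_basis j : cob (bcbasis j) = delta_mx j 0.
Proof.
have [_ _ _ ce] := ec; rewrite cobE; apply/colP => i; rewrite !mxE ce mxE mulr1.
by case: (_ && _); rewrite ?rmorph1 ?rmorph0.
Qed.

Lemma cob_expand t : t = \sum_j (cob t j 0 : B^c) *: bcbasis j.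
Proof.
have [me _ _ _] := ec; have [tDl tDr tZ] := tens_balanced M (restr f).
have F0 : zmod_morphism (fun t => \sum_j (cob t j 0 : B^c) *: bcbasis j).
  move=> t' u'; rewrite cobB -sumrB; apply: eq_bigr => j _.
  by rewrite !mxE scalerBl.
move: t; apply: (@tens_additive_ext _ _ _ (basechange f M) id _ _ F0) => //.
move=> m b; rewrite {1}(me m).
have -> : tens (\sum_j (c m j 0 : A^c) *: e j) b =
    \sum_j (tens ((c m j 0 : A^c) *: e j) b : basechange f M).
  have t0 : tens 0 b = 0 :> basechange f M.
    by apply: (@addIr _ (tens 0 b)); rewrite -tDl !add0r.
  by elim/big_rec2: _ => [|i u v _ <-]; rewrite ?t0 ?tDl.
apply: eq_bigr => j _; rewrite tZ cobE mxE bc_scale_tens mul1r.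
by [].
Qed.

Lemma cob_inj : injective cob.
Proof. by move=> t u tu; rewrite (cob_expand t) (cob_expand u) tu. Qed.

Lemma cob_linear_ext (Q : lmodType B^c) (u : {linear basechange f M -> Q}) t :
  u t = \sum_j (cob t j 0 : B^c) *: u (bcbasis j).
Proof.
by rewrite {1}(cob_expand t) linear_sum; apply: eq_bigr => j _; rewrite linearZ.
Qed.

Lemma linear_of_basis (Q : lmodType B^c) (y : 'I_k -> Q) :
  exists s : {linear basechange f M -> Q},
    forall t, s t = \sum_j (cob t j 0 : B^c) *: y j.
Proof.
pose s t := \sum_j (cob t j 0 : B^c) *: y j.
have s_lin : linear s.
  move=> b t u; rewrite /s scaler_sumr -big_split; apply: eq_bigr => j _ /=.
  by rewrite cobD cobZ !mxE scalerDl scalerA.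
pose sl : {linear basechange f M -> Q} :=
  HB.pack s (GRing.isLinear.Build B^c (basechange f M) Q *:%R s s_lin).
by exists sl.
Qed.
End Coordinates.

Section Maps.
Variables (M M' : lmodType A^c) (u : {linear M -> M'}).
Variables (k k' : nat) (e : 'I_k -> M) (c : M -> 'cV[A]_k).
Variables (e' : 'I_k' -> M') (c' : M' -> 'cV[A]_k').
Hypotheses (ec : is_basis e c) (ec' : is_basis e' c').

Definition linmat : 'M[A]_(k', k) := \matrix_(i, j) c' (u (e j)) i 0.

Lemma coord_sum (I : Type) (s : seq I) (F : I -> M') :
  c' (\sum_(i <- s) F i) = \sum_(i <- s) c' (F i).
Proof.
have [_ cD _ _] := ec'; have c0 : c' 0 = 0.
  by apply: (@addIr _ (c' 0)); rewrite -cD !add0r.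
by elim/big_rec2: _ => [|i v w _ <-]; rewrite ?c0 ?cD.
Qed.

Lemma linmatE m : c' (u m) = linmat *m c m.
Proof.
have [me _ _ _] := ec; have [_ _ cZ _] := ec'.
rewrite {1}(me m) linear_sum coord_sum; apply/colP => i; rewrite summxE mxE.
by apply: eq_bigr => j _; rewrite linearZ_LR cZ !mxE.
Qed.

Lemma cob_bc_map t : cob c' (bc_map f u t) = map_mx f linmat *m cob c t.
Proof.
move: t; apply: (@tens_additive_ext _ _ _ _
  (fun t : basechange f M => cob c' (bc_map f u t))
  (fun t : basechange f M => map_mx f linmat *m cob c t)).
- by move=> t v; rewrite linearB (cobB ec').
- by move=> t v; rewrite (cobB ec) mulmxBr.
move=> m b; rewrite [bc_map _ _ _]tens_mapE (cobE ec') (cobE ec) linmatE.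
apply/colP => i; rewrite [LHS]mxE mxE rmorph_sum mulr_suml mxE.
by apply: eq_bigr => j _; rewrite rmorphM !mxE mulrA.
Qed.
End Maps.

(** A substitute for a basis when [M] need not be free or finitely generated, as in degree n + 1:
    finitely many tensors involve finitely many elements [q] of [M], of which neither independence
    nor generation is asked. *)
Lemma finite_tensor_family (M : lmodType A^c) k (y : 'I_k -> basechange f M) :
  exists m (q : 'I_m -> M) (X : 'M[B]_(m, k)),
    forall j, y j = \sum_l (tens (q l) (X l j : restr f) : basechange f M).
Proof.
have [_ tDr _] := tens_balanced M (restr f).
have tens0 m : tens m ((0 : B) : restr f) = 0 :> basechange f M.
  by apply: (@addIr _ (tens m (0 : restr f))); rewrite -tDr !add0r.
elim: k y => [|k IHk] y.
  by exists 0%N, (fun _ => 0), 0; case.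
have [m [q [X qX]]] := IHk (fun j => y (lift ord0 j)).
have [s sE] := tens_sum (y ord0).
pose p := size s; pose nth_s (l : 'I_p) := nth (0, 0) s l.
exists (p + m)%N, (fun l : 'I_(p + m) =>
  match fintype.split l with inl l => (nth_s l).1 | inr l => q l end).
exists (\matrix_(l, j) match fintype.split l with
  | inl l => if unlift ord0 j is Some _ then 0 else ((nth_s l).2 : B)
  | inr l => if unlift ord0 j is Some i then X l i else 0 end) => j.
rewrite big_split_ord /=.
have lrow (l : 'I_p) : fintype.split (lshift m l) = inl l by exact: (unsplitK (inl l)).
have rrow (l : 'I_m) : fintype.split (rshift p l) = inr l by exact: (unsplitK (inr l)).
case: (unliftP ord0 j) => [i ->|->].
  rewrite big1 ?add0r => [|l _]; last by rewrite mxE lrow liftK tens0.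
  by rewrite qX; apply: eq_bigr => l _; rewrite mxE rrow liftK.
rewrite [X in _ + X]big1 ?addr0 => [|l _]; last by rewrite mxE rrow unlift_none tens0.
rewrite sE (big_nth (0, 0)) big_mkord; apply: eq_bigr => l _.
by rewrite mxE lrow unlift_none.
Qed.
End BaseChangeBasis.

Section Homology.
Variables (A : pzRingType) (C : chain_complex A).

Definition cycle_class i (x : chain C i) (dx : bdry C i (i - 1) x = 0) : homology C i :=
  quotmod_pi _ (Sub x (introT eqP dx) : cycles (bdry C i (i - 1))).

Lemma homology_trivialP i : trivial_module (homology C i) ->
  forall x : chain C i, bdry C i (i - 1) x = 0 -> exists y, bdry C (i + 1) i y = x.
Proof.
move=> triv x dx; have : cycle_class dx = cycle_class (linear0 (bdry C i (i - 1))).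
  by rewrite [LHS]triv [RHS]triv.
move/quotmod_piP; rewrite unfold_in => /asboolP [y yE].
by exists y; rewrite yE /= subr0.
Qed.
End Homology.

Lemma null_linear (A : pzRingType) (U V : lmodType A) :
  exists s : {linear U -> V}, forall x, s x = 0.
Proof.
have z_lin : linear (fun _ : U => 0 : V) by move=> a x y; rewrite scaler0 addr0.
pose z : {linear U -> V} := HB.pack (fun _ : U => 0 : V)
  (GRing.isLinear.Build A U V *:%R (fun _ => 0) z_lin).
by exists z.
Qed.

Section Contraction.
Variables (A B : pzRingType) (f : {rmorphism A -> B}) (C : chain_complex A^c).

(** The weak form d s d = d of a contraction is all that the next degree requires. Source and target
    are separate variables, which avoids identifying degree i + 1 - 1 with i. *)
Definition has_splitting (l i : int) : Prop :=
  exists s : {linear bc_chain f C l -> bc_chain f C i},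
    forall x, bc_bdry f C i l (s (bc_bdry f C i l x)) = bc_bdry f C i l x.

Lemma basechange_trivial (M : lmodType A^c) :
  trivial_module M -> trivial_module (basechange f M).
Proof.
have [tD _ _] := tens_balanced M (restr f).
move=> M0; apply: (@tens_additive_ext _ _ _ (basechange f M) id (fun=> 0)) => //.
  by move=> x y; rewrite subr0.
by move=> m b; apply: (@addIr _ (tens m b)); rewrite -tD (M0 (m + m)) (M0 m) add0r.
Qed.

(* The cycle x - s d x is a boundary; lifting it on a basis extends the contraction
   by one degree. *)
Lemma contraction_step i : fg_free (chain C i) ->
  trivial_module (homology (bc_complex f C) i) ->
  forall s : {linear bc_chain f C (i - 1) -> bc_chain f C i},
  (forall x, bc_bdry f C i (i - 1) (s (bc_bdry f C i (i - 1) x)) = bc_bdry f C i (i - 1) x) ->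
  exists t : {linear bc_chain f C i -> bc_chain f C (i + 1)},
    forall x, bc_bdry f C (i + 1) i (t x) = x - s (bc_bdry f C i (i - 1) x).
Proof.
move=> /fg_free_basis [k [e [c ec]]] triv s sP.
have /choice [y yP] : forall j, exists y : bc_chain f C (i + 1),
    bc_bdry f C (i + 1) i y = bcbasis f e j - s (bc_bdry f C i (i - 1) (bcbasis f e j)).
  move=> j; apply: (homology_trivialP triv).
  by rewrite [LHS](linearB (bc_bdry f C i (i - 1))) sP subrr.
have [t tE] := linear_of_basis f ec y; exists t => x.
pose sd : {linear bc_chain f C i -> bc_chain f C i} := s \o bc_bdry f C i (i - 1).
have sdx : s (bc_bdry f C i (i - 1) x) = _ := cob_linear_ext ec sd x.
rewrite tE linear_sum sdx [X in _ = X - _](cob_expand ec x) -sumrB.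
by apply: eq_bigr => j _; rewrite linearZ_LR yP scalerBr.
Qed.

Lemma splitting_step i : fg_free (chain C i) ->
  trivial_module (homology (bc_complex f C) i) ->
  has_splitting (i - 1) i -> has_splitting i (i + 1).
Proof.
move=> free triv [s sP]; have [t tP] := contraction_step free triv sP.
exists t => x; rewrite tP bc_bdry_bdry linear0 subr0.
by [].
Qed.

Lemma splitting_exists (n : int) : bounded_below C ->
  (forall i : int, i <= n -> fg_free (chain C i)) ->
  (forall i : int, i <= n -> trivial_module (homology (bc_complex f C) i)) ->
  forall i : int, i <= n + 1 -> has_splitting (i - 1) i.
Proof.
move=> [b bP] free triv.
(* The induction starts where the target of d_i is zero, and [s] = 0 serves. *)
have low i : i <= b -> has_splitting (i - 1) i.
  move=> ib; have [z zP] := null_linear (bc_chain f C (i - 1)) (bc_chain f C i).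
  have triv1 : trivial_module (bc_chain f C (i - 1)).
    by apply: basechange_trivial; apply: bP; lia.
  by exists z => x; rewrite [LHS]triv1 [RHS]triv1.
suff step (m : nat) : b + m%:Z <= n + 1 -> has_splitting (b + m%:Z - 1) (b + m%:Z).
  move=> i ilt; have [/low //|bi] := leP i b.
  have -> : i = b + `|i - b|%N%:Z by lia.
  by apply: step; lia.
elim: m => [_|m IHm lt]; first by rewrite addr0; apply: low.
have := @splitting_step (b + m%:Z); have -> : b + m.+1%:Z = b + m%:Z + 1 by lia.
by rewrite addrK; apply; [apply: free; lia|apply: triv; lia|apply: IHm; lia].
Qed.

(** The identity d t + s d = 1 in degree i, read on a basis. The vectors t(e_j) are written with
    finitely many elements [q] and coefficients [X]; [Y] is the matrix of s. *)
Lemma contraction_matrices (n : int) : bounded_below C ->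
  (forall i : int, i <= n -> fg_free (chain C i)) ->
  (forall i : int, i <= n -> trivial_module (homology (bc_complex f C) i)) ->
  forall i : int, i <= n ->
  exists k (e : 'I_k -> chain C i) (c : chain C i -> 'cV[A]_k)
    k' (e' : 'I_k' -> chain C (i - 1)) (c' : chain C (i - 1) -> 'cV[A]_k')
    m (q : 'I_m -> chain C (i + 1)) (X : 'M[B]_(m, k)) (Y : 'M[B]_(k, k')),
  [/\ is_basis e c, is_basis e' c' &
    map_mx f (\matrix_(r, l) c (bdry C (i + 1) i (q l)) r 0) *m X +
    Y *m map_mx f (linmat (bdry C i (i - 1)) e c') = 1%:M].
Proof.
move=> bb free triv i ilt.
have [s sP] : has_splitting (i - 1) i by apply: splitting_exists (bb) free triv _ _; lia.
have [t tP] := contraction_step (free i ilt) (triv i ilt) sP.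
have [k [e [c ec]]] := fg_free_basis (free i ilt).
have [k' [e' [c' ec']]] : exists k (e : 'I_k -> chain C (i - 1)) c, is_basis e c.
  by apply/fg_free_basis/free; lia.
have [m [q [X qX]]] := finite_tensor_family (fun j => t (bcbasis f e j)).
pose Y : 'M[B]_(k, k') := \matrix_(j, l) cob c (s (bcbasis f e' l)) j 0.
exists k, e, c, k', e', c', m, q, X, Y; split=> //.
have sY x : cob c (s x) = Y *m cob c' x.
  rewrite (cob_linear_ext ec') (cob_sum ec); apply/colP => j; rewrite summxE mxE.
  by apply: eq_bigr => l _; rewrite (cobZ ec) !mxE.
have dE l (b : restr f) : cob c (bc_bdry f C (i + 1) i (tens (q l) b)) =
    \col_r (f (c (bdry C (i + 1) i (q l)) r 0) * (b : B)).
  by rewrite [bc_bdry _ _ _ _ _]tens_mapE (cobE ec).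
apply/matrixP => r j.
have := congr1 (fun x => cob c x r 0) (tP (bcbasis f e j)).
rewrite (cobB ec) sY (cob_bc_map _ ec ec') (cob_basis f ec) qX linear_sum (cob_sum ec).
rewrite mulmxA -colE; move: (Y *m _) => Z; rewrite summxE !mxE eqxx andbT => eqZ.
rewrite -[RHS](subrK (Z r j)) -eqZ; congr (_ + _).
by apply: eq_bigr => l _; rewrite dE !mxE.
Qed.
End Contraction.

(** * The dimension of the homology *)

Section ZeroSubmodule.
Variables (A : pzRingType) (M : lmodType A).
Definition zero_pred : {pred M} := fun x => x == 0.
Lemma zero_submod_closed : GRing.subsemimod_closed zero_pred.
Proof.
split; first split; rewrite ?unfold_in /zero_pred ?eqxx //.
  by move=> x y; rewrite !unfold_in => /eqP -> /eqP ->; rewrite addr0.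
by move=> a x; rewrite !unfold_in => /eqP ->; rewrite scaler0.
Qed.
HB.instance Definition _ := GRing.isSubmodClosed.Build A M zero_pred zero_submod_closed.

Lemma zero_submod_trivial : trivial_module (submod (zero_pred : submodClosed M)).
Proof. by move=> x; apply: val_inj; apply/eqP; exact: (valP x). Qed.
End ZeroSubmodule.

Section TrivialModules.
Variable A : pzRingType.
Lemma trivial_isomorphic (M N : lmodType A) :
  trivial_module M -> trivial_module N -> isomorphic M N.
Proof.
move=> M0 N0; have [z z0] := null_linear M N.
exists z; exists (fun _ => 0) => x; first by rewrite [RHS]M0.
by rewrite [RHS]N0.
Qed.

Lemma trivial_projective (M : lmodType A) : trivial_module M -> projective M.
Proof.
move=> M0 U V p h _; have [z z0] := null_linear M U.
by exists z => x; rewrite /= (M0 x) !linear0.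
Qed.

Lemma trivial_fg (M : lmodType A) : trivial_module M -> finitely_generated M.
Proof.
by move=> M0; exists 0%N, (fun _ => 0) => x; exists (fun _ => 0); rewrite big_ord0.
Qed.
End TrivialModules.

Section Dimension.
Variables (K : realType) (G : groupType).
Local Notation C := (K[i]).
Local Notation NG := (vna K G).

(** A projective submodule of [M] isomorphic to a column space is an injection of that column space
    into [M]. *)
Lemma l2dim_eq0 (M : lmodType NG^c) :
  (forall n (P : 'M[NG]_n) (g : {linear colspace P -> M}),
    projection_mx P -> injective g -> mtr P <= 0) ->
  l2dim M = 0%E.
Proof.
move=> le0; apply/eqP; rewrite eq_le; apply/andP; split.
  apply: ge_ereal_sup => _ [d [S [_ _ [n [P [Pproj [g bij_g] dE]]]]] <-].
  pose h : {linear colspace P -> M} := val \o g.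
  have h_inj : injective h by move=> x y /val_inj /(bij_inj bij_g).
  by rewrite lee_fin -lecR dE; exact: le0 Pproj h_inj.
(* The zero submodule, presented by the empty matrix, contributes the value 0; this gives the lower
   bound of the supremum. *)
apply: ereal_sup_ubound; exists 0 => //=; exists (@zero_pred _ M : submodClosed M).
have M0 := @zero_submod_trivial _ M; split.
- exact: trivial_fg.
- exact: trivial_projective.
exists 0%N, 0; split; last by rewrite big_ord0.
  by split; [rewrite mul0mx|case].
apply: trivial_isomorphic => // x; apply: val_inj; apply/matrixP; case=> //.
Qed.

Section ColumnSpace.
Variables (n : nat) (P : 'M[NG]_n).
Lemma colspace_mem (w : 'cV[NG]_n) : (P *m w : 'cV[NG^c]_n) \in colspace_pred P.
Proof. by apply/asboolP; exists w. Qed.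
Definition colspace_elt (w : 'cV[NG]_n) : colspace P := Sub (P *m w : 'cV[NG^c]_n) (colspace_mem w).

Lemma colspace_elt_expand (w : 'cV[NG]_n) :
  colspace_elt w = \sum_j (w j 0 : NG^c) *: colspace_elt (delta_mx j 0).
Proof.
apply: val_inj; rewrite linear_sum /=; apply/matrixP => i l; rewrite ord1 summxE mxE.
by apply: eq_bigr => j _; rewrite mxE -colE mxE.
Qed.
End ColumnSpace.
End Dimension.

Section Main.
Variables (K : realType) (G : groupType).
Local Notation NG := (vna K G).
Local Notation ZG := (grpring int G).
Local Notation vg := (vna_of_gr K G).

Section Lift.
Variables (R : comNzRingType) (Gamma : groupType) (phi : {multiplicative G -> Gamma}).

Lemma gr_section0 : gr_section phi (0 : grpring R Gamma) = 0.
Proof. by rewrite -(subrr 0) gr_section_is_zmod_morphism subrr. Qed.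

Lemma gr_sectionD : {morph @gr_section R G Gamma phi : x y / x + y}.
Proof. exact: zmod_morphismD (@gr_section_is_zmod_morphism R G Gamma phi). Qed.

Lemma gr_functor_gr_section_sum (I : Type) (s : seq I) (F : I -> grpring R Gamma) :
  gr_functor R phi (gr_section phi (\sum_(i <- s) F i)) =
  \sum_(i <- s) gr_functor R phi (gr_section phi (F i)).
Proof.
by elim/big_rec2: _ => [|i u v _ <-]; rewrite ?gr_section0 ?rmorph0 // gr_sectionD rmorphD.
Qed.

(** [gr_section] does not respect products, but followed by [gr_functor] it is a Z[G]-bilinear
    projection onto R[phi(G)] that fixes 1. It can therefore be applied to the given identity entry
    by entry. *)
Lemma lift_identity k' k m (E : 'M[ZG]_(k, m)) (D : 'M[ZG]_(k', k))
    (X : 'M[grpring R Gamma]_(m, k)) (Y : 'M[grpring R Gamma]_(k, k')) :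
  map_mx (gr_map R phi) E *m X + Y *m map_mx (gr_map R phi) D = 1%:M ->
  map_mx (gr_functor R phi) (map_mx (gr_of_int R G) E *m map_mx (gr_section phi) X +
    map_mx (gr_section phi) Y *m map_mx (gr_of_int R G) D) = 1%:M.
Proof.
move=> XY; have -> : 1%:M = map_mx (fun x => gr_functor R phi (gr_section phi x)) 1%:M
    :> 'M[grpring R Gamma]_k.
  apply/matrixP => i j; rewrite !mxE; case: (i == j).
    by rewrite mulr1n gr1E gr_functor_gr_section_gr -(gmul_one phi) in_image_phi.
  by rewrite mulr0n gr_section0 rmorph0.
rewrite -XY; apply/matrixP => i j; rewrite mxE [in RHS]mxE.
rewrite [in LHS]mxE rmorphD [in RHS]mxE.
rewrite gr_sectionD rmorphD; congr (_ + _).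
  rewrite !mxE rmorph_sum gr_functor_gr_section_sum; apply: eq_bigr => l _.
  by rewrite rmorphM !mxE -gr_map_gr_functor gr_functor_gr_section_mull.
rewrite !mxE rmorph_sum gr_functor_gr_section_sum; apply: eq_bigr => l _.
by rewrite rmorphM !mxE -gr_map_gr_functor gr_functor_gr_section_mulr.
Qed.
End Lift.

(** The columns of [A0] are coordinates of cycles representing the images under [g] of the
    generators of the column space. If A v = E u, the cycle with coordinates A v is a boundary, so
    [g] kills the class of P v, and injectivity gives P v = 0. *)
Lemma embedding_matrix (C : chain_complex ZG^c) i k (e : 'I_k -> chain C i) c
    k' (e' : 'I_k' -> chain C (i - 1)) c' m (q : 'I_m -> chain C (i + 1))
    n (P : 'M[NG]_n) (g : {linear colspace P -> homology (bc_complex vg C) i}) :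
  is_basis e c -> is_basis e' c' -> P *m P = P -> injective g ->
  let E := \matrix_(r, l) c (bdry C (i + 1) i (q l)) r 0 in
  let D := linmat (bdry C i (i - 1)) e c' in
  exists A : 'M[NG]_(k, n), [/\ map_mx vg D *m A = 0, A *m P = A &
    forall (v : 'cV_n) (u : 'cV_m), A *m v = map_mx vg E *m u -> P *m v = 0].
Proof.
move=> ec ec' PP ginj E D.
set dB := bdry (bc_complex vg C) i (i - 1).
have /choice [z zP] : forall j, exists z : cycles dB,
    (quotmod_pi _ z : homology (bc_complex vg C) i) = g (colspace_elt P (delta_mx j 0)).
  by move=> j; exists (repr (g (colspace_elt P (delta_mx j 0)))); exact: quotmod_piK.
pose A0 : 'M[NG]_(k, n) := \matrix_(r, j) cob c (val (z j)) r 0.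
pose zeta (w : 'cV[NG]_n) : cycles dB := \sum_j (w j 0 : NG^c) *: z j.
have zeta_class w : (quotmod_pi _ (zeta w) : homology (bc_complex vg C) i) = g (colspace_elt P w).
  rewrite colspace_elt_expand linear_sum.
  pose pi : {additive cycles dB -> homology (bc_complex vg C) i} :=
    HB.pack (fun x : cycles dB => quotmod_pi _ x : homology (bc_complex vg C) i)
      (GRing.isZmodMorphism.Build _ _ _ (@quotmod_pi_is_zmod_morphism _ _ _)).
  rewrite -[LHS]/(pi _) raddf_sum; apply: eq_bigr => j _.
  by rewrite linearZ_LR -zP -[RHS]/(quotmod_scale _ _) quotmod_scale_pi.
have zeta_coord w : cob c (val (zeta w)) = A0 *m w.
  rewrite /zeta raddf_sum (cob_sum ec); apply/colP => r; rewrite summxE mxE.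
  apply: eq_bigr => j _; transitivity (cob c ((w j 0 : NG^c) *: val (z j)) r 0) => //.
  by rewrite (cobZ ec) !mxE.
have DA0 : map_mx vg D *m A0 = 0.
  apply/matrixP => r j; rewrite [RHS]mxE.
  have -> : (map_mx vg D *m A0) r j = (map_mx vg D *m cob c (val (z j))) r 0.
    by rewrite !mxE; apply: eq_bigr => l _; rewrite !mxE.
  rewrite -(cob_bc_map _ ec ec'); have /eqP := valP (z j).
  by rewrite -[bc_map _ _ _]/(dB (val (z j))) => ->; rewrite (cob0 vg ec') mxE.
(* The representatives were chosen independently of the relations among the generators;
   multiplication by [P] enforces A P = A. *)
exists (A0 *m P); split; first by rewrite mulmxA DA0 mul0mx.
  by rewrite -mulmxA PP.
move=> v u; rewrite -mulmxA -zeta_coord => zE.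
pose y : basechange vg (chain C (i + 1)) := \sum_l tens (q l) (u l 0 : restr vg).
have yE : bdry (bc_complex vg C) (i + 1) i y = val (zeta (P *m v)).
  apply: (cob_inj ec); rewrite zE -[bdry _ _ _ _]/(bc_map vg (bdry C (i + 1) i) y).
  rewrite linear_sum (cob_sum ec); apply/colP => r; rewrite summxE mxE.
  apply: eq_bigr => l _.
  transitivity (cob c (tens (bdry C (i + 1) i (q l)) (u l 0 : restr vg)) r 0).
    by congr (cob c _ r 0); exact: tens_mapE.
  by rewrite (cobE ec) !mxE.
have zeta0 : zeta 0 = 0 by apply: big1 => j _; rewrite mxE scale0r.
have /ginj /(congr1 val) /= : g (colspace_elt P (P *m v)) = g (colspace_elt P 0).
  rewrite -!zeta_class zeta0; apply/quotmod_piP; rewrite subr0 unfold_in.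
  by apply/asboolP; exists y.
by rewrite mulmxA PP mulmx0.
Qed.
End Main.

Theorem theorem6p6 (K : realType) (R : comNzRingType) (G Gamma : groupType)
    (phi : {multiplicative G -> Gamma}) (n : int)
    (C : chain_complex (grpring int G)^c) :
  countable [set: G]%classic ->
  amenable K G ->
  strebel R (gker phi) ->
  bounded_below C ->
  (forall i : int, i <= n -> fg_free (chain C i)) ->
  (forall i : int, i <= n ->
    trivial_module (homology (bc_complex (gr_map R phi) C) i)) ->
  forall i : int, i <= n ->
    l2dim (homology (bc_complex (vna_of_gr K G) C) i) = 0%E.
Proof.
move=> _ amen str bb free triv i ilt.
have [k [e [c [k' [e' [c' [m [q [X [Y [ec ec' XY]]]]]]]]]]] :=
  contraction_matrices bb free triv ilt.
set E := (X in map_mx _ X *m _) in XY; set D := linmat _ _ _ in XY.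
have DE : D *m E = 0.
  apply/matrixP => r l; rewrite [RHS]mxE.
  have -> : (D *m E) r l = (D *m c (bdry C (i + 1) i (q l))) r 0.
    by rewrite !mxE; apply: eq_bigr => j _; rewrite !mxE.
  rewrite -(linmatE _ ec ec') bdry_bdry.
  have [_ cD _ _] := ec'; have -> : c' 0 = 0.
    by apply: (@addIr _ (c' 0)); rewrite -cD !add0r.
  by rewrite mxE.
have Finj := strebel_injective str (lift_identity XY).
have [JE JEP _] := kernel_projection_exists (map_mx (vna_of_gr K G) E).
have [JD JDP _] := kernel_projection_exists (map_mx (vna_of_gr K G) D).
have traces : mtr JE + mtr JD <= m%:R.
  have [JEd JEJE EJE _] := JEP; have [JDd JDJD DJD _] := JDP.
  exact: (kernel_trace_bound amen Finj).
apply: l2dim_eq0 => p P g /projection_mx_dag [Pd PP] ginj.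
have [A [DA AP Ainj]] := embedding_matrix q ec ec' PP ginj.
apply: (trace_le0_of_homology_embedding JDP JEP _ DA AP Pd PP Ainj traces).
by rewrite -map_mxM DE map_mx0.
Qed.
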